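(* Let $d\ge 1$, $h>0$, and let $u\in C^1([0,1];\ell^2((h\mathbb Z)^d))$ be a solution to $$\partial_t u_j(t)=\Delta_{\mathrm d} u_j(t)+V_j(t)u_j(t),\qquad j\in\mathbb Z^d,\ t\in[0,1],$$ where $V:(h\mathbb Z)^d\times[0,1]\to\mathbb R$ is bounded, and where $\|V\|_\infty$ and $\|u\|_2$ are finite and independent of $h$. \begin{enumerate} \item Let $\gamma>0$ and assume that $$h^d\sum_{j\in\mathbb Z^d}\prod_{k=1}^d\frac{K_{j_k}^2(\gamma/h^2)}{K_0^2(\gamma/h^2)}\big(|u_j(0)|^2+|u_j(1)|^2\big)<\infty$$ uniformly with respect to $h$. Then there exist $C,h_0>0$ such that if $\gamma<C$ and $h\in(0,h_0)$, then $u\equiv 0$. \item There exists $\mu_0=\mu_0(d)$ such that if, for some $\mu>\mu_0$, $$h^d\sum_{j\in\mathbb Z^d}\prod_{k=1}^d\frac{K_{j_k\mu}\big(\frac{2}{eh^2}\big)}{K_0\big(\frac{2}{eh^2}\big)}\big(|u_j(0)|^2+|u_j(1)|^2\big)<\infty,$$ then $u\equiv0$. \end{enumerate}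
   Context: For $h>0$ and $d\ge1$, a function $f$ on the lattice $(h\mathbb Z)^d$ is indexed by $j\in\mathbb Z^d$ via $f_j:=f(hj)$; for time-dependent functions $u_j(t):=u(hj,t)$. The discrete Laplacian is $\Delta_{\mathrm d}f_j:=h^{-2}\sum_{k=1}^d(f_{j+e_k}-2f_j+f_{j-e_k})$, where $e_k$ is the $k$-th unit vector. The norm on $\ell^2((h\mathbb Z)^d)$ is $\|f\|_{\ell^2}=(h^d\sum_{j}|f_j|^2)^{1/2}$. Also $\|V\|_\infty:=\sup_{j\in\mathbb Z^d,t\in[0,1]}|V_j(t)|$ and $\|u\|_2:=(h^d\int_0^1\sum_{j\in\mathbb Z^d}|u_j(t)|^2dt)^{1/2}$. $K_\nu$ denotes the Macdonald function (modified Bessel function of the second kind) of order $\nu$, $K_\nu(z)=\int_0^\infty e^{-z\cosh s}\cosh(\nu s)\,ds$ for $z>0$. *)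

(* Defs.v *)
From Stdlib Require Import Reals Lra ZArith List.
From Coquelicot Require Import Coquelicot.
Import ListNotations.
Open Scope R_scope.

Definition lat_pt (d : nat) (j : list Z) : Prop := length j = d.

Fixpoint lat_add (j : list Z) (k : nat) (z : Z) : list Z :=
  match j, k with
  | nil, _ => nil
  | a :: j', O => (a + z)%Z :: j'
  | a :: j', S k' => a :: lat_add j' k' z
  end.

Definition zrange (n : nat) : list Z :=
  map (fun i => (Z.of_nat i - Z.of_nat n)%Z) (seq 0 (2 * n + 1)).

Fixpoint box (d n : nat) : list (list Z) :=
  match d with
  | O => [nil]
  | S d' => flat_map (fun z => map (cons z) (box d' n)) (zrange n)
  end.

Definition finsum {A : Type} (F : A -> R) (l : list A) : R :=
  fold_right (fun a acc => F a + acc) 0 l.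

(* Sum over Z^d of a NONNEGATIVE family, as an extended real
   (supremum of the sums over the boxes [-n,n]^d). *)
Definition lat_sum (d : nat) (F : list Z -> R) : Rbar :=
  Sup_seq (fun n => Finite (finsum F (box d n))).

Definition l2sq (d : nat) (h : R) (f : list Z -> C) : Rbar :=
  Rbar_mult (Finite (h ^ d)) (lat_sum d (fun j => (Cmod (f j)) ^ 2)).

Definition disc_lap (d : nat) (h : R) (f : list Z -> C) (j : list Z) : C :=
  Cmult (RtoC (/ (h ^ 2)))
    (fold_right Cplus (RtoC 0)
       (map (fun k => Cplus (Cminus (f (lat_add j k 1%Z)) (Cmult (RtoC 2) (f j)))
                            (f (lat_add j k (-1)%Z)))
            (seq 0 d))).

Definition MacK (nu z : R) : R :=
  RInt_gen (fun s => exp (- z * cosh s) * cosh (nu * s))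
           (at_point 0) (Rbar_locally p_infty).

Definition is_C1_l2 (d : nat) (h : R) (u u' : R -> list Z -> C) : Prop :=
  (forall t, 0 <= t <= 1 ->
     Rbar_lt (l2sq d h (u t)) p_infty /\ Rbar_lt (l2sq d h (u' t)) p_infty) /\
  (forall t, 0 <= t <= 1 -> forall eps, 0 < eps -> exists delta, 0 < delta /\
     forall s, 0 <= s <= 1 -> 0 < Rabs (s - t) < delta ->
       Rbar_lt (l2sq d h (fun j => Cminus (Cmult (RtoC (/ (s - t))) (Cminus (u s j) (u t j)))
                                           (u' t j)))
               (Finite eps)) /\
  (forall t, 0 <= t <= 1 -> forall eps, 0 < eps -> exists delta, 0 < delta /\
     forall s, 0 <= s <= 1 -> Rabs (s - t) < delta ->
       Rbar_lt (l2sq d h (fun j => Cminus (u' s j) (u' t j))) (Finite eps)).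

Definition is_solution (d : nat) (h : R) (V : list Z -> R -> R) (u : R -> list Z -> C) : Prop :=
  exists u' : R -> list Z -> C,
    is_C1_l2 d h u u' /\
    forall t, 0 <= t <= 1 -> forall j, lat_pt d j ->
      u' t j = Cplus (disc_lap d h (u t) j) (Cmult (RtoC (V j t)) (u t j)).

Definition L2norm_sq (d : nat) (h : R) (u : R -> list Z -> C) : R :=
  RInt (fun t => real (l2sq d h (u t))) 0 1.

Definition weight1 (gam h : R) (j : list Z) : R :=
  fold_right Rmult 1
    (map (fun jk => (MacK (IZR jk) (gam / h ^ 2)) ^ 2 / (MacK 0 (gam / h ^ 2)) ^ 2) j).

Definition weight2 (mu h : R) (j : list Z) : R :=
  fold_right Rmult 1
    (map (fun jk => MacK (IZR jk * mu) (2 / (exp 1 * h ^ 2)) / MacK 0 (2 / (exp 1 * h ^ 2))) j).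

Definition weighted_data (d : nat) (h : R) (w : list Z -> R) (u : R -> list Z -> C) : Rbar :=
  Rbar_mult (Finite (h ^ d))
    (lat_sum d (fun j => w j * ((Cmod (u 0 j)) ^ 2 + (Cmod (u 1 j)) ^ 2))).

Definition vanishes (d : nat) (u : R -> list Z -> C) : Prop :=
  forall t, 0 <= t <= 1 -> forall j, lat_pt d j -> u t j = RtoC 0.

(* Main.v *)
(** Only the first coordinate [x] of a lattice point [x :: y] carries a weight, so all
transverse differences, the potential and the neighbour at [x + 1] are perturbations of bounded
norm, and with [N = / h ^ 2] the equation reads [u_x' = N u_(x-1) + F_x] with [|F| <= C |u|].
For a weight [W_x(t) = rprod r x / A(t)^x] the quantity [log (sum W |u|^2 + 1)] is convex in [t] up
to a constant, provided [S_t + [S,T]] is nonnegative, [S] and [T] being the symmetric and the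
antisymmetric part of the generator of [sqrt W u].
For [W_x = x!^2 / A^x] and [A(t) = s^2 (delta + (t - 1/2)^2)], [s = N / 10], this holds for every
[delta > 0], with constants independent of [delta]; at [t = 0, 1] these weights are dominated by
the Bessel weights of the data, because [K_(k+1)(z) >= (2k/z) K_k(z)]. Letting [delta] tend to [0]
forces [u_x(1/2) = 0] for [x >= 1], hence everywhere by translation, and then [u = 0] by
Gronwall's inequality, the discrete Laplacian being bounded.

The sums [sum W |u|^2] are not known to be finite at interior times. Hence [delta] decreases
by the factor [2/3] in each step of an induction, in which the growth of [W] is capped far out to
half the rate in [x]: this keeps the form nonnegative and the capped weight below the previous one. *)

Require Import Defs.
From Stdlib Require Import Reals ZArith List Lra Lia Psatz.
From Stdlib Require Import Classical FunctionalExtensionality.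
From Coquelicot Require Import Coquelicot.
Import ListNotations.
Open Scope R_scope.

(** * Finite sums over boxes *)

(** The convexity inequality can only be run on finite strips, and both truncations leave an error.
    The cut at [x = n] is paid by an a priori bound with a spare factor [2^x]; the transverse
    boundary is paid by a damping [q ^ l1norm y], whose ratio between neighbours is at most 2
    however close [q] is to 1. Both errors are made at most 1 and vanish, with the source coming
    from [x = -1], into the [+ 1] of [H + 1]. The a priori bound is thus used only qualitatively:
    the new bound depends on the data alone, and the induction on delta accumulates no constant.
    Rates of one step: lowering delta costs [(3/2)^x], the spare factor [2^x], and capping gains
    about [4^x]; 3 < 4 closes the step. The very first a priori bound comes from Gronwall, since
    capped ratios make a weight exponential. Squared factorials fit because their ratios
    [(x+1)^2 / A] have increments linear in [x], like the term [x p'] to be beaten, [p = A'/(2A)];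
    both [p^2] and [p'] are at most [1/(delta + (t-1/2)^2)], so delta cancels. As [s] is a fixed
    multiple of [N], also [h] scales out, and gamma has a threshold free of [h]. *)

Lemma finsum_ext {A} (F G : A -> R) l :
  (forall a, In a l -> F a = G a) -> finsum F l = finsum G l.
Proof.
  induction l as [|a l IH]; simpl; intros H; [reflexivity|].
  rewrite (H a) by now left. rewrite IH; [reflexivity|]. intros; apply H; now right.
Qed.

Lemma finsum_le {A} (F G : A -> R) l :
  (forall a, In a l -> F a <= G a) -> finsum F l <= finsum G l.
Proof.
  induction l as [|a l IH]; simpl; intros H; [lra|].
  apply Rplus_le_compat; [apply H; now left|]. apply IH; intros; apply H; now right.
Qed.

Lemma finsum_cons {A} (F : A -> R) a l : finsum F (a :: l) = F a + finsum F l.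
Proof. reflexivity. Qed.

Lemma finsum_zero {A} (l : list A) : finsum (fun _ => 0) l = 0.
Proof. induction l; simpl; lra. Qed.

Lemma finsum_nonneg {A} (F : A -> R) l : (forall a, In a l -> 0 <= F a) -> 0 <= finsum F l.
Proof. intros H. rewrite <- (finsum_zero l). now apply finsum_le. Qed.

Lemma finsum_plus {A} (F G : A -> R) l :
  finsum (fun a => F a + G a) l = finsum F l + finsum G l.
Proof. induction l; simpl; lra. Qed.

Lemma finsum_scal {A} (c : R) (F : A -> R) l : finsum (fun a => c * F a) l = c * finsum F l.
Proof. induction l; simpl; [ring|]. rewrite IHl; ring. Qed.

Lemma finsum_app {A} (F : A -> R) l1 l2 : finsum F (l1 ++ l2) = finsum F l1 + finsum F l2.
Proof. induction l1; simpl; lra. Qed.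

Lemma finsum_map {A B} (F : B -> R) (f : A -> B) l :
  finsum F (map f l) = finsum (fun a => F (f a)) l.
Proof. induction l; simpl; congruence. Qed.

Lemma finsum_flat_map {A B} (F : B -> R) (f : A -> list B) l :
  finsum F (flat_map f l) = finsum (fun a => finsum F (f a)) l.
Proof. induction l; simpl; [reflexivity|]. rewrite finsum_app; congruence. Qed.

Lemma finsum_swap {A B} (F : A -> B -> R) l1 l2 :
  finsum (fun a => finsum (F a) l2) l1 = finsum (fun b => finsum (fun a => F a b) l1) l2.
Proof.
  induction l1; simpl; [now rewrite finsum_zero|]. rewrite IHl1, finsum_plus; reflexivity.
Qed.

Lemma finsum_member {A} (F : A -> R) l a :
  (forall b, In b l -> 0 <= F b) -> In a l -> F a <= finsum F l.
Proof.
  induction l as [|b l IH]; simpl; intros H Ha; [easy|]. destruct Ha as [->|Ha].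
  - assert (0 <= finsum F l) by (apply finsum_nonneg; intros; apply H; now right). lra.
  - assert (0 <= F b) by (apply H; now left).
    assert (F a <= finsum F l) by (apply IH; [intros; apply H; now right|easy]). lra.
Qed.

Lemma finsum_sqr_le {A} (F : A -> R) l :
  (finsum F l) ^ 2 <= INR (length l) * finsum (fun a => F a ^ 2) l.
Proof.
  induction l as [|a l IH]; [simpl; lra|].
  change (length (a :: l)) with (S (length l)). rewrite S_INR, !finsum_cons.
  set (n := INR (length l)) in *. set (q := finsum (fun a => F a ^ 2) l) in *.
  set (m := finsum F l) in *. assert (0 <= n) by apply pos_INR.
  assert (0 <= q) by (apply finsum_nonneg; intros; apply pow2_ge_0).
  destruct (Req_dec n 0) as [Hn|Hn].
  - rewrite Hn, Rmult_0_l in IH. assert (Hm : m = 0) by nra. rewrite Hn, Hm.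
    generalize (pow2_ge_0 (F a)). lra.
  - assert (2 * F a * m <= n * F a ^ 2 + q).
    { apply Rmult_le_reg_l with n; [lra|].
      assert (0 <= (n * F a - m) ^ 2) by apply pow2_ge_0. nra. }
    nra.
Qed.

Lemma finsum_derive {A} (F dF : A -> R -> R) l t :
  (forall a, In a l -> is_derive (F a) t (dF a t)) ->
  is_derive (fun t => finsum (fun a => F a t) l) t (finsum (fun a => dF a t) l).
Proof.
  induction l as [|a l IH]; simpl; intros H.
  - apply (is_derive_const 0).
  - apply (is_derive_plus (F a)); [apply H; now left|]. apply IH; intros; apply H; now right.
Qed.

Lemma finsum_continuous {A} (F : A -> R -> R) l t :
  (forall a, In a l -> continuous (F a) t) ->
  continuous (fun t => finsum (fun a => F a t) l) t.
Proof.
  induction l as [|a l IH]; simpl; intros H.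
  - apply continuous_const.
  - apply (continuous_plus (F a)); [apply H; now left|]. apply IH; intros; apply H; now right.
Qed.

Lemma finsum_seq_S (F : nat -> R) n : finsum F (seq 0 (S n)) = finsum F (seq 0 n) + F n.
Proof. rewrite seq_S, finsum_app; simpl; ring. Qed.

Lemma finsum_seq_shift (F : nat -> R) n :
  finsum F (seq 0 (S n)) = F 0%nat + finsum (fun x => F (S x)) (seq 0 n).
Proof. simpl. rewrite <- seq_shift, finsum_map. reflexivity. Qed.

Lemma finsum_seq_le (F : nat -> R) n m :
  (n <= m)%nat -> (forall x, 0 <= F x) -> finsum F (seq 0 n) <= finsum F (seq 0 m).
Proof.
  intros Hnm HF. induction Hnm; [lra|]. rewrite finsum_seq_S. specialize (HF m). lra.
Qed.

Lemma finsum_zrange_S (G : Z -> R) n :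
  finsum G (zrange (S n)) =
  G (- Z.of_nat (S n))%Z + finsum G (zrange n) + G (Z.of_nat (S n)).
Proof.
  unfold zrange. rewrite !finsum_map.
  replace (2 * S n + 1)%nat with (S (S (2 * n + 1))) by lia.
  rewrite finsum_seq_S, finsum_seq_shift.
  cbv beta. apply f_equal2; [apply f_equal2|]; [f_equal; lia| |f_equal; lia].
  apply finsum_ext; intros; cbv beta; f_equal; lia.
Qed.

Lemma finsum_zrange_0 (G : Z -> R) : finsum G (zrange 0) = G 0%Z.
Proof. simpl. ring. Qed.

Lemma In_zrange z n : In z (zrange n) <-> (Z.abs z <= Z.of_nat n)%Z.
Proof.
  unfold zrange. rewrite in_map_iff. split.
  - intros (i & <- & Hi). apply in_seq in Hi. lia.
  - intros H. exists (Z.to_nat (z + Z.of_nat n)). split; [lia|]. apply in_seq; lia.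
Qed.

Lemma zrange_shift (G : Z -> R) n s :
  (forall z, 0 <= G z) -> s = 1%Z \/ s = (-1)%Z ->
  finsum (fun z => G (z + s)%Z) (zrange n) <= finsum G (zrange (S n)).
Proof.
  intros HG Hs.
  (* The shifted interval misses exactly two points of [[-(n+1), n+1]], both at the end opposite to
     the shift. As an equality this is inductive. *)
  assert (E : finsum (fun z => G (z + s)%Z) (zrange n) + G (- s * Z.of_nat n)%Z
              + G (- s * Z.of_nat (S n))%Z = finsum G (zrange (S n))).
  { induction n as [|n IH].
    - rewrite finsum_zrange_S, !finsum_zrange_0. destruct Hs as [->| ->]; simpl; lra.
    - rewrite finsum_zrange_S, (finsum_zrange_S G (S n)), <- IH. cbv beta.
      destruct Hs as [->| ->].
      + replace (- Z.of_nat (S n) + 1)%Z with (- (1) * Z.of_nat n)%Z by lia.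
        replace (Z.of_nat (S n) + 1)%Z with (Z.of_nat (S (S n))) by lia.
        replace (- Z.of_nat (S (S n)))%Z with (- (1) * Z.of_nat (S (S n)))%Z by lia. lra.
      + replace (Z.of_nat (S n) + -1)%Z with (- (-1) * Z.of_nat n)%Z by lia.
        replace (- Z.of_nat (S n) + -1)%Z with (- Z.of_nat (S (S n)))%Z by lia.
        replace (- (-1) * Z.of_nat (S (S n)))%Z with (Z.of_nat (S (S n))) by lia. lra. }
  generalize (HG (- s * Z.of_nat n)%Z) (HG (- s * Z.of_nat (S n))%Z). lra.
Qed.

Lemma finsum_box_S d n (G : list Z -> R) :
  finsum G (box (S d) n) = finsum (fun z => finsum (fun y => G (z :: y)) (box d n)) (zrange n).
Proof.
  simpl. rewrite finsum_flat_map. apply finsum_ext; intros. now rewrite finsum_map.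
Qed.

Lemma In_box d n j :
  In j (box d n) <-> length j = d /\ (forall z, In z j -> (Z.abs z <= Z.of_nat n)%Z).
Proof.
  revert j; induction d as [|d IH]; intros j.
  - simpl. split.
    + intros [<-|[]]; split; [reflexivity|easy].
    + intros [H _]. destruct j; [now left|discriminate].
  - simpl box. rewrite in_flat_map. split.
    + intros (z & Hz & Hj). apply in_map_iff in Hj as (y & <- & Hy).
      apply IH in Hy as [Hl Hy]. apply In_zrange in Hz. split; [simpl; lia|].
      intros z' [<-|Hz']; auto.
    + intros [Hl H]. destruct j as [|z y]; [discriminate|]. exists z. split.
      * apply In_zrange, H. now left.
      * apply in_map, IH. split; [simpl in Hl; lia|]. intros; apply H; now right.
Qed.

Lemma box_exists j : exists n, In j (box (length j) n).
Proof.
  induction j as [|z y [n Hn]].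
  - exists 0%nat. now left.
  - apply In_box in Hn as [_ Hn]. exists (n + Z.abs_nat z)%nat. apply In_box.
    split; [reflexivity|]. intros z' [<-|H]; [lia|]. specialize (Hn z' H). lia.
Qed.

Lemma box_length d n j : In j (box d n) -> length j = d.
Proof. intros H; now apply In_box in H. Qed.

Lemma zrange_le (G : Z -> R) n m :
  (n <= m)%nat -> (forall z, 0 <= G z) -> finsum G (zrange n) <= finsum G (zrange m).
Proof.
  intros Hnm HG; induction Hnm; [lra|]. rewrite finsum_zrange_S.
  generalize (HG (- Z.of_nat (S m))%Z) (HG (Z.of_nat (S m))). lra.
Qed.

Lemma box_le (G : list Z -> R) d n m :
  (n <= m)%nat -> (forall j, 0 <= G j) -> finsum G (box d n) <= finsum G (box d m).
Proof.
  intros Hnm. revert G; induction d as [|d IH]; intros G HG; [simpl; lra|].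
  rewrite !finsum_box_S.
  apply Rle_trans with (finsum (fun z => finsum (fun y => G (z :: y)) (box d m)) (zrange n)).
  - apply finsum_le; intros. now apply (IH (fun y => G (a :: y))).
  - apply zrange_le; [easy|]. intros; apply finsum_nonneg; auto.
Qed.

Lemma box_shift (G : list Z -> R) d n k s :
  (forall j, 0 <= G j) -> (k < d)%nat -> s = 1%Z \/ s = (-1)%Z ->
  finsum (fun j => G (lat_add j k s)) (box d n) <= finsum G (box d (S n)).
Proof.
  intros HG Hk Hs. revert G k HG Hk; induction d as [|d IH]; intros G k HG Hk; [lia|].
  rewrite !finsum_box_S. destruct k as [|k].
  - simpl lat_add.
    apply Rle_trans with
      (finsum (fun z => finsum (fun y => G ((z + s)%Z :: y)) (box d (S n))) (zrange n)).
    + apply finsum_le; intros. apply box_le; [lia|]. auto.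
    + apply (zrange_shift (fun z => finsum (fun y => G (z :: y)) (box d (S n)))); [|easy].
      intros; apply finsum_nonneg; auto.
  - simpl lat_add.
    apply Rle_trans with
      (finsum (fun z => finsum (fun y => G (z :: y)) (box d (S n))) (zrange n)).
    + apply finsum_le; intros z _. apply (IH (fun y => G (z :: y))); [auto|lia].
    + apply zrange_le; [lia|]. intros; apply finsum_nonneg; auto.
Qed.

(** A test rather than a sublist: a sum over the smaller box can then be written over the larger one
    and compared with it term by term. *)
Definition inbox (n : nat) (j : list Z) : bool :=
  forallb (fun z => (Z.abs z <=? Z.of_nat n)%Z) j.

Lemma finsum_inbox (G : list Z -> R) d n :
  finsum (fun j => if inbox n j then G j else 0) (box d (S n)) = finsum G (box d n).
Proof.
  revert G; induction d as [|d IH]; intros G; [reflexivity|].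
  rewrite !finsum_box_S, finsum_zrange_S.
  rewrite (finsum_ext _ (fun _ => 0) (box d (S n))).
  2:{ intros y _. simpl inbox. rewrite (proj2 (Z.leb_gt _ _)) by lia. reflexivity. }
  rewrite (finsum_ext (fun y => if inbox n (Z.of_nat (S n) :: y) then _ else _) (fun _ => 0)).
  2:{ intros y _. simpl inbox. rewrite (proj2 (Z.leb_gt _ _)) by lia. reflexivity. }
  rewrite !finsum_zero, Rplus_0_l, Rplus_0_r. apply finsum_ext; intros z Hz.
  apply In_zrange in Hz. rewrite <- IH. apply finsum_ext; intros y _.
  simpl inbox. rewrite (proj2 (Z.leb_le _ _)) by lia. reflexivity.
Qed.

Definition l1norm (j : list Z) : nat := fold_right (fun z a => (Z.abs_nat z + a)%nat) 0%nat j.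

Lemma inbox_false_l1norm n j : inbox n j = false -> (n < l1norm j)%nat.
Proof.
  induction j as [|z y IH]; simpl; [discriminate|]. intros H.
  apply Bool.andb_false_iff in H as [H|H].
  - apply Z.leb_gt in H. lia.
  - specialize (IH H). lia.
Qed.

Lemma l1norm_box d n j : In j (box d n) -> (l1norm j <= d * n)%nat.
Proof.
  intros H. apply In_box in H as [<- H]. induction j as [|z y IH]; simpl; [lia|].
  assert (Z.abs z <= Z.of_nat n)%Z by (apply H; now left).
  assert (l1norm y <= length y * n)%nat by (apply IH; intros; apply H; now right). lia.
Qed.

Lemma l1norm_lat_add j k s :
  s = 1%Z \/ s = (-1)%Z ->
  (l1norm (lat_add j k s) <= S (l1norm j) /\ l1norm j <= S (l1norm (lat_add j k s)))%nat.
Proof.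
  intros Hs. revert k; induction j as [|z y IH]; intros k; [destruct k; simpl; lia|].
  destruct k as [|k]; simpl; [lia|]. specialize (IH k). lia.
Qed.

Lemma length_lat_add j k s : length (lat_add j k s) = length j.
Proof. revert k; induction j; intros [|k]; simpl; auto. Qed.

(** A difference operator on a box reads one more layer. A point of that layer has a coordinate
    beyond [n], hence [l1norm] beyond [n], where the weight has dropped to [th]. *)
Lemma box_layer d n (Om g : list Z -> R) th :
  (forall j, 0 <= g j) -> (forall j, 0 <= Om j) -> 0 <= th ->
  (forall j, length j = d -> (n < l1norm j)%nat -> Om j <= th) ->
  finsum (fun j => Om j * g j) (box d (S n)) <=
  finsum (fun j => Om j * g j) (box d n) + th * finsum g (box d (S n)).
Proof.
  intros Hg HO Hth H. rewrite <- (finsum_inbox (fun j => Om j * g j) d n), <- finsum_scal, <- finsum_plus.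
  apply finsum_le; intros j Hj. specialize (Hg j). specialize (HO j).
  destruct (inbox n j) eqn:E.
  - nra.
  - apply inbox_false_l1norm in E. specialize (H j (box_length _ _ _ Hj) E). nra.
Qed.

(** Bernoulli's inequality for [q = 1 - 1/(2K+2)]. Such a [q] damps at infinity, yet changes a sum
    over a fixed box by at most a factor 2. *)
Lemma damping_exists (K : nat) : exists q, / 2 <= q < 1 /\ forall k, (k <= K)%nat -> / 2 <= q ^ k.
Proof.
  assert (HK : 0 <= INR K) by apply pos_INR.
  exists (1 - / (2 * INR K + 2)).
  assert (H1 : 0 < / (2 * INR K + 2) <= / 2).
  { split; [apply Rinv_0_lt_compat; lra|]. apply Rinv_le_contravar; lra. }
  split; [lra|]. intros k Hk. set (e := / (2 * INR K + 2)) in *.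
  assert (B : 1 - INR k * e <= (1 - e) ^ k).
  { clear Hk. induction k as [|k IH]; [simpl; lra|]. rewrite S_INR. simpl pow.
    assert (0 <= INR k) by apply pos_INR.
    assert ((1 - e) * (1 - INR k * e) <= (1 - e) * (1 - e) ^ k) by (apply Rmult_le_compat_l; lra).
    nra. }
  assert (INR k * e <= / 2).
  { apply le_INR in Hk. apply Rle_trans with (INR K * e); [apply Rmult_le_compat_r; lra|].
    unfold e. apply Rmult_le_reg_r with (2 * INR K + 2); [lra|].
    rewrite Rmult_assoc, Rinv_l by lra. lra. }
  lra.
Qed.

(** * Differential inequalities *)

Lemma derive_nonneg_incr (f : R -> R) (a b : R) :
  a <= b ->
  (forall t, a <= t <= b -> continuous f t) ->
  (forall t, a < t < b -> exists l : R, is_derive f t l /\ 0 <= l) ->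
  f a <= f b.
Proof.
  intros Hab Hc Hd.
  (* The intermediate point of the mean value theorem may be an endpoint, where [f] need not be
     differentiable; the value 0 there keeps the sign. *)
  set (df := fun t => if Rlt_dec a t then if Rlt_dec t b then Derive f t else 0 else 0).
  destruct (MVT_gen f a b df) as (c & _ & Hc').
  - intros t. rewrite Rmin_left, Rmax_right by lra. intros Ht.
    destruct (Hd t Ht) as (l & Hl & _). unfold df.
    destruct (Rlt_dec a t); [|lra]. destruct (Rlt_dec t b); [|lra].
    apply Derive_correct. now exists l.
  - intros t. rewrite Rmin_left, Rmax_right by lra. intros Ht.
    apply continuity_pt_filterlim, Hc, Ht.
  - assert (0 <= df c).
    { unfold df. destruct (Rlt_dec a c); [|lra]. destruct (Rlt_dec c b); [|lra].
      destruct (Hd c) as (l & Hl & Hl'); [lra|]. now rewrite (is_derive_unique _ _ _ Hl). }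
    nra.
Qed.

Lemma exp_weight_derive (g : R -> R) (c t l : R) :
  is_derive g t l -> is_derive (fun t => g t * exp (c * t)) t ((l + c * g t) * exp (c * t)).
Proof.
  intros H. assert (E : Derive (fun x => g x) t = l) by now apply is_derive_unique.
  auto_derive; [now exists l|]. rewrite E; ring.
Qed.

Lemma exp_weight_continuous (g : R -> R) (c t : R) :
  continuous g t -> continuous (fun t => g t * exp (c * t)) t.
Proof.
  intros H. apply (continuous_mult g); [exact H|].
  apply continuous_comp; [|apply continuous_exp].
  apply (continuous_mult (fun _ => c)); [apply continuous_const|apply continuous_id].
Qed.

Lemma gronwall_forward (g : R -> R) (c a b : R) :
  a <= b ->
  (forall t, a <= t <= b -> continuous g t) ->
  (forall t, a < t < b -> exists l : R, is_derive g t l /\ l <= c * g t) ->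
  g b <= exp (c * (b - a)) * g a.
Proof.
  intros Hab Hc Hd.
  assert (H : - (g a * exp (- c * a)) <= - (g b * exp (- c * b))).
  { apply (derive_nonneg_incr (fun t => - (g t * exp (- c * t))) a b); [easy| |].
    - intros t Ht. apply (continuous_opp (fun t => g t * exp (- c * t))).
      apply exp_weight_continuous; auto.
    - intros t Ht. destruct (Hd t Ht) as (l & Hl & Hle).
      exists (- ((l + - c * g t) * exp (- c * t))). split.
      + apply (is_derive_opp (fun t => g t * exp (- c * t))). now apply exp_weight_derive.
      + generalize (exp_pos (- c * t)). nra. }
  replace (c * (b - a)) with (- c * a + c * b) by ring. rewrite exp_plus.
  assert (E : exp (- c * b) * exp (c * b) = 1).
  { rewrite <- exp_plus. replace (- c * b + c * b) with 0 by ring. apply exp_0. }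
  assert (g b = g b * exp (- c * b) * exp (c * b)) by (rewrite Rmult_assoc, E; ring).
  rewrite H0. generalize (exp_pos (c * b)). nra.
Qed.

Lemma gronwall_backward (g : R -> R) (c a b : R) :
  a <= b ->
  (forall t, a <= t <= b -> continuous g t) ->
  (forall t, a < t < b -> exists l : R, is_derive g t l /\ - c * g t <= l) ->
  g a <= exp (c * (b - a)) * g b.
Proof.
  intros Hab Hc Hd.
  assert (H : g a * exp (c * a) <= g b * exp (c * b)).
  { apply (derive_nonneg_incr (fun t => g t * exp (c * t)) a b); [easy| |].
    - intros t Ht. apply exp_weight_continuous; auto.
    - intros t Ht. destruct (Hd t Ht) as (l & Hl & Hle).
      exists ((l + c * g t) * exp (c * t)). split; [now apply exp_weight_derive|].
      generalize (exp_pos (c * t)). nra. }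
  replace (c * (b - a)) with (c * b + - c * a) by ring. rewrite exp_plus.
  assert (E : exp (- c * a) * exp (c * a) = 1).
  { rewrite <- exp_plus. replace (- c * a + c * a) with 0 by ring. apply exp_0. }
  assert (g a = g a * exp (c * a) * exp (- c * a)) by (rewrite Rmult_assoc, (Rmult_comm (exp (c * a))), E; ring).
  rewrite H0. generalize (exp_pos (- c * a)). nra.
Qed.

Lemma exp_mult_le_exp (c s : R) : 0 <= c -> s <= 1 -> exp (c * s) <= exp c.
Proof. intros. destruct (Req_dec (c * s) c) as [->|]; [lra|]. left. apply exp_increasing. nra. Qed.

(** A bound on the absolute value of the derivative works in both directions of time; this permits
    data prescribed at an interior time such as 1/2. *)
Lemma gronwall (g : R -> R) (c : R) :
  0 <= c -> (forall t, 0 <= t <= 1 -> 0 <= g t) ->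
  (forall t, 0 <= t <= 1 -> continuous g t) ->
  (forall t, 0 < t < 1 -> exists l : R, is_derive g t l /\ Rabs l <= c * g t) ->
  forall t t0, 0 <= t <= 1 -> 0 <= t0 <= 1 -> g t <= exp c * g t0.
Proof.
  intros Hc0 Hg Hc Hd t t0 Ht Ht0. destruct (Rle_lt_dec t0 t) as [Hl|Hl].
  - apply Rle_trans with (exp (c * (t - t0)) * g t0).
    + apply gronwall_forward; [easy|intros; apply Hc; lra|].
      intros s Hs. destruct (Hd s) as (l & Hl1 & Hl2); [lra|]. exists l; split; [easy|].
      generalize (Rle_abs l). lra.
    + apply Rmult_le_compat_r; [now apply Hg|]. apply exp_mult_le_exp; lra.
  - apply Rle_trans with (exp (c * (t0 - t)) * g t0).
    + apply gronwall_backward; [lra|intros; apply Hc; lra|].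
      intros s Hs. destruct (Hd s) as (l & Hl1 & Hl2); [lra|]. exists l; split; [easy|].
      generalize (Rle_abs (- l)). rewrite Rabs_Ropp. lra.
    + apply Rmult_le_compat_r; [now apply Hg|]. apply exp_mult_le_exp; lra.
Qed.

(* The frequency [D / (H + 1)] is almost nondecreasing, and it is half the logarithmic derivative
   of [H + 1]: according to its sign at [t], [H + 1] is almost increasing on [[t, 1]]
   or almost decreasing on [[0, t]]. *)
Lemma almost_log_convex (H D : R -> R) (c K : R) :
  0 <= c -> 0 <= K -> (forall t, 0 <= H t) ->
  (forall t, 0 <= t <= 1 -> continuous H t) ->
  (forall t, 0 <= t <= 1 -> continuous D t) ->
  (forall t, 0 < t < 1 -> exists dH dD : R,
     is_derive H t dH /\ is_derive D t dD /\
     Rabs (dH - 2 * D t) <= c * (H t + 1) /\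
     - K * (H t + 1) ^ 2 <= dD * (H t + 1) - D t * dH) ->
  forall t, 0 <= t <= 1 -> H t + 1 <= exp (2 * K + c) * (H 0 + H 1 + 2).
Proof.
  intros Hc HK HH HcH HcD Hd t Ht.
  set (P := fun t => H t + 1).
  assert (HP : forall t, 1 <= P t) by (intros s; unfold P; generalize (HH s); lra).
  assert (HPc : forall t, 0 <= t <= 1 -> continuous P t).
  { intros s Hs. apply (continuous_plus H); [auto|apply continuous_const]. }
  assert (HPd : forall t l, is_derive H t l -> is_derive P t l).
  { intros s l Hl. replace l with (plus l 0) by (unfold plus; simpl; ring).
    apply (is_derive_plus H); [easy|]. apply (is_derive_const 1). }
  (* The term [K * t] compensates the permitted loss, so that [m] is truly monotone. *)
  set (m := fun t => D t / P t + K * t).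
  assert (Hm : forall a b, 0 <= a -> a <= b -> b <= 1 -> m a <= m b).
  { intros a b Ha Hab Hb. apply (derive_nonneg_incr m); [easy| |].
    - intros s Hs. apply (continuous_plus (fun t => D t / P t)).
      + apply (continuous_mult D); [apply HcD; lra|].
        apply continuous_Rinv_comp; [apply HPc; lra|]. generalize (HP s); lra.
      + apply (continuous_mult (fun _ => K)); [apply continuous_const|apply continuous_id].
    - intros s Hs. destruct (Hd s) as (dH & dD & H1 & H2 & H3 & H4); [lra|].
      specialize (HP s).
      exists ((dD * P s - D s * dH) / P s ^ 2 + K). split.
      + apply (is_derive_plus (fun t => D t / P t)).
        * apply is_derive_div; [easy|now apply HPd|lra].
        * replace K with (K * 1) at 2 by ring. apply is_derive_scal, (is_derive_id s).
      + fold (P s) in H4.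
        assert (0 < P s ^ 2) by (apply pow_lt; lra).
        apply Rmult_le_reg_r with (P s ^ 2); [easy|].
        replace (((dD * P s - D s * dH) / P s ^ 2 + K) * P s ^ 2)
          with (dD * P s - D s * dH + K * P s ^ 2) by (field; lra).
        lra. }
  assert (HDm : forall s, D s = P s * (m s - K * s)).
  { intros s. unfold m. specialize (HP s). field. lra. }
  fold (P t). replace (H 0 + H 1 + 2) with (P 0 + P 1) by (unfold P; ring).
  destruct (Rle_lt_dec (m t) 0) as [Hs|Hs].
  - apply Rle_trans with (exp (c * (t - 0)) * P 0).
    + apply gronwall_forward; [lra|intros; apply HPc; lra|].
      intros s Hss. destruct (Hd s) as (dH & dD & H1 & H2 & H3 & H4); [lra|].
      exists dH. split; [now apply HPd|]. fold (P s) in H3.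
      assert (D s <= 0).
      { rewrite HDm. assert (m s <= m t) by (apply Hm; lra). specialize (HP s).
        assert (0 <= K * s) by nra. nra. }
      generalize (Rle_abs (dH - 2 * D s)). lra.
    + generalize (HP 0) (HP 1) (exp_pos (2 * K + c)).
      assert (exp (c * (t - 0)) <= exp (2 * K + c)).
      { destruct (Req_dec (c * (t - 0)) (2 * K + c)) as [->|]; [lra|]. left; apply exp_increasing; nra. }
      nra.
  - apply Rle_trans with (exp ((2 * K + c) * (1 - t)) * P 1).
    + apply gronwall_backward; [lra|intros; apply HPc; lra|].
      intros s Hss. destruct (Hd s) as (dH & dD & H1 & H2 & H3 & H4); [lra|].
      exists dH. split; [now apply HPd|]. fold (P s) in H3.
      assert (- K * P s <= D s).
      { rewrite HDm. assert (m t <= m s) by (apply Hm; lra). specialize (HP s).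
        assert (K * s <= K) by nra. nra. }
      generalize (Rle_abs (- (dH - 2 * D s))). rewrite Rabs_Ropp. lra.
    + generalize (HP 0) (HP 1) (exp_pos (2 * K + c)).
      assert (exp ((2 * K + c) * (1 - t)) <= exp (2 * K + c)) by (apply exp_mult_le_exp; lra).
      nra.
Qed.

(** * Gronwall estimates on the lattice *)

(** The real form of the equation: [c] collects the potential and the diagonal entry of the
    Laplacian, so that only neighbours stay explicit. Continuity and the bound are asked for at all
    times, which a solution frozen outside [[0, 1]] provides. *)
Record lattice_sol (d : nat) (N M B : R) (v : list Z -> R -> R) : Prop := {
  ls_cont : forall j t, length j = d -> continuous (v j) t;
  ls_eq : forall j t, length j = d -> 0 < t < 1 -> exists c, Rabs c <= M /\
    is_derive (v j) t
      (N * finsum (fun k => v (lat_add j k 1%Z) t + v (lat_add j k (-1)%Z) t) (seq 0 d)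
       + c * v j t);
  ls_bound : forall t n, finsum (fun j => v j t ^ 2) (box d n) <= B }.

Lemma weighted_shift (Om g : list Z -> R) d n k s kap :
  (forall j, 0 <= Om j) -> (forall j, 0 <= g j) -> 0 <= kap ->
  (k < d)%nat -> s = 1%Z \/ s = (-1)%Z ->
  (forall j, length j = d -> Om j <= kap * Om (lat_add j k s)) ->
  finsum (fun j => Om j * g (lat_add j k s)) (box d n) <=
  kap * finsum (fun j => Om j * g j) (box d (S n)).
Proof.
  intros HO Hg Hkap Hk Hs H. rewrite <- finsum_scal.
  eapply Rle_trans; [|apply (box_shift (fun j => kap * (Om j * g j)) d n k s); auto].
  - apply finsum_le; intros j Hj. specialize (H j (box_length _ _ _ Hj)).
    specialize (Hg (lat_add j k s)). nra.
  - intros j. specialize (HO j). specialize (Hg j).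
    apply Rmult_le_pos; [easy|]. now apply Rmult_le_pos.
Qed.

Lemma finsum_le_const {A} (F : A -> R) l c :
  (forall a, In a l -> F a <= c) -> finsum F l <= INR (length l) * c.
Proof.
  induction l as [|a l IH]; intros H; [simpl; lra|].
  rewrite finsum_cons. change (length (a :: l)) with (S (length l)). rewrite S_INR.
  assert (F a <= c) by (apply H; now left).
  assert (finsum F l <= INR (length l) * c) by (apply IH; intros; apply H; now right). lra.
Qed.

Lemma finsum_abs {A} (F : A -> R) l : Rabs (finsum F l) <= finsum (fun a => Rabs (F a)) l.
Proof.
  induction l; [simpl; rewrite Rabs_R0; lra|]. rewrite !finsum_cons.
  eapply Rle_trans; [apply Rabs_triang|]. lra.
Qed.

Lemma square_derive (f : R -> R) (t l w : R) :
  is_derive f t l -> is_derive (fun t => w * f t ^ 2) t (w * (2 * f t * l)).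
Proof.
  intros H. assert (E : Derive (fun x => f x) t = l) by now apply is_derive_unique.
  auto_derive; [now exists l|]. rewrite E; ring.
Qed.

Lemma square_continuous (f : R -> R) (t w : R) :
  continuous f t -> continuous (fun t => w * f t ^ 2) t.
Proof.
  intros H. apply (continuous_mult (fun _ => w)); [apply continuous_const|].
  apply (continuous_ext (fun t => f t * f t)); [intros s; change (@eq R (f s * f s) (f s ^ 2)); ring|]. now apply (continuous_mult f f).
Qed.

(** The energy on a box does not close, since its derivative reads the next layer. With [th m * B],
    a bound for the energy of that layer, added to it, the sum does satisfy a linear differential
    inequality, with a constant free of [m]. *)
Lemma lattice_gronwall d N M B v (Om : list Z -> R) kap (th : nat -> R) :
  0 <= N -> 0 <= M -> 0 <= B -> 0 <= kap -> lattice_sol d N M B v ->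
  (forall j, 0 <= Om j) ->
  (forall j k s, (k < d)%nat -> s = 1%Z \/ s = (-1)%Z -> length j = d ->
     Om j <= kap * Om (lat_add j k s)) ->
  (forall n, 0 <= th n) -> is_lim_seq th 0 ->
  (forall n j, length j = d -> (n < l1norm j)%nat -> Om j <= th n) ->
  forall t0 B0, 0 <= t0 <= 1 ->
  (forall n, finsum (fun j => Om j * v j t0 ^ 2) (box d n) <= B0) ->
  forall t n, 0 <= t <= 1 ->
  finsum (fun j => Om j * v j t ^ 2) (box d n)
  <= exp (2 * M + 2 * INR d * N * (1 + kap)) * B0.
Proof.
  intros HN HM HB Hkap Hsol HO Hr Hth Hlim Hoff t0 B0 Ht0 HB0 t n Ht.
  set (C := 2 * M + 2 * INR d * N * (1 + kap)).
  assert (Hd : 0 <= INR d) by apply pos_INR.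
  assert (HC : 0 <= C).
  { unfold C. assert (0 <= INR d * N) by now apply Rmult_le_pos.
    assert (0 <= INR d * N * (1 + kap)) by (apply Rmult_le_pos; lra). lra. }
  assert (Hpos : forall n t, 0 <= finsum (fun j => Om j * v j t ^ 2) (box d n)).
  { intros; apply finsum_nonneg; intros. apply Rmult_le_pos; [auto|apply pow2_ge_0]. }
  assert (Hm : forall m, finsum (fun j => Om j * v j t ^ 2) (box d m) + th m * B
                <= exp C * (B0 + th m * B)).
  { intros m. apply Rle_trans with
      (exp C * (finsum (fun j => Om j * v j t0 ^ 2) (box d m) + th m * B)).
    2:{ apply Rmult_le_compat_l; [left; apply exp_pos|]. specialize (HB0 m). lra. }
    apply (gronwall (fun t => finsum (fun j => Om j * v j t ^ 2) (box d m) + th m * B) C);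
      try easy.
    - intros s _. specialize (Hpos m s). specialize (Hth m). nra.
    - intros s _. apply (continuous_plus (fun t => finsum (fun j => Om j * v j t ^ 2) (box d m)));
        [|apply continuous_const].
      apply (finsum_continuous (fun j t => Om j * v j t ^ 2)). intros j Hj.
      apply square_continuous, (ls_cont _ _ _ _ _ Hsol). now apply box_length in Hj.
    - intros s Hs.
      exists (finsum (fun j => Om j * (2 * v j s * Derive (v j) s)) (box d m)). split.
      { evar_last.
        - apply (is_derive_plus (fun t => finsum (fun j => Om j * v j t ^ 2) (box d m))).
          + apply (finsum_derive (fun j t => Om j * v j t ^ 2)
                     (fun j t => Om j * (2 * v j t * Derive (v j) t))).
            intros j Hj. apply square_derive.
            destruct (ls_eq _ _ _ _ _ Hsol j s) as (c & _ & H);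
              [now apply box_length in Hj|easy|].
            now rewrite (is_derive_unique _ _ _ H).
          + apply is_derive_const.
        - unfold plus, zero; simpl; ring. }
      eapply Rle_trans; [apply finsum_abs|].
      apply Rle_trans with (finsum (fun j => (2 * M + 2 * INR d * N) * (Om j * v j s ^ 2) +
          N * finsum (fun k => Om j * v (lat_add j k 1%Z) s ^ 2
                               + Om j * v (lat_add j k (-1)%Z) s ^ 2) (seq 0 d)) (box d m)).
      { apply finsum_le; intros j Hj. apply box_length in Hj.
        destruct (ls_eq _ _ _ _ _ Hsol j s) as (c & Hc & H); [easy|easy|].
        rewrite (is_derive_unique _ _ _ H). clear H.
        set (nb := finsum (fun k => v (lat_add j k 1%Z) s + v (lat_add j k (-1)%Z) s) (seq 0 d)).
        assert (Hnb : 2 * Rabs (v j s * nb) <= 2 * INR d * v j s ^ 2 +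
            finsum (fun k => v (lat_add j k 1%Z) s ^ 2 + v (lat_add j k (-1)%Z) s ^ 2) (seq 0 d)).
        { unfold nb. rewrite <- finsum_scal.
          apply Rle_trans with (finsum (fun k => 2 * v j s ^ 2 +
            (v (lat_add j k 1%Z) s ^ 2 + v (lat_add j k (-1)%Z) s ^ 2)) (seq 0 d)).
          - eapply Rle_trans; [apply Rmult_le_compat_l; [lra|apply finsum_abs]|].
            rewrite <- finsum_scal. apply finsum_le; intros k _.
            generalize (v j s) (v (lat_add j k 1%Z) s) (v (lat_add j k (-1)%Z) s).
            intros x y z. unfold Rabs. destruct Rcase_abs;
            generalize (pow2_ge_0 (x + y)) (pow2_ge_0 (x + z)) (pow2_ge_0 (x - y))
              (pow2_ge_0 (x - z)); nra.
          - rewrite finsum_plus. apply Rplus_le_compat_r.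
            eapply Rle_trans; [apply finsum_le_const; intros; apply Rle_refl|].
            rewrite length_seq. lra. }
        rewrite (finsum_ext _ (fun k => Om j * (v (lat_add j k 1%Z) s ^ 2
                                         + v (lat_add j k (-1)%Z) s ^ 2))) by (intros; ring).
        rewrite finsum_scal.
        clearbody nb. set (q := finsum _ _) in *. specialize (HO j). generalize (pow2_ge_0 (v j s)); intros Hv.
        replace (Om j * (2 * v j s * (N * nb + c * v j s)))
          with (Om j * (N * (2 * (v j s * nb)) + 2 * (c * v j s ^ 2))) by ring.
        rewrite Rabs_mult, (Rabs_pos_eq (Om j)) by easy.
        replace ((2 * M + 2 * INR d * N) * (Om j * v j s ^ 2) + N * (Om j * q))
          with (Om j * (N * (2 * INR d * v j s ^ 2 + q) + 2 * (M * v j s ^ 2))) by ring.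
        apply Rmult_le_compat_l; [easy|]. eapply Rle_trans; [apply Rabs_triang|].
        rewrite !Rabs_mult, (Rabs_pos_eq N), (Rabs_pos_eq 2), (Rabs_pos_eq (v j s ^ 2)) by lra.
        rewrite Rabs_mult in Hnb.
        apply Rplus_le_compat; [now apply Rmult_le_compat_l|].
        apply Rmult_le_compat_l; [lra|]. now apply Rmult_le_compat_r. }
      set (E := finsum (fun j => Om j * v j s ^ 2) (box d m)) in *.
      rewrite finsum_plus, !finsum_scal, finsum_swap. fold E.
      assert (Hk : finsum (fun k => finsum (fun j => Om j * v (lat_add j k 1%Z) s ^ 2
                               + Om j * v (lat_add j k (-1)%Z) s ^ 2) (box d m)) (seq 0 d)
              <= INR d * (2 * (kap * (E + th m * B)))).
      { assert (H1 : finsum (fun j => Om j * v j s ^ 2) (box d (S m)) <= E + th m * B).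
        { eapply Rle_trans; [apply (box_layer d m Om (fun j => v j s ^ 2) (th m)); auto|].
          - intros; apply pow2_ge_0.
          - apply Rplus_le_compat_l, Rmult_le_compat_l; [easy|]. apply (ls_bound _ _ _ _ _ Hsol). }
        assert (H2 : forall k sg, (k < d)%nat -> sg = 1%Z \/ sg = (-1)%Z ->
          finsum (fun j => Om j * v (lat_add j k sg) s ^ 2) (box d m) <= kap * (E + th m * B)).
        { intros k sg Hk Hsg. eapply Rle_trans.
          - apply (weighted_shift Om (fun j => v j s ^ 2) d m k sg kap); auto.
            intros; apply pow2_ge_0.
          - now apply Rmult_le_compat_l. }
        eapply Rle_trans; [apply finsum_le_const|rewrite length_seq; apply Rle_refl].
        intros k Hk. apply in_seq in Hk. cbv beta. rewrite finsum_plus.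
        generalize (H2 k 1%Z) (H2 k (-1)%Z). intros A1 A2.
        specialize (A1 ltac:(lia) ltac:(auto)). specialize (A2 ltac:(lia) ltac:(auto)). lra. }
      apply Rmult_le_compat_l with (r := N) in Hk; [|easy].
      assert (0 <= th m * B) by (apply Rmult_le_pos; auto).
      unfold C. assert (0 <= INR d * N) by now apply Rmult_le_pos. nra. }
  (* The box of the conclusion stays fixed while the box of the energy exhausts the lattice and the
     offset tends to 0. *)
  assert (Hfin : finsum (fun j => Om j * v j t ^ 2) (box d n) <= exp C * (B0 + 0 * B)).
  { change (Rbar_le (finsum (fun j => Om j * v j t ^ 2) (box d n)) (exp C * (B0 + 0 * B))).
    apply (is_lim_seq_le_loc (fun _ => finsum (fun j => Om j * v j t ^ 2) (box d n))
             (fun m => exp C * (B0 + th m * B))).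
    - exists n. intros m Hm'. apply Rle_trans with (finsum (fun j => Om j * v j t ^ 2) (box d m)).
      + apply box_le; [easy|]. intros; apply Rmult_le_pos; [auto|apply pow2_ge_0].
      + specialize (Hm m). specialize (Hth m). nra.
    - apply is_lim_seq_const.
    - apply (is_lim_seq_scal_l (fun m => B0 + th m * B) (exp C) (B0 + 0 * B)).
      apply is_lim_seq_plus'; [apply is_lim_seq_const|].
      apply (is_lim_seq_scal_r th B 0), Hlim. }
  lra.
Qed.

(** The cap [X] makes the exponential bounded, so that any damping sends it to 0 at infinity;
    estimates are to be uniform in [X]. *)
Definition dir_weight (Lam : R) (X : nat) (j : list Z) : R :=
  match j with nil => 1 | z :: _ => Lam ^ (Nat.min (Z.to_nat z) X) end.

Lemma dir_weight_pos Lam X j : 1 <= Lam -> 0 < dir_weight Lam X j.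
Proof. intros H. destruct j; simpl; [lra|]. apply pow_lt; lra. Qed.

Lemma pow_decr q a b : 0 <= q <= 1 -> (a <= b)%nat -> q ^ b <= q ^ a.
Proof.
  intros Hq Hab. induction Hab; [lra|]. simpl. assert (0 <= q ^ m) by (apply pow_le; lra). nra.
Qed.

Lemma damping_ratio q a b : / 2 <= q <= 1 -> (b <= S a)%nat -> q ^ a <= 2 * q ^ b.
Proof.
  intros Hq Hab. apply Rle_trans with (2 * q ^ (S a)).
  - simpl. assert (0 <= q ^ a) by (apply pow_le; lra). nra.
  - apply Rmult_le_compat_l; [lra|]. apply pow_decr; [lra|easy].
Qed.

(** The damped weight has neighbour ratio [2 * Lam] and decays like [Lam ^ X * q ^ n]. Only the
    ratio enters the Gronwall constant, so neither [X] nor [q] survives; the leading 2 undoes the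
    damping on the box. *)
Lemma lattice_weighted_bound d N M B v Lam t0 B0 :
  0 <= N -> 0 <= M -> 0 <= B -> lattice_sol d N M B v -> 1 <= Lam -> 0 <= t0 <= 1 ->
  (forall X n, finsum (fun j => dir_weight Lam X j * v j t0 ^ 2) (box d n) <= B0) ->
  forall t X n, 0 <= t <= 1 ->
  finsum (fun j => dir_weight Lam X j * v j t ^ 2) (box d n)
  <= 2 * exp (2 * M + 2 * INR d * N * (1 + 2 * Lam)) * B0.
Proof.
  intros HN HM HB Hsol HL Ht0 HB0 t X n Ht.
  destruct (damping_exists (d * n)) as (q & Hq & Hqn).
  assert (Hqp : forall k, 0 < q ^ k) by (intros; apply pow_lt; lra).
  assert (Hq1 : forall k, q ^ k <= 1).
  { intros. apply (pow_decr q 0 k); [lra|lia]. }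
  set (E := exp _).
  assert (Hg : finsum (fun j => dir_weight Lam X j * q ^ l1norm j * v j t ^ 2) (box d n)
               <= E * B0).
  { apply (lattice_gronwall d N M B v (fun j => dir_weight Lam X j * q ^ l1norm j) (2 * Lam)
             (fun n => Lam ^ X * q ^ n)) with (t0 := t0); try easy; try lra.
    - intros j. apply Rmult_le_pos; left; [now apply dir_weight_pos|auto].
    - intros j k s Hk Hs Hj.
      assert (H1 : dir_weight Lam X j <= Lam * dir_weight Lam X (lat_add j k s)).
      { assert (W : forall a b, (a <= S b)%nat -> Lam ^ a <= Lam * Lam ^ b).
        { intros a b Hab. change (Lam * Lam ^ b) with (Lam ^ S b). now apply Rle_pow. }
        destruct j as [|z y]; [destruct k; simpl; lra|].
        destruct k as [|k]; simpl; apply W; lia. }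
      assert (H2 : q ^ l1norm j <= 2 * q ^ l1norm (lat_add j k s)).
      { apply damping_ratio; [lra|]. now apply l1norm_lat_add. }
      replace (2 * Lam * (dir_weight Lam X (lat_add j k s) * q ^ l1norm (lat_add j k s)))
        with (Lam * dir_weight Lam X (lat_add j k s) * (2 * q ^ l1norm (lat_add j k s))) by ring.
      apply Rmult_le_compat; try easy; left; [now apply dir_weight_pos|auto].
    - intros m. left. apply Rmult_lt_0_compat; [apply pow_lt; lra|auto].
    - replace (Finite 0) with (Rbar_mult (Lam ^ X) 0) by (simpl; f_equal; ring).
      apply (is_lim_seq_scal_l (fun n => q ^ n)). apply is_lim_seq_geom.
      rewrite Rabs_pos_eq; lra.
    - intros m j Hj Hm. apply Rmult_le_compat; [left; now apply dir_weight_pos|left; auto| |].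
      + destruct j; simpl; [apply pow_R1_Rle; lra|]. apply Rle_pow; [easy|lia].
      + apply pow_decr; [lra|lia].
    - intros m. eapply Rle_trans; [|apply (HB0 X m)]. apply finsum_le; intros j _.
      rewrite Rmult_assoc. apply Rmult_le_compat_l; [left; now apply dir_weight_pos|].
      rewrite <- (Rmult_1_l (v j t0 ^ 2)) at 2.
      apply Rmult_le_compat_r; [apply pow2_ge_0|auto]. }
  apply Rle_trans with
    (2 * finsum (fun j => dir_weight Lam X j * q ^ l1norm j * v j t ^ 2) (box d n)).
  - rewrite <- finsum_scal. apply finsum_le; intros j Hj.
    assert (/ 2 <= q ^ l1norm j) by now apply Hqn, l1norm_box.
    assert (0 <= dir_weight Lam X j * v j t ^ 2).
    { apply Rmult_le_pos; [left; now apply dir_weight_pos|apply pow2_ge_0]. }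
    replace (2 * (dir_weight Lam X j * q ^ l1norm j * v j t ^ 2))
      with (2 * q ^ l1norm j * (dir_weight Lam X j * v j t ^ 2)) by ring. nra.
  - lra.
Qed.

(** The trivial weight [Lam = 1] with data bound 0; [t0] is arbitrary because the estimate runs
    forward and backward. *)
Lemma lattice_unique d N M B v t0 :
  0 <= N -> 0 <= M -> 0 <= B -> lattice_sol d N M B v -> 0 <= t0 <= 1 ->
  (forall j, length j = d -> v j t0 = 0) ->
  forall j t, length j = d -> 0 <= t <= 1 -> v j t = 0.
Proof.
  intros HN HM HB Hsol Ht0 H j t Hj Ht. destruct (box_exists j) as [n Hn]. rewrite Hj in Hn.
  assert (H1 := lattice_weighted_bound d N M B v 1 t0 0 HN HM HB Hsol (Rle_refl 1) Ht0).
  assert (H2 : dir_weight 1 0 j * v j t ^ 2 <= 0).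
  { eapply Rle_trans; [apply (finsum_member (fun j => dir_weight 1 0 j * v j t ^ 2) (box d n))|].
    - intros. apply Rmult_le_pos; [left; apply dir_weight_pos; lra|apply pow2_ge_0].
    - easy.
    - eapply Rle_trans; [apply H1; [|easy]|lra].
      intros X m. rewrite (finsum_ext _ (fun _ => 0)).
      + rewrite finsum_zero; lra.
      + intros i Hi. rewrite H by now apply box_length in Hi. ring. }
  assert (0 < dir_weight 1 0 j) by (apply dir_weight_pos; lra).
  assert (0 <= v j t ^ 2) by apply pow2_ge_0. assert (v j t ^ 2 = 0) by nra. nra.
Qed.

(** * The chain [u_x' = N u_(x-1) + F_x] *)

(** From [n0] on the quotient [a n / b n] does not increase; the sum of the quotients up to [n0] is
    a convenient bound for the largest of them. *)
Lemma eventually_ratio_bound (a b : nat -> R) n0 :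
  (forall n, 0 < b n) -> (forall n, 0 <= a n) ->
  (forall n, (n0 <= n)%nat -> a (S n) * b n <= a n * b (S n)) ->
  exists C, 0 <= C /\ forall n, a n <= C * b n.
Proof.
  intros Hb Ha Hr.
  assert (Hq : forall n, 0 <= a n / b n).
  { intros n. apply Rmult_le_pos; [auto|]. left. now apply Rinv_0_lt_compat. }
  assert (Hab : forall n, a n = a n / b n * b n).
  { intros n. field. specialize (Hb n). lra. }
  exists (finsum (fun n => a n / b n) (seq 0 (S n0))). split.
  { apply finsum_nonneg; auto. }
  set (C := finsum _ _).
  assert (HC : forall n, (n <= n0)%nat -> a n / b n <= C).
  { intros n Hn. apply (finsum_member (fun n => a n / b n)); [auto|]. apply in_seq; lia. }
  intros n. destruct (Nat.le_gt_cases n n0) as [Hn|Hn].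
  - rewrite (Hab n). apply Rmult_le_compat_r; [left; auto|auto].
  - assert (Hn' : (n0 <= n)%nat) by lia. clear Hn. induction Hn' as [|n Hn IH].
    + rewrite (Hab n0) at 1. apply Rmult_le_compat_r; [left; auto|auto].
    + specialize (Hr n Hn). generalize (Hb n) (Hb (S n)). intros.
      apply Rmult_le_reg_r with (b n); [easy|]. nra.
Qed.

(** The value 0 at the origin detaches the half-line from the site -1; the lost term reappears as a
    source in [row_perturbation]. *)
Definition prev (u : nat -> R) (x : nat) : R := match x with O => 0 | S y => u y end.

Section Chain.
Variables (N p p1 : R) (W rho u du : nat -> R).
Hypothesis HW : forall x, W (S x) = rho x * W x.

(* With [f = sqrt W u] and [W' = 2 c W], [c = ch_c]: [ch_s] is [S f / sqrt W], [ch_freq] is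
   [<S f, f>], and [ch_Q] is [<(S_t + [S,T]) f, f>] for the chain cut after [n]; the cut
   produces its last, negative, term. *)
Definition ch_c (x : nat) : R := - INR x * p.
Definition ch_s (x : nat) : R := ch_c x * u x + N / 2 * (prev u x + rho x * u (S x)).
Definition ch_F (x : nat) : R := du x - N * prev u x.
Definition ch_freq (n : nat) : R :=
  finsum (fun x => ch_c x * W x * u x ^ 2) (seq 0 (S n))
  + N * finsum (fun x => W (S x) * u x * u (S x)) (seq 0 n).
Definition ch_dfreq (n : nat) : R :=
  finsum (fun x => (- INR x * p1 + 2 * ch_c x ^ 2) * W x * u x ^ 2
                   + 2 * ch_c x * W x * u x * du x) (seq 0 (S n))
  + N * finsum (fun x => W (S x) * (2 * ch_c (S x) * u x * u (S x)
                                    + du x * u (S x) + u x * du (S x))) (seq 0 n).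
Definition ch_Q (n : nat) : R :=
  finsum (fun x => (- INR x * p1 + N ^ 2 / 2 * (rho x - prev rho x)) * W x * u x ^ 2)
    (seq 0 (S n))
  - 2 * N * p * finsum (fun x => W (S x) * u x * u (S x)) (seq 0 n)
  - N ^ 2 / 2 * rho n * W n * u n ^ 2.

(** The bond between [x] and [x + 1] enters [ch_s] half from either side, and
    [W (S x) = rho x * W x] makes the two halves equal. *)
Lemma ch_freq_eq n : u (S n) = 0 ->
  ch_freq n = finsum (fun x => W x * u x * ch_s x) (seq 0 (S n)).
Proof.
  intros Hu.
  (* With [u (S n)] arbitrary a boundary term appears; it is this form that is inductive. *)
  assert (H : ch_freq n + N / 2 * W (S n) * u n * u (S n)
              = finsum (fun x => W x * u x * ch_s x) (seq 0 (S n))).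
  { clear Hu. unfold ch_freq. induction n as [|n IH].
    - simpl finsum. rewrite !HW. unfold ch_s, ch_c, prev. simpl. field.
    - rewrite (finsum_seq_S _ (S n)), (finsum_seq_S (fun x => W (S x) * u x * u (S x)) n),
        (finsum_seq_S (fun x => W x * u x * ch_s x) (S n)), <- IH.
      rewrite !HW. unfold ch_s. simpl prev. field. }
  rewrite Hu in H. lra.
Qed.

(** With f' = S f + T f + sqrt W F, the derivative of <S f, f> is <S_t f, f> + 2 <S f, f'>, and 2 <S
    f, T f> = <[S,T] f, f> because T is antisymmetric. *)
Lemma ch_dfreq_eq n : u (S n) = 0 ->
  ch_dfreq n = ch_Q n + 2 * finsum (fun x => W x * ch_s x * (ch_s x + ch_F x)) (seq 0 (S n)).
Proof.
  intros Hu.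
  assert (H : ch_dfreq n
              + 2 * W n * ((ch_c n * u n + N / 2 * rho n * u (S n)) ^ 2 - (ch_c n * u n) ^ 2)
              + N * W (S n) * u (S n) * du n
    = ch_Q n + 2 * finsum (fun x => W x * ch_s x * (ch_s x + ch_F x)) (seq 0 (S n))).
  { clear Hu. unfold ch_dfreq, ch_Q. induction n as [|n IH].
    - simpl finsum. rewrite !HW. unfold ch_s, ch_F, ch_c, prev. simpl. field.
    - rewrite !(finsum_seq_S _ (S n)), !(finsum_seq_S _ n).
      rewrite !(finsum_seq_S _ n) in IH.
      set (S1 := finsum _ (seq 0 n)) in *.
      set (S2 := finsum _ (seq 0 n)) in *.
      set (S3 := finsum _ (seq 0 n)) in *.
      set (S4 := finsum _ (seq 0 n)) in *.
      set (S5 := finsum _ (seq 0 n)) in *. clearbody S1 S2 S3 S4 S5.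
      (* Subtracting the induction hypothesis leaves an algebraic identity in the terms of the last
         indices. *)
      match type of IH with ?L = ?R =>
        match goal with |- ?L' = ?R' =>
           cut (L' - L = R' - R); [lra|clear IH] end end.
      rewrite !HW. unfold ch_s, ch_F. simpl prev.
      replace (ch_c (S n)) with (ch_c n - p) by (unfold ch_c; rewrite S_INR; ring).
      rewrite !S_INR. field. }
  rewrite Hu in H.
  replace (ch_c n * u n + N / 2 * rho n * 0) with (ch_c n * u n) in H by ring. lra.
Qed.

Lemma ch_denergy_eq n : u (S n) = 0 ->
  finsum (fun x => 2 * ch_c x * W x * u x ^ 2 + W x * (2 * u x * du x)) (seq 0 (S n))
  = 2 * finsum (fun x => W x * u x * (ch_s x + ch_F x)) (seq 0 (S n)).
Proof.
  intros Hu.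
  assert (H : finsum (fun x => 2 * ch_c x * W x * u x ^ 2 + W x * (2 * u x * du x)) (seq 0 (S n))
    + N * W (S n) * u n * u (S n)
    = 2 * finsum (fun x => W x * u x * (ch_s x + ch_F x)) (seq 0 (S n))).
  { clear Hu. induction n as [|n IH].
    - simpl finsum. rewrite !HW. unfold ch_s, ch_F, prev. simpl. field.
    - rewrite !(finsum_seq_S _ (S n)), Rmult_plus_distr_l, <- IH.
      rewrite !HW. unfold ch_s, ch_F. simpl prev. field. }
  rewrite Hu in H. lra.
Qed.

(** Diagonal dominance: by [p^2 rho <= g^2] a bond term is at most [g x] times the sum of its two
    weighted squares, and each diagonal entry pays for its two bonds. Only the cut term is left. *)
Lemma ch_Q_lower (g : nat -> R) n :
  0 <= N -> (forall x, 0 <= W x) -> (forall x, 0 <= g x) ->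
  (forall x, p ^ 2 * rho x <= g x ^ 2) ->
  (forall x, 0 <= - INR x * p1 + N ^ 2 / 2 * (rho x - prev rho x) - N * (g x + prev g x)) ->
  - (N ^ 2 / 2 * rho n * W n * u n ^ 2) <= ch_Q n.
Proof.
  intros HN HW0 Hg Hp Hc. unfold ch_Q.
  set (co := fun x => - INR x * p1 + N ^ 2 / 2 * (rho x - prev rho x)) in *.
  (* Strengthened for the induction: the share [N * g n] of the last diagonal entry stays unspent,
     reserved for the bond to [n + 1]. *)
  cut (N * g n * (W n * u n ^ 2) <=
       finsum (fun x => co x * W x * u x ^ 2) (seq 0 (S n))
       - 2 * N * p * finsum (fun x => W (S x) * u x * u (S x)) (seq 0 n)).
  { intros H. assert (0 <= N * g n * (W n * u n ^ 2)).
    { apply Rmult_le_pos; apply Rmult_le_pos; auto. apply pow2_ge_0. }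
    unfold co in H; lra. }
  change (forall x, 0 <= co x - N * (g x + prev g x)) in Hc.
  clearbody co. induction n as [|n IH].
  - specialize (Hc 0%nat). rewrite finsum_seq_S.
    simpl finsum. simpl prev in Hc.
    assert (0 <= W 0%nat * u 0%nat ^ 2) by (apply Rmult_le_pos; [auto|apply pow2_ge_0]).
    nra.
  - rewrite (finsum_seq_S _ (S n)), (finsum_seq_S (fun x => W (S x) * u x * u (S x)) n).
    specialize (Hc (S n)). simpl prev in Hc.
    set (a := W n * u n ^ 2) in *. set (b := W (S n) * u (S n) ^ 2).
    assert (Ha : 0 <= a) by (apply Rmult_le_pos; [auto|apply pow2_ge_0]).
    assert (Hb : 0 <= b) by (apply Rmult_le_pos; [auto|apply pow2_ge_0]).
    assert (Hx : 2 * (p * (W (S n) * u n * u (S n))) <= g n * (a + b)).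
    { assert (Hsq : (p * (W (S n) * u n * u (S n))) ^ 2 <= g n ^ 2 * (a * b)).
      { replace ((p * (W (S n) * u n * u (S n))) ^ 2) with (p ^ 2 * rho n * (a * b)).
        - apply Rmult_le_compat_r; [now apply Rmult_le_pos|]. apply Hp.
        - unfold a, b. rewrite HW. ring. }
      set (z := p * _) in *. specialize (Hg n).
      assert (4 * (a * b) <= (a + b) ^ 2) by (generalize (pow2_ge_0 (a - b)); lra).
      assert (g n ^ 2 * (4 * (a * b)) <= g n ^ 2 * (a + b) ^ 2)
        by (apply Rmult_le_compat_l; [apply pow2_ge_0|easy]).
      assert (0 <= g n * (a + b)) by (apply Rmult_le_pos; lra).
      destruct (Rle_lt_dec (2 * z) (g n * (a + b))) as [|Hlt]; [easy|]. nra. }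
    assert (Hco : N * (g (S n) + g n) * b <= co (S n) * b) by (apply Rmult_le_compat_r; lra).
    apply Rmult_le_compat_l with (r := N) in Hx; [|easy].
    replace (co (S n) * W (S n) * u (S n) ^ 2) with (co (S n) * b) by (unfold b; ring).
    fold b. lra.
Qed.
End Chain.

Lemma cauchy_schwarz {A} (w f g : A -> R) l :
  (forall a, In a l -> 0 <= w a) ->
  finsum (fun a => w a * f a * g a) l ^ 2
  <= finsum (fun a => w a * f a ^ 2) l * finsum (fun a => w a * g a ^ 2) l.
Proof.
  intros Hw.
  set (x := finsum (fun a => w a * f a ^ 2) l). set (y := finsum (fun a => w a * f a * g a) l).
  set (z := finsum (fun a => w a * g a ^ 2) l).
  assert (H : forall la mu, 0 <= la ^ 2 * x + 2 * la * mu * y + mu ^ 2 * z).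
  { intros la mu. unfold x, y, z. rewrite <- !finsum_scal, <- !finsum_plus.
    apply finsum_nonneg; intros a Ha. specialize (Hw a Ha).
    replace (_ + _) with (w a * (la * f a + mu * g a) ^ 2) by ring.
    apply Rmult_le_pos; [easy|apply pow2_ge_0]. }
  assert (Hx : 0 <= x) by (specialize (H 1 0); lra).
  destruct (Req_dec x 0) as [E|E].
  - assert (Hz : 0 <= z) by (specialize (H 0 1); lra).
    (* For [x = 0] these values leave [0 <= - (z + 2) * y ^ 2], hence [y = 0]. *)
    specialize (H (- (z + 1)) y). rewrite E in H |- *. generalize (pow2_ge_0 y). nra.
  - specialize (H (- y) x). nra.
Qed.

Lemma finsum_list_prod {A B} (G : A * B -> R) l1 l2 :
  finsum G (list_prod l1 l2) = finsum (fun a => finsum (fun b => G (a, b)) l2) l1.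
Proof.
  induction l1; simpl; [reflexivity|]. rewrite finsum_app, finsum_map, IHl1. reflexivity.
Qed.

(* Completing the square: [D = <u,s>] with [G = s + F/2], so that Cauchy-Schwarz for [u], [G]
   leaves only [|F|^2 / 2]. *)
Lemma frequency_inequality {A} (w u s F : A -> R) l (Q e M2 H D dH dD : R) :
  (forall a, In a l -> 0 <= w a) ->
  H = finsum (fun a => w a * u a ^ 2) l ->
  D = finsum (fun a => w a * u a * s a) l ->
  dH = 2 * finsum (fun a => w a * u a * (s a + F a)) l ->
  dD = Q + 2 * finsum (fun a => w a * s a * (s a + F a)) l ->
  0 <= e -> - e <= Q -> 0 <= M2 -> finsum (fun a => w a * F a ^ 2) l <= M2 * (H + 1) ->
  Rabs (dH - 2 * D) <= (1 + M2) * (H + 1) /\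
  - (e + M2 / 2) * (H + 1) ^ 2 <= dD * (H + 1) - D * dH.
Proof.
  intros Hw EH ED EdH EdD He HQ HM2 HF.
  set (UF := finsum (fun a => w a * u a * F a) l).
  set (FF := finsum (fun a => w a * F a ^ 2) l) in *.
  set (SS := finsum (fun a => w a * (s a + F a / 2) ^ 2) l).
  assert (H0 : 0 <= H).
  { rewrite EH. apply finsum_nonneg; intros. apply Rmult_le_pos; [auto|apply pow2_ge_0]. }
  assert (HFF : 0 <= FF).
  { apply finsum_nonneg; intros. apply Rmult_le_pos; [auto|apply pow2_ge_0]. }
  assert (E1 : dH = 2 * D + 2 * UF).
  { rewrite EdH, ED. unfold UF. rewrite <- Rmult_plus_distr_l, <- finsum_plus.
    f_equal. apply finsum_ext; intros; ring. }
  assert (E2 : dD = Q + 2 * SS - FF / 2).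
  { rewrite EdD. unfold SS, FF.
    replace (2 * finsum (fun a => w a * s a * (s a + F a)) l)
      with (2 * finsum (fun a => w a * (s a + F a / 2) ^ 2) l
            + (- / 2) * finsum (fun a => w a * F a ^ 2) l); [lra|].
    rewrite <- !finsum_scal, <- finsum_plus. apply finsum_ext; intros; field. }
  assert (E3 : (D + UF / 2) ^ 2 <= H * SS).
  { replace (D + UF / 2) with (finsum (fun a => w a * u a * (s a + F a / 2)) l).
    - rewrite EH. now apply cauchy_schwarz.
    - rewrite ED. unfold UF. replace (finsum (fun a => w a * u a * F a) l / 2) with
        (/ 2 * finsum (fun a => w a * u a * F a) l) by field.
      rewrite <- finsum_scal, <- finsum_plus. apply finsum_ext; intros; field. }
  assert (E4 : UF ^ 2 <= H * FF) by (rewrite EH; now apply cauchy_schwarz).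
  assert (HSS : 0 <= SS).
  { apply finsum_nonneg; intros. apply Rmult_le_pos; [auto|apply pow2_ge_0]. }
  split.
  - rewrite E1. replace (2 * D + 2 * UF - 2 * D) with (2 * UF) by ring.
    assert ((2 * UF) ^ 2 <= (H + FF) ^ 2) by (generalize (pow2_ge_0 (H - FF)); nra).
    apply Rabs_le. assert (H + FF <= (1 + M2) * (H + 1)) by lra. split; nra.
  - rewrite E1, E2.
    replace ((Q + 2 * SS - FF / 2) * (H + 1) - D * (2 * D + 2 * UF))
      with ((Q - FF / 2) * (H + 1) + 2 * (H * SS - (D + UF / 2) ^ 2) + 2 * SS + UF ^ 2 / 2)
      by field.
    generalize (pow2_ge_0 UF). intros.
    assert (- (e + M2 / 2) * (H + 1) ^ 2 <= (Q - FF / 2) * (H + 1)); [|lra].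
    replace (- (e + M2 / 2) * (H + 1) ^ 2) with (- (e + M2 / 2) * (H + 1) * (H + 1)) by ring.
    apply Rmult_le_compat_r; [lra|]. nra.
Qed.

(** * Logarithmic convexity of weighted energies *)

Fixpoint rprod (r : nat -> R) (n : nat) : R :=
  match n with O => 1 | S m => r m * rprod r m end.

(** A general [r] admits capped ratios. Time enters through [A] alone, so the logarithmic derivative
    is linear in [x] whatever [r] is. *)
Definition wgt (r : nat -> R) (A : R -> R) (x : nat) (t : R) : R := rprod r x / A t ^ x.

Definition half_sum (e n : nat) (F : nat -> list Z -> R) : R :=
  finsum (fun y => finsum (fun x => F x y) (seq 0 (S n))) (box e n).

Lemma half_sum_le e n F G :
  (forall x y, (x <= n)%nat -> length y = e -> F x y <= G x y) ->
  half_sum e n F <= half_sum e n G.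
Proof.
  intros H. apply finsum_le; intros y Hy. apply finsum_le; intros x Hx.
  apply H; [apply in_seq in Hx; lia|]. now apply box_length in Hy.
Qed.

Lemma half_sum_scal e n c F : half_sum e n (fun x y => c * F x y) = c * half_sum e n F.
Proof.
  unfold half_sum. rewrite <- finsum_scal. apply finsum_ext; intros. now rewrite finsum_scal.
Qed.

Lemma zrange_half (G : Z -> R) n :
  (forall z, 0 <= G z) -> finsum (fun x => G (Z.of_nat x)) (seq 0 (S n)) <= finsum G (zrange n).
Proof.
  intros HG. induction n as [|n IH]; [simpl; lra|].
  rewrite finsum_seq_S, finsum_zrange_S. generalize (HG (- Z.of_nat (S n))%Z). lra.
Qed.

Lemma half_sum_box e n (G : list Z -> R) :
  (forall j, 0 <= G j) -> half_sum e n (fun x y => G (Z.of_nat x :: y)) <= finsum G (box (S e) n).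
Proof.
  intros HG. unfold half_sum. rewrite finsum_swap, finsum_box_S.
  apply (zrange_half (fun z => finsum (fun y => G (z :: y)) (box e n))).
  intros; apply finsum_nonneg; auto.
Qed.

Lemma half_sum_slice e n m x F :
  (x <= n)%nat -> (m <= n)%nat -> (forall x y, 0 <= F x y) ->
  finsum (F x) (box e m) <= half_sum e n F.
Proof.
  intros Hx Hm HF. apply Rle_trans with (finsum (F x) (box e n)); [now apply box_le|].
  apply finsum_le; intros y _. apply (finsum_member (fun x => F x y)); [auto|].
  apply in_seq; lia.
Qed.

Lemma rprod_pos r n : (forall x, 0 < r x) -> 0 < rprod r n.
Proof. intros H; induction n; simpl; [lra|]. now apply Rmult_lt_0_compat. Qed.

Lemma wgt_pos r A x t : (forall x, 0 < r x) -> 0 < A t -> 0 < wgt r A x t.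
Proof.
  intros. apply Rmult_lt_0_compat; [now apply rprod_pos|]. now apply Rinv_0_lt_compat, pow_lt.
Qed.

Lemma wgt_S r A x t : 0 < A t -> wgt r A (S x) t = r x / A t * wgt r A x t.
Proof.
  intros H. unfold wgt. simpl. field. split; [apply pow_nonzero|]; lra.
Qed.

Lemma wgt_derive r A p x t :
  (forall t, 0 < A t) -> is_derive A t (2 * p * A t) ->
  is_derive (wgt r A x) t (2 * (- INR x * p) * wgt r A x t).
Proof.
  intros HA Hd. induction x as [|x IH].
  - apply (is_derive_ext (fun _ => 1)).
    + intros s. unfold wgt. simpl. change (@eq R 1 (1 / 1)). field.
    + replace (2 * (- INR 0 * p) * wgt r A 0 t) with 0 by (simpl; ring).
      apply (is_derive_const 1).
  - apply (is_derive_ext (fun t => r x * (wgt r A x t / A t))).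
    + intros s. rewrite wgt_S by auto. change (@eq R (r x * (wgt r A x s / A s))
        (r x / A s * wgt r A x s)). field. specialize (HA s); lra.
    + specialize (HA t). rewrite wgt_S by auto.
      evar_last; [apply is_derive_scal, is_derive_div; [apply IH|apply Hd|lra]|].
      rewrite S_INR. simpl. field. lra.
Qed.

Lemma wgt_continuous r A x t :
  (forall t, 0 < A t) -> continuous A t -> continuous (wgt r A x) t.
Proof.
  intros HA Hc. induction x as [|x IH].
  - apply (continuous_ext (fun _ => 1)); [|apply continuous_const].
    intros s. unfold wgt. simpl. change (@eq R 1 (1 / 1)). field.
  - apply (continuous_ext (fun t => r x * (wgt r A x t * / A t))).
    + intros s. rewrite wgt_S by auto. change (@eq R (r x * (wgt r A x s * / A s))
        (r x / A s * wgt r A x s)). field. specialize (HA s); lra.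
    + apply (continuous_mult (fun _ => r x)); [apply continuous_const|].
      apply (continuous_mult (wgt r A x)); [easy|].
      apply continuous_Rinv_comp; [easy|]. specialize (HA t); lra.
Qed.

Lemma diag_term_derive (k : R) (p w f : R -> R) (t p1 df : R) :
  is_derive p t p1 -> is_derive w t (2 * (- k * p t) * w t) -> is_derive f t df ->
  is_derive (fun t => - k * p t * w t * f t ^ 2) t
    ((- k * p1 + 2 * (- k * p t) ^ 2) * w t * f t ^ 2 + 2 * (- k * p t) * w t * f t * df).
Proof.
  intros Hp Hw Hf.
  assert (E1 : Derive (fun x => p x) t = p1) by now apply is_derive_unique.
  assert (E2 : Derive (fun x => w x) t = 2 * (- k * p t) * w t) by now apply is_derive_unique.
  assert (E3 : Derive (fun x => f x) t = df) by now apply is_derive_unique.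
  auto_derive; [repeat split; eexists; eassumption|]. rewrite E1, E2, E3. ring.
Qed.

Lemma energy_term_derive (c : R) (w f : R -> R) (t df : R) :
  is_derive w t (2 * c * w t) -> is_derive f t df ->
  is_derive (fun t => w t * f t ^ 2) t (2 * c * w t * f t ^ 2 + w t * (2 * f t * df)).
Proof.
  intros Hw Hf.
  assert (E2 : Derive (fun x => w x) t = 2 * c * w t) by now apply is_derive_unique.
  assert (E3 : Derive (fun x => f x) t = df) by now apply is_derive_unique.
  auto_derive; [repeat split; eexists; eassumption|]. rewrite E2, E3. ring.
Qed.

Lemma pair_term_derive (c : R) (w f g : R -> R) (t df dg : R) :
  is_derive w t (2 * c * w t) -> is_derive f t df -> is_derive g t dg ->
  is_derive (fun t => w t * f t * g t) t
    (w t * (2 * c * f t * g t + df * g t + f t * dg)).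
Proof.
  intros Hw Hf Hg.
  assert (E2 : Derive (fun x => w x) t = 2 * c * w t) by now apply is_derive_unique.
  assert (E3 : Derive (fun x => f x) t = df) by now apply is_derive_unique.
  assert (E4 : Derive (fun x => g x) t = dg) by now apply is_derive_unique.
  auto_derive; [repeat split; eexists; eassumption|]. rewrite E2, E3, E4. ring.
Qed.

Lemma weighted_square_continuous (w f : R -> R) t :
  continuous w t -> continuous f t -> continuous (fun t => w t * f t ^ 2) t.
Proof.
  intros Hw Hf. apply (continuous_ext (fun t => w t * (f t * f t))).
  - intros s. change (@eq R (w s * (f s * f s)) (w s * f s ^ 2)). ring.
  - apply (continuous_mult w); [easy|]. now apply (continuous_mult f f).
Qed.

Lemma ch_freq_derive N p1 (p : R -> R) (W u : nat -> R -> R) (du : nat -> R) t n :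
  is_derive p t p1 -> (forall x, is_derive (W x) t (2 * (- INR x * p t) * W x t)) ->
  (forall x, (x <= n)%nat -> is_derive (u x) t (du x)) ->
  is_derive (fun t => ch_freq N (p t) (fun x => W x t) (fun x => u x t) n) t
    (ch_dfreq N (p t) p1 (fun x => W x t) (fun x => u x t) du n).
Proof.
  intros Hp HW Hu. unfold ch_freq, ch_dfreq, ch_c.
  apply (is_derive_plus (fun t => finsum (fun x => - INR x * p t * W x t * u x t ^ 2) (seq 0 (S n)))).
  - apply (finsum_derive (fun x t => - INR x * p t * W x t * u x t ^ 2)
      (fun x t => (- INR x * p1 + 2 * (- INR x * p t) ^ 2) * W x t * u x t ^ 2
         + 2 * (- INR x * p t) * W x t * u x t * du x)).
    intros x Hx. apply in_seq in Hx. apply diag_term_derive; auto. apply Hu; lia.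
  - apply (is_derive_scal (fun t => finsum (fun x => W (S x) t * u x t * u (S x) t) (seq 0 n))).
    apply (finsum_derive (fun x t => W (S x) t * u x t * u (S x) t)
      (fun x t => W (S x) t * (2 * (- INR (S x) * p t) * u x t * u (S x) t
          + du x * u (S x) t + u x t * du (S x)))).
    intros x Hx. apply in_seq in Hx. apply pair_term_derive; auto; apply Hu; lia.
Qed.

Lemma ch_freq_continuous N (p : R -> R) (W u : nat -> R -> R) t n :
  continuous p t -> (forall x, continuous (W x) t) ->
  (forall x, (x <= n)%nat -> continuous (u x) t) ->
  continuous (fun t => ch_freq N (p t) (fun x => W x t) (fun x => u x t) n) t.
Proof.
  intros Hp HW Hu. unfold ch_freq, ch_c.
  apply (continuous_plus (fun t => finsum (fun x => - INR x * p t * W x t * u x t ^ 2) (seq 0 (S n)))).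
  - apply (finsum_continuous (fun x t => - INR x * p t * W x t * u x t ^ 2)).
    intros x Hx. apply in_seq in Hx. apply weighted_square_continuous; [|apply Hu; lia].
    apply (continuous_mult (fun t => - INR x * p t)); [|auto].
    apply (continuous_mult (fun _ => - INR x)); [apply continuous_const|auto].
  - apply (continuous_mult (fun _ => N)); [apply continuous_const|].
    apply (finsum_continuous (fun x t => W (S x) t * u x t * u (S x) t)).
    intros x Hx. apply in_seq in Hx.
    apply (continuous_mult (fun t => W (S x) t * u x t)); [|apply Hu; lia].
    apply (continuous_mult (W (S x))); [auto|apply Hu; lia].
Qed.

Lemma ch_freq_ext N p W u v n :
  (forall x, (x <= n)%nat -> u x = v x) -> ch_freq N p W u n = ch_freq N p W v n.
Proof.
  intros H. unfold ch_freq. f_equal; [|f_equal]; apply finsum_ext; intros x Hx;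
  apply in_seq in Hx; rewrite !H by lia; reflexivity.
Qed.

Lemma ch_dfreq_ext N p p1 W u v du n :
  (forall x, (x <= n)%nat -> u x = v x) -> ch_dfreq N p p1 W u du n = ch_dfreq N p p1 W v du n.
Proof.
  intros H. unfold ch_dfreq. f_equal; [|f_equal]; apply finsum_ext; intros x Hx;
  apply in_seq in Hx; rewrite !H by lia; reflexivity.
Qed.

(** One flat list of pairs, so that a single application of [frequency_inequality] treats all chains
    together. *)
Definition strip (e n : nat) : list (list Z * nat) := list_prod (box e n) (seq 0 (S n)).

(** The damping acts on the transverse coordinates only and is constant in time, hence a mere factor
    in front of every chain identity. *)
Definition strip_wt (q : R) (W : nat -> R) (a : list Z * nat) : R :=
  q ^ l1norm (fst a) * W (snd a).

Lemma strip_sum q W e n (G : nat -> list Z -> R) :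
  finsum (fun a => strip_wt q W a * G (snd a) (fst a)) (strip e n) =
  finsum (fun y => q ^ l1norm y * finsum (fun x => W x * G x y) (seq 0 (S n))) (box e n).
Proof.
  unfold strip. rewrite finsum_list_prod. apply finsum_ext; intros y _.
  rewrite <- finsum_scal. apply finsum_ext; intros x _. unfold strip_wt. simpl. ring.
Qed.

Lemma In_strip e n a : In a (strip e n) -> length (fst a) = e /\ (snd a <= n)%nat.
Proof.
  destruct a as [y x]. intros H. apply in_prod_iff in H as [H1 H2].
  apply in_seq in H2. apply box_length in H1. simpl. split; [easy|lia].
Qed.

Definition row (v : list Z -> R -> R) (t : R) (y : list Z) (x : nat) : R := v (Z.of_nat x :: y) t.
Definition drow (v : list Z -> R -> R) (t : R) (y : list Z) (x : nat) : R :=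
  Derive (v (Z.of_nat x :: y)) t.

(** The 4 comes from squaring a sum of four terms: right neighbour, transverse neighbours, potential
    with diagonal, source at -1. In [8 * INR e ^ 2], Cauchy-Schwarz over the neighbours gives
    [2 * INR e], and the [e] directions with two signs and damping ratio 2 give [4 * INR e]. *)
Definition pert_const (e : nat) (N M B Amax : R) : R :=
  4 * (N ^ 2 * Amax + 8 * INR e ^ 2 * N ^ 2 + M ^ 2 + N ^ 2 * B).

Lemma row_perturbation e N M B v t y x :
  0 <= N -> 0 <= M -> lattice_sol (S e) N M B v -> 0 < t < 1 -> length y = e ->
  (drow v t y x - N * prev (row v t y) x) ^ 2 <=
  4 * N ^ 2 * row v t y (S x) ^ 2
  + 8 * INR e * N ^ 2 * finsum (fun k => row v t (lat_add y k 1) x ^ 2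
                                + row v t (lat_add y k (-1)) x ^ 2) (seq 0 e)
  + 4 * M ^ 2 * row v t y x ^ 2
  + 4 * N ^ 2 * (if Nat.eqb x 0 then v ((-1)%Z :: y) t ^ 2 else 0).
Proof.
  intros HN HM Hsol Ht Hy.
  destruct (ls_eq _ _ _ _ _ Hsol (Z.of_nat x :: y) t) as (c & Hc & H); [simpl; lia|easy|].
  unfold drow. rewrite (is_derive_unique _ _ _ H). clear H.
  rewrite finsum_seq_shift. simpl lat_add.
  set (nb := finsum (fun k => v (Z.of_nat x :: lat_add y k 1) t
                              + v (Z.of_nat x :: lat_add y k (-1)) t) (seq 0 e)).
  set (nb2 := finsum (fun k => row v t (lat_add y k 1) x ^ 2
                                + row v t (lat_add y k (-1)) x ^ 2) (seq 0 e)).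
  assert (Hnb : nb ^ 2 <= 2 * INR e * nb2).
  { unfold nb, nb2. eapply Rle_trans; [apply finsum_sqr_le|]. rewrite length_seq.
    rewrite (Rmult_comm 2), Rmult_assoc. apply Rmult_le_compat_l; [apply pos_INR|].
    rewrite <- finsum_scal. apply finsum_le; intros k _. unfold row.
    generalize (v (Z.of_nat x :: lat_add y k 1) t) (v (Z.of_nat x :: lat_add y k (-1)) t).
    intros a b. generalize (pow2_ge_0 (a - b)). lra. }
  (* Nonzero only at [x = 0], where [prev] has dropped the true left neighbour at -1. *)
  set (src := if Nat.eqb x 0 then v ((-1)%Z :: y) t else 0).
  assert (E1 : (if Nat.eqb x 0 then v ((-1)%Z :: y) t ^ 2 else 0) = src ^ 2).
  { unfold src. destruct (Nat.eqb x 0); ring. }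
  assert (E2 : N * (v ((Z.of_nat x + 1)%Z :: y) t + v ((Z.of_nat x + -1)%Z :: y) t + nb)
     + c * v (Z.of_nat x :: y) t - N * prev (row v t y) x
     = N * row v t y (S x) + N * nb + c * row v t y x + N * src).
  { unfold row, src, prev. replace (Z.of_nat x + 1)%Z with (Z.of_nat (S x)) by lia.
    destruct x as [|x]; simpl Nat.eqb; cbv iota.
    - simpl. ring.
    - replace (Z.of_nat (S x) + -1)%Z with (Z.of_nat x) by lia. ring. }
  rewrite E1, E2. generalize (row v t y (S x)) (row v t y x). intros a b.
  assert (Hcb : (c * b) ^ 2 <= M ^ 2 * b ^ 2).
  { replace ((c * b) ^ 2) with (c ^ 2 * b ^ 2) by ring. apply Rmult_le_compat_r; [apply pow2_ge_0|].
    rewrite <- pow2_abs. apply pow_incr. split; [apply Rabs_pos|easy]. }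
  assert (HN2 : 0 <= N ^ 2) by apply pow2_ge_0.
  assert (N ^ 2 * nb ^ 2 <= N ^ 2 * (2 * INR e * nb2)) by now apply Rmult_le_compat_l.
  generalize (pow2_ge_0 (N * a - N * nb)) (pow2_ge_0 (N * a - c * b)) (pow2_ge_0 (N * a - N * src))
    (pow2_ge_0 (N * nb - c * b)) (pow2_ge_0 (N * nb - N * src)) (pow2_ge_0 (c * b - N * src)).
  nra.
Qed.

(** The right neighbour is harmless because the weights do not drop by more than [Amax]: moving the
    index costs that factor and adds the term at [n + 1] ([Htail1]). A transverse move costs the
    damping ratio 2 and an outer layer ([Htail2]). The source sits at [x = 0], where the weight is
    1, and is bounded by [B]. *)
Lemma perturbation_bound e N M B v q (W : nat -> R) Amax n t :
  0 <= N -> 0 <= M -> 0 <= B -> lattice_sol (S e) N M B v -> 0 < t < 1 ->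
  / 2 <= q <= 1 -> (1 <= n)%nat -> (forall x, 0 < W x) -> W 0%nat = 1 ->
  0 <= Amax -> (forall x, W x <= Amax * W (S x)) ->
  finsum (fun y => W (S n) * row v t y (S n) ^ 2) (box e n) <= 1 ->
  q ^ n * finsum (fun y => finsum (fun x => W x * row v t y x ^ 2) (seq 0 (S n)))
            (box e (S n)) <= 1 ->
  finsum (fun a => strip_wt q W a
     * (drow v t (fst a) (snd a) - N * prev (row v t (fst a)) (snd a)) ^ 2) (strip e n)
  <= pert_const e N M B Amax *
     (finsum (fun a => strip_wt q W a * row v t (fst a) (snd a) ^ 2) (strip e n) + 1).
Proof.
  intros HN HM HB Hsol Ht Hq Hn HW HW0 HA HWA Htail1 Htail2.
  set (S0 := fun G : nat -> list Z -> R =>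
      finsum (fun a => strip_wt q W a * G (snd a) (fst a)) (strip e n)).
  assert (HS0 : forall G, S0 G = finsum (fun y => q ^ l1norm y *
      finsum (fun x => W x * G x y) (seq 0 (S n))) (box e n)) by (intros; apply strip_sum).
  set (H := finsum (fun a => strip_wt q W a * row v t (fst a) (snd a) ^ 2) (strip e n)).
  assert (Hqp : forall k, 0 < q ^ k) by (intros; apply pow_lt; lra).
  assert (Hq1 : forall k, q ^ k <= 1).
  { intros. apply (pow_decr q 0 k); [lra|lia]. }
  assert (Hwt : forall a, 0 < strip_wt q W a).
  { intros. apply Rmult_lt_0_compat; auto. }
  assert (EH : H = S0 (fun x y => row v t y x ^ 2)) by reflexivity.
  assert (HH : 0 <= H).
  { apply finsum_nonneg; intros. apply Rmult_le_pos; [left; auto|apply pow2_ge_0]. }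
  set (g := fun y => finsum (fun x => W x * row v t y x ^ 2) (seq 0 (S n))).
  assert (Hg : forall y, 0 <= g y).
  { intros; apply finsum_nonneg; intros. apply Rmult_le_pos; [left; auto|apply pow2_ge_0]. }
  assert (EHg : H = finsum (fun y => q ^ l1norm y * g y) (box e n)).
  { rewrite EH. now rewrite HS0. }
  assert (T1 : S0 (fun x y => row v t y (S x) ^ 2) <= Amax * (H + 1)).
  { rewrite HS0.
    apply Rle_trans with (Amax * finsum (fun y => q ^ l1norm y * g y
        + W (S n) * row v t y (S n) ^ 2) (box e n)).
    - rewrite <- finsum_scal. apply finsum_le; intros y _.
      assert (Hs : finsum (fun x => W x * row v t y (S x) ^ 2) (seq 0 (S n))
                   <= Amax * (g y + W (S n) * row v t y (S n) ^ 2)).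
      { unfold g. rewrite <- (finsum_seq_S (fun x => W x * row v t y x ^ 2) (S n)).
        rewrite (finsum_seq_shift (fun x => W x * row v t y x ^ 2) (S n)).
        apply Rle_trans with (Amax * finsum (fun x => W (S x) * row v t y (S x) ^ 2) (seq 0 (S n))).
        - rewrite <- finsum_scal. apply finsum_le; intros x _.
          rewrite <- Rmult_assoc. apply Rmult_le_compat_r; [apply pow2_ge_0|auto].
        - apply Rmult_le_compat_l; [easy|].
          assert (0 <= W 0%nat * row v t y 0%nat ^ 2).
          { apply Rmult_le_pos; [left; auto|apply pow2_ge_0]. }
          lra. }
      specialize (Hqp (l1norm y)). specialize (Hq1 (l1norm y)).
      assert (0 <= W (S n) * row v t y (S n) ^ 2).
      { apply Rmult_le_pos; [left; auto|apply pow2_ge_0]. }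
      apply Rle_trans with (q ^ l1norm y * (Amax * (g y + W (S n) * row v t y (S n) ^ 2))).
      + apply Rmult_le_compat_l; lra.
      + replace (q ^ l1norm y * (Amax * (g y + W (S n) * row v t y (S n) ^ 2)))
          with (Amax * (q ^ l1norm y * g y + q ^ l1norm y * (W (S n) * row v t y (S n) ^ 2)))
          by ring.
        apply Rmult_le_compat_l; [easy|]. nra.
    - rewrite finsum_plus, <- EHg. apply Rmult_le_compat_l; [easy|]. lra. }
  assert (T2 : S0 (fun x y => finsum (fun k => row v t (lat_add y k 1) x ^ 2
                      + row v t (lat_add y k (-1)) x ^ 2) (seq 0 e)) <= INR e * (4 * (H + 1))).
  { unfold S0.
    rewrite (finsum_ext _ (fun a => finsum (fun k => strip_wt q W a *
        row v t (lat_add (fst a) k 1) (snd a) ^ 2 + strip_wt q W a *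
        row v t (lat_add (fst a) k (-1)) (snd a) ^ 2) (seq 0 e))).
    2:{ intros a _. cbv beta. rewrite <- finsum_scal. apply finsum_ext; intros; ring. }
    rewrite finsum_swap.
    eapply Rle_trans; [apply finsum_le_const|rewrite length_seq; apply Rle_refl].
    intros k Hk. apply in_seq in Hk. cbv beta. rewrite finsum_plus.
    assert (Hks : forall s, s = 1%Z \/ s = (-1)%Z ->
       finsum (fun a => strip_wt q W a * row v t (lat_add (fst a) k s) (snd a) ^ 2) (strip e n)
       <= 2 * (H + 1)).
    { intros s Hs. change (S0 (fun x y => row v t (lat_add y k s) x ^ 2) <= 2 * (H + 1)).
      rewrite HS0. eapply Rle_trans.
      - apply (weighted_shift (fun y => q ^ l1norm y) g e n k s 2); try easy; try lia; try lra.
        + intros; left; auto.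
        + intros; apply damping_ratio; [lra|]. now apply l1norm_lat_add.
      - apply Rmult_le_compat_l; [lra|].
        eapply Rle_trans; [apply (box_layer e n (fun y => q ^ l1norm y) g (q ^ n)); auto|].
        + intros; left; auto.
        + left; auto.
        + intros y Hy Hl. apply pow_decr; [lra|lia].
        + rewrite <- EHg. apply Rplus_le_compat_l. exact Htail2. }
    generalize (Hks 1%Z) (Hks (-1)%Z). intros A1 A2.
    specialize (A1 ltac:(auto)). specialize (A2 ltac:(auto)). lra. }
  assert (T4 : S0 (fun x y => if Nat.eqb x 0 then v ((-1)%Z :: y) t ^ 2 else 0) <= B).
  { rewrite HS0.
    apply Rle_trans with (finsum (fun y => v ((-1)%Z :: y) t ^ 2) (box e n)).
    - apply finsum_le; intros y _. rewrite finsum_seq_shift.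
      rewrite (finsum_ext (fun x => W (S x) * _) (fun _ => 0)) by (intros; simpl; ring).
      rewrite finsum_zero, HW0. simpl Nat.eqb. cbv iota.
      specialize (Hq1 (l1norm y)). generalize (pow2_ge_0 (v ((-1)%Z :: y) t)). nra.
    - eapply Rle_trans; [|apply (ls_bound _ _ _ _ _ Hsol t n)].
      rewrite finsum_box_S.
      apply (finsum_member (fun z => finsum (fun y => v (z :: y) t ^ 2) (box e n))).
      + intros; apply finsum_nonneg; intros; apply pow2_ge_0.
      + apply In_zrange. lia. }
  apply Rle_trans with
    (4 * N ^ 2 * S0 (fun x y => row v t y (S x) ^ 2)
     + 8 * INR e * N ^ 2 * S0 (fun x y => finsum (fun k => row v t (lat_add y k 1) x ^ 2
                      + row v t (lat_add y k (-1)) x ^ 2) (seq 0 e))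
     + 4 * M ^ 2 * H
     + 4 * N ^ 2 * S0 (fun x y => if Nat.eqb x 0 then v ((-1)%Z :: y) t ^ 2 else 0)).
  { unfold S0, H. rewrite <- !finsum_scal, <- !finsum_plus. apply finsum_le; intros a Ha.
    apply In_strip in Ha as [Hy Hx].
    eapply Rle_trans;
      [apply Rmult_le_compat_l; [left; auto|];
       apply (row_perturbation e N M B v t (fst a) (snd a)); easy|].
    right. ring. }
  assert (HN2 : 0 <= N ^ 2) by apply pow2_ge_0.
  assert (HM2 : 0 <= M ^ 2) by apply pow2_ge_0.
  assert (He : 0 <= INR e) by apply pos_INR.
  assert (HeN : 0 <= INR e * N ^ 2) by now apply Rmult_le_pos.
  apply Rmult_le_compat_l with (r := 4 * N ^ 2) in T1; [|lra].
  apply Rmult_le_compat_l with (r := 8 * INR e * N ^ 2) in T2; [|lra].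
  apply Rmult_le_compat_l with (r := 4 * N ^ 2) in T4; [|lra].
  assert (0 <= N ^ 2 * B * H) by (apply Rmult_le_pos; [now apply Rmult_le_pos|easy]).
  unfold pert_const. nra.
Qed.

(** This is [exp (2 * K + c)] of [almost_log_convex]; [N ^ 2 / 2] stands for the cut term of [ch_Q].
    The weight enters only through [Amax], so all delta share one constant. *)
Definition conv_const (e : nat) (N M B Amax : R) : R :=
  exp (2 * (N ^ 2 / 2 + pert_const e N M B Amax / 2) + (1 + pert_const e N M B Amax)).

Lemma pert_const_nonneg e N M B Amax : 0 <= B -> 0 <= Amax -> 0 <= pert_const e N M B Amax.
Proof.
  intros. unfold pert_const. generalize (pow2_ge_0 N) (pow2_ge_0 M) (pow2_ge_0 (INR e)). intros.
  assert (0 <= N ^ 2 * Amax) by now apply Rmult_le_pos.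
  assert (0 <= INR e ^ 2 * N ^ 2) by now apply Rmult_le_pos.
  assert (0 <= N ^ 2 * B) by now apply Rmult_le_pos. lra.
Qed.

(* A sufficient condition for [S_t + [S,T] >= 0] with the weight [wgt r A]: [p = A' / (2 A)],
   [p1 = p'], and [N * g x] bounds the off-diagonal entry of the form between [x] and [x + 1]. *)
Record convex_weight (N Amax : R) (r : nat -> R) (A : R -> R) : Prop := {
  cw_r : forall x, 1 <= r x;
  cw_pos : forall t, 0 < A t;
  cw_max : forall t, 0 <= t <= 1 -> A t <= Amax;
  cw_cont : forall t, continuous A t;
  cw_ex : exists p p1 : R -> R,
    (forall t, continuous p t) /\
    (forall t, is_derive A t (2 * p t * A t)) /\
    (forall t, is_derive p t (p1 t)) /\
    (forall t, 0 < t < 1 -> exists g : nat -> R, (forall x, 0 <= g x) /\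
       (forall x, p t ^ 2 * (r x / A t) <= g x ^ 2) /\
       (forall x, 0 <= - INR x * p1 t + N ^ 2 / 2 * (r x / A t - prev (fun x => r x / A t) x)
                       - N * (g x + prev g x))) }.

(** The three tail conditions pay, in this order, for the right neighbour at [n + 1], for the outer
    transverse layer, and for the negative cut term of [ch_Q]. *)
Lemma damped_convexity e N M B v q r A Amax n :
  0 <= N -> 0 <= M -> 0 <= B -> lattice_sol (S e) N M B v ->
  / 2 <= q <= 1 -> (1 <= n)%nat -> convex_weight N Amax r A ->
  (forall t, 0 < t < 1 ->
     finsum (fun y => wgt r A (S n) t * row v t y (S n) ^ 2) (box e n) <= 1 /\
     q ^ n * finsum (fun y => finsum (fun x => wgt r A x t * row v t y x ^ 2) (seq 0 (S n)))
            (box e (S n)) <= 1 /\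
     finsum (fun y => wgt r A (S n) t * row v t y n ^ 2) (box e n) <= 1) ->
  let H := fun t => finsum (fun a => strip_wt q (fun x => wgt r A x t) a
                                     * row v t (fst a) (snd a) ^ 2) (strip e n) in
  forall t, 0 <= t <= 1 -> H t + 1 <= conv_const e N M B Amax * (H 0 + H 1 + 2).
Proof.
  intros HN HM HB Hsol Hq Hn [Hr HA HAmax HAc (p & p1 & Hpc & HAd & Hpd & Hg)] Htail H.
  assert (Hr0 : forall x, 0 < r x) by (intros x; specialize (Hr x); lra).
  assert (HW : forall x t, 0 < wgt r A x t) by (intros; apply wgt_pos; auto).
  assert (HAm : 0 <= Amax) by (specialize (HAmax 0); specialize (HA 0); lra).
  assert (HM2 := pert_const_nonneg e N M B Amax HB HAm).
  set (M2 := pert_const e N M B Amax) in *.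
  assert (Hqp : forall k, 0 < q ^ k) by (intros; apply pow_lt; lra).
  assert (Hq1 : forall k, q ^ k <= 1).
  { intros. apply (pow_decr q 0 k); [lra|lia]. }
  assert (Hcont : forall x y t, length y = e -> continuous (fun t => row v t y x) t).
  { intros x y t Hy. apply (ls_cont _ _ _ _ _ Hsol). simpl; lia. }
  assert (Hder : forall x y t, length y = e -> 0 < t < 1 ->
            is_derive (fun t => row v t y x) t (drow v t y x)).
  { intros x y t Hy Ht. destruct (ls_eq _ _ _ _ _ Hsol (Z.of_nat x :: y) t) as (c & _ & Hd);
      [simpl; lia|easy|]. unfold drow. rewrite (is_derive_unique _ _ _ Hd). exact Hd. }
  assert (HHn : forall t, H t = finsum (fun y => q ^ l1norm y *
      finsum (fun x => wgt r A x t * row v t y x ^ 2) (seq 0 (S n))) (box e n)).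
  { intros t. apply (strip_sum q (fun x => wgt r A x t) e n (fun x y => row v t y x ^ 2)). }
  set (D := fun t => finsum (fun y => q ^ l1norm y *
       ch_freq N (p t) (fun x => wgt r A x t) (fun x => row v t y x) n) (box e n)).
  apply (almost_log_convex H D (1 + M2) (N ^ 2 / 2 + M2 / 2)).
  - lra.
  - generalize (pow2_ge_0 N). lra.
  - intros t. apply finsum_nonneg; intros. apply Rmult_le_pos; [|apply pow2_ge_0].
    apply Rmult_le_pos; left; auto.
  - intros t _. eapply continuous_ext; [intros s; symmetry; apply HHn|].
    apply (finsum_continuous (fun y t => q ^ l1norm y *
      finsum (fun x => wgt r A x t * row v t y x ^ 2) (seq 0 (S n)))).
    intros y Hy. apply box_length in Hy.
    apply (continuous_mult (fun _ => q ^ l1norm y)); [apply continuous_const|].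
    apply (finsum_continuous (fun x t => wgt r A x t * row v t y x ^ 2)).
    intros x _. apply weighted_square_continuous; [apply wgt_continuous; auto|auto].
  - intros t _. apply (finsum_continuous (fun y t => q ^ l1norm y *
       ch_freq N (p t) (fun x => wgt r A x t) (fun x => row v t y x) n)).
    intros y Hy. apply box_length in Hy.
    apply (continuous_mult (fun _ => q ^ l1norm y)); [apply continuous_const|].
    apply (ch_freq_continuous N p (wgt r A)  (fun x t => row v t y x)); auto.
    intros; apply wgt_continuous; auto.
  - intros t Ht. destruct (Hg t Ht) as (g & Hg0 & Hg1 & Hg2).
    destruct (Htail t Ht) as (HT1 & HT2 & HT3).
    assert (HWd : forall x, is_derive (wgt r A x) t (2 * (- INR x * p t) * wgt r A x t)).
    { intros x. now apply wgt_derive. }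
    set (W := fun x => wgt r A x t).
    set (rho := fun x => r x / A t).
    assert (HWS : forall x, W (S x) = rho x * W x) by (intros; apply wgt_S; auto).
    (* Cut to zero beyond [n], because the chain identities ask for [u (S n) = 0]; up to [n] nothing
       changes, and the derivatives are those of the uncut rows. *)
    set (ut := fun y x => if Nat.leb x n then row v t y x else 0).
    assert (Hut : forall y x, (x <= n)%nat -> ut y x = row v t y x).
    { intros y x Hx. unfold ut. now rewrite (proj2 (Nat.leb_le _ _)). }
    assert (HutS : forall y, ut y (S n) = 0).
    { intros y. unfold ut. rewrite (proj2 (Nat.leb_gt _ _)); [reflexivity|lia]. }
    assert (Hprev : forall y x, (x <= n)%nat -> prev (ut y) x = prev (row v t y) x).
    { intros y [|x] Hx; [reflexivity|]. simpl. apply Hut. lia. }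
    exists (finsum (fun y => q ^ l1norm y *
       finsum (fun x => 2 * ch_c (p t) x * W x * row v t y x ^ 2
                 + W x * (2 * row v t y x * drow v t y x)) (seq 0 (S n))) (box e n)).
    exists (finsum (fun y => q ^ l1norm y *
       ch_dfreq N (p t) (p1 t) W (row v t y) (drow v t y) n) (box e n)).
    split; [|split].
    + eapply is_derive_ext; [intros s; symmetry; apply HHn|].
      apply (finsum_derive (fun y t => q ^ l1norm y *
        finsum (fun x => wgt r A x t * row v t y x ^ 2) (seq 0 (S n)))
        (fun y t => q ^ l1norm y *
       finsum (fun x => 2 * ch_c (p t) x * wgt r A x t * row v t y x ^ 2
                 + wgt r A x t * (2 * row v t y x * drow v t y x)) (seq 0 (S n)))).
      intros y Hy. apply box_length in Hy.
      apply (is_derive_scal (fun t => finsum (fun x => wgt r A x t * row v t y x ^ 2) (seq 0 (S n)))).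
      apply (finsum_derive (fun x t => wgt r A x t * row v t y x ^ 2)
        (fun x t => 2 * ch_c (p t) x * wgt r A x t * row v t y x ^ 2
                 + wgt r A x t * (2 * row v t y x * drow v t y x))).
      intros x _. apply (energy_term_derive (ch_c (p t) x) (wgt r A x)); auto.
    + apply (finsum_derive (fun y t => q ^ l1norm y *
        ch_freq N (p t) (fun x => wgt r A x t) (fun x => row v t y x) n)
        (fun y t => q ^ l1norm y *
         ch_dfreq N (p t) (p1 t) (fun x => wgt r A x t) (row v t y) (drow v t y) n)).
      intros y Hy. apply box_length in Hy.
      apply (is_derive_scal (fun t =>
        ch_freq N (p t) (fun x => wgt r A x t) (fun x => row v t y x) n)).
      apply (ch_freq_derive N (p1 t) p (wgt r A) (fun x t => row v t y x) (drow v t y)); auto.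
    + apply (frequency_inequality (strip_wt q W) (fun a => ut (fst a) (snd a))
        (fun a => ch_s N (p t) rho (ut (fst a)) (snd a))
        (fun a => ch_F N (ut (fst a)) (drow v t (fst a)) (snd a)) (strip e n)
        (finsum (fun y => q ^ l1norm y * ch_Q N (p t) (p1 t) W rho (ut y) n) (box e n))).
      * intros a _. apply Rmult_le_pos; left; auto. apply HW.
      * apply finsum_ext. intros a Ha. apply In_strip in Ha as [_ Ha]. now rewrite Hut.
      * transitivity (finsum (fun a => strip_wt q W a * (ut (fst a) (snd a) *
           ch_s N (p t) rho (ut (fst a)) (snd a))) (strip e n));
          [|apply finsum_ext; intros; ring].
        etransitivity;
          [|symmetry; apply (strip_sum q W e n (fun x y => ut y x * ch_s N (p t) rho (ut y) x))].
        apply finsum_ext; intros y _. f_equal.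
        transitivity (ch_freq N (p t) W (ut y) n);
          [apply ch_freq_ext; intros; symmetry; now apply Hut|].
        rewrite (ch_freq_eq N (p t) W rho (ut y) HWS n (HutS y)).
        apply finsum_ext; intros; ring.
      * transitivity (2 * finsum (fun a => strip_wt q W a * (ut (fst a) (snd a) *
           (ch_s N (p t) rho (ut (fst a)) (snd a) + ch_F N (ut (fst a)) (drow v t (fst a)) (snd a))))
            (strip e n)); [|f_equal; apply finsum_ext; intros; ring].
        rewrite (strip_sum q W e n (fun x y => ut y x *
          (ch_s N (p t) rho (ut y) x + ch_F N (ut y) (drow v t y) x))).
        rewrite <- finsum_scal.
        apply finsum_ext; intros y _. rewrite <- Rmult_assoc, (Rmult_comm 2), Rmult_assoc. f_equal.
        transitivity (finsum (fun x => 2 * ch_c (p t) x * W x * ut y x ^ 2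
                 + W x * (2 * ut y x * drow v t y x)) (seq 0 (S n))).
        { apply finsum_ext; intros x Hx. apply in_seq in Hx. rewrite Hut by lia. reflexivity. }
        rewrite (ch_denergy_eq N (p t) W rho (ut y) (drow v t y) HWS n (HutS y)).
        f_equal. apply finsum_ext; intros; ring.
      * transitivity (finsum (fun y => q ^ l1norm y * ch_Q N (p t) (p1 t) W rho (ut y) n) (box e n)
          + 2 * finsum (fun a => strip_wt q W a * (ch_s N (p t) rho (ut (fst a)) (snd a) *
           (ch_s N (p t) rho (ut (fst a)) (snd a) + ch_F N (ut (fst a)) (drow v t (fst a)) (snd a))))
            (strip e n)); [|f_equal; f_equal; apply finsum_ext; intros; ring].
        rewrite (strip_sum q W e n (fun x y => ch_s N (p t) rho (ut y) x *
          (ch_s N (p t) rho (ut y) x + ch_F N (ut y) (drow v t y) x))).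
        rewrite <- finsum_scal, <- finsum_plus.
        apply finsum_ext; intros y _.
        rewrite (ch_dfreq_ext N (p t) (p1 t) _ _ (ut y)) by (intros; symmetry; now apply Hut).
        rewrite (ch_dfreq_eq N (p t) (p1 t) W rho (ut y) (drow v t y) HWS n (HutS y)).
        rewrite (finsum_ext _ (fun x => W x * (ch_s N (p t) rho (ut y) x *
          (ch_s N (p t) rho (ut y) x + ch_F N (ut y) (drow v t y) x))) (seq 0 (S n)))
          by (intros; ring).
        ring.
      * generalize (pow2_ge_0 N). lra.
      (* In the cut term [rho n * W n] is [W (S n)], as in the third tail condition; the damping
         factor, at most 1, only shrinks this negative bound. *)
      * assert (HQ : forall y, - (N ^ 2 / 2 * (W (S n) * row v t y n ^ 2))
                     <= q ^ l1norm y * ch_Q N (p t) (p1 t) W rho (ut y) n).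
        { intros y.
          assert (HQ := ch_Q_lower N (p t) (p1 t) W rho (ut y) HWS g n HN
             ltac:(intros; left; apply HW) Hg0 Hg1 Hg2).
          rewrite Hut in HQ by lia.
          assert (0 <= N ^ 2 / 2 * rho n * W n * row v t y n ^ 2).
          { apply Rmult_le_pos; [|apply pow2_ge_0].
            rewrite Rmult_assoc, <- HWS. apply Rmult_le_pos; [|left; apply HW].
            generalize (pow2_ge_0 N). lra. }
          replace (N ^ 2 / 2 * (W (S n) * row v t y n ^ 2)) with
            (N ^ 2 / 2 * rho n * W n * row v t y n ^ 2) by (rewrite HWS; ring).
          specialize (Hqp (l1norm y)). specialize (Hq1 (l1norm y)). nra. }
        apply Rle_trans with
          (finsum (fun y => - (N ^ 2 / 2) * (W (S n) * row v t y n ^ 2)) (box e n)).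
        { rewrite finsum_scal. fold W in HT3. change (wgt r A (S n) t) with (W (S n)) in HT3.
          generalize (pow2_ge_0 N). nra. }
        apply finsum_le; intros y _. specialize (HQ y). lra.
      * exact HM2.
      * eapply Rle_trans; [|apply (perturbation_bound e N M B v q W Amax n t); try easy].
        -- right. apply finsum_ext. intros a Ha. apply In_strip in Ha as [_ Ha].
           unfold ch_F. now rewrite Hprev.
        -- intros; apply HW.
        -- unfold W, wgt. simpl. field.
        -- intros x. rewrite HWS. unfold rho.
           assert (1 <= Amax * (r x / A t)).
           { specialize (HA t). specialize (Hr x). specialize (HAmax t ltac:(lra)).
             apply Rmult_le_reg_r with (A t); [easy|].
             replace (Amax * (r x / A t) * A t) with (Amax * r x) by (field; lra). nra. }
           specialize (HW x t). fold (W x) in HW. nra.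
Qed.

Lemma geom_eventually_le (q c : R) :
  0 <= q < 1 -> exists n0, forall n, (n0 <= n)%nat -> q ^ n * c <= 1.
Proof.
  intros Hq.
  assert (H : is_lim_seq (fun n => q ^ n * c) (0 * c)).
  { apply (is_lim_seq_scal_r _ c 0). apply is_lim_seq_geom. rewrite Rabs_pos_eq; lra. }
  rewrite Rmult_0_l in H. apply is_lim_seq_spec in H.
  destruct (H (mkposreal 1 Rlt_0_1)) as [n0 Hn0]. exists n0. intros n Hn.
  specialize (Hn0 n Hn). simpl in Hn0. rewrite Rminus_0_r in Hn0.
  generalize (Rle_abs (q ^ n * c)). lra.
Qed.

Lemma square_geom_eventually_le (c : R) :
  0 <= c -> exists n0, forall n, (n0 <= n)%nat -> (INR n + 1) ^ 2 * (/ 2) ^ n * c <= 1.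
Proof.
  intros Hc.
  (* From [n = 4] on, [((n+2)/(n+1))^2 <= 36/25 < 3/2]; then [3/2 * 1/2 = 3/4] is still less than
     1. *)
  destruct (eventually_ratio_bound (fun n => (INR n + 1) ^ 2) (fun n => (3 / 2) ^ n) 4)
    as (C & HC & H).
  - intros; apply pow_lt; lra.
  - intros; apply pow2_ge_0.
  - intros n Hn. apply le_INR in Hn. simpl (INR 4) in Hn. rewrite S_INR.
    change ((3 / 2) ^ S n) with (3 / 2 * (3 / 2) ^ n).
    assert (0 < (3 / 2) ^ n) by (apply pow_lt; lra).
    assert ((INR n + 1 + 1) ^ 2 <= 3 / 2 * (INR n + 1) ^ 2) by nra. nra.
  - destruct (geom_eventually_le (3 / 4) (C * c)) as [n0 Hn0]; [lra|].
    exists n0. intros n Hn. specialize (Hn0 n Hn). specialize (H n). cbv beta in H.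
    assert (0 < (/ 2) ^ n) by (apply pow_lt; lra).
    replace ((3 / 4) ^ n) with ((3 / 2) ^ n * (/ 2) ^ n) in Hn0
      by (rewrite <- Rpow_mult_distr; f_equal; field).
    apply Rle_trans with (C * (3 / 2) ^ n * (/ 2) ^ n * c); [|lra].
    apply Rmult_le_compat_r; [easy|]. apply Rmult_le_compat_r; lra.
Qed.

(** [Bap] serves only to choose a strip so large that its three tails are at most 1; it is absent
    from the conclusion. The 4 is the 2 that undoes the damping times the 2 for data at both
    ends. *)
Lemma convexity_step e N M B v r A Amax Amin Bap B0 :
  0 <= N -> 0 <= M -> 0 <= B -> lattice_sol (S e) N M B v ->
  convex_weight N Amax r A -> 0 < Amin -> (forall t, 0 <= t <= 1 -> Amin <= A t) ->
  (forall x, r x <= (INR x + 1) ^ 2) ->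
  (forall t n, 0 <= t <= 1 ->
     half_sum e n (fun x y => 2 ^ x * (wgt r A x t * row v t y x ^ 2)) <= Bap) ->
  (forall n, half_sum e n (fun x y => wgt r A x 0 * row v 0 y x ^ 2) <= B0) ->
  (forall n, half_sum e n (fun x y => wgt r A x 1 * row v 1 y x ^ 2) <= B0) ->
  forall t n, 0 <= t <= 1 ->
  half_sum e n (fun x y => wgt r A x t * row v t y x ^ 2)
  <= 4 * conv_const e N M B Amax * (B0 + 1).
Proof.
  intros HN HM HB Hsol Hcw HAmin HA Hr Hap Hd0 Hd1 t n Ht.
  (* The order matters: [q] is fitted to the box of the conclusion and [m] is chosen afterwards, so
     [q < 1] can still give [q ^ m * Bap <= 1]. *)
  destruct (damping_exists (e * n)) as (q & Hq & Hqn).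
  assert (Hqp : forall k, 0 < q ^ k) by (intros; apply pow_lt; lra).
  assert (Hq1 : forall k, q ^ k <= 1).
  { intros. apply (pow_decr q 0 k); [lra|lia]. }
  assert (Hr0 : forall x, 0 < r x) by (intros x; generalize (cw_r _ _ _ _ Hcw x); lra).
  assert (HW : forall x t, 0 < wgt r A x t).
  { intros; apply wgt_pos; [auto|]. apply (cw_pos _ _ _ _ Hcw). }
  assert (HWv : forall x t y z, 0 <= wgt r A x t * row v t y z ^ 2).
  { intros. apply Rmult_le_pos; [left; auto|apply pow2_ge_0]. }
  assert (H2 : forall x, 1 <= 2 ^ x) by (intros; apply pow_R1_Rle; lra).
  assert (HWv2 : forall x t y z, 0 <= 2 ^ x * (wgt r A x t * row v t y z ^ 2)).
  { intros x' t' y' z'. apply Rmult_le_pos; [|auto]. specialize (H2 x'). lra. }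
  assert (HBap : 0 <= Bap).
  { eapply Rle_trans; [|apply (Hap t 0%nat Ht)].
    apply finsum_nonneg; intros; apply finsum_nonneg; auto. }
  assert (Hslice : forall s m m', 0 <= s <= 1 -> (m' <= m)%nat ->
     finsum (fun y => wgt r A m s * row v s y m ^ 2) (box e m') <= (/ 2) ^ m * Bap).
  { intros s m m' Hs Hm.
    assert (E := half_sum_slice e m m' m
       (fun x y => 2 ^ x * (wgt r A x s * row v s y x ^ 2)) (le_n m) Hm ltac:(intros; cbv beta; auto)).
    specialize (Hap s m Hs). cbv beta in E. rewrite finsum_scal in E.
    apply Rmult_le_reg_l with (2 ^ m); [specialize (H2 m); lra|].
    rewrite <- Rmult_assoc, <- Rpow_mult_distr, Rinv_r, pow1 by lra. lra. }
  destruct (geom_eventually_le (/ 2) Bap) as [m1 Hm1]; [lra|].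
  destruct (geom_eventually_le q Bap) as [m2 Hm2]; [lra|].
  destruct (square_geom_eventually_le (Bap / Amin)) as [m3 Hm3].
  { apply Rmult_le_pos; [easy|]. left. now apply Rinv_0_lt_compat. }
  set (m := (n + m1 + m2 + m3 + 1)%nat).
  set (H := fun m t => finsum (fun a => strip_wt q (fun x => wgt r A x t) a
                                     * row v t (fst a) (snd a) ^ 2) (strip e m)).
  assert (HHs : forall m t, H m t = finsum (fun y => q ^ l1norm y *
      finsum (fun x => wgt r A x t * row v t y x ^ 2) (seq 0 (S m))) (box e m)).
  { intros m' s. apply (strip_sum q (fun x => wgt r A x s) e m' (fun x y => row v s y x ^ 2)). }
  assert (Hin : forall m y s, 0 <= finsum (fun x => wgt r A x s * row v s y x ^ 2) (seq 0 (S m))).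
  { intros; apply finsum_nonneg; auto. }
  assert (Hle : forall m s, H m s <= half_sum e m (fun x y => wgt r A x s * row v s y x ^ 2)).
  { intros m' s. rewrite HHs. apply finsum_le; intros y _.
    specialize (Hq1 (l1norm y)). specialize (Hin m' y s). nra. }
  assert (Hmain : H m t + 1 <= conv_const e N M B Amax * (H m 0 + H m 1 + 2)).
  { apply (damped_convexity e N M B v q r A Amax m); try easy; try lra.
    - unfold m; lia.
    - intros s Hs. repeat split.
      + eapply Rle_trans; [apply (Hslice s (S m) m); [lra|lia]|]. apply Hm1. unfold m; lia.
      + apply Rle_trans with (q ^ m * Bap); [|apply Hm2; unfold m; lia].
        apply Rmult_le_compat_l; [left; auto|].
        eapply Rle_trans; [|apply (Hap s (S m)); lra].
        unfold half_sum. apply finsum_le; intros y _.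
        apply Rle_trans with (finsum (fun x => wgt r A x s * row v s y x ^ 2) (seq 0 (S (S m)))).
        * apply finsum_seq_le; [lia|auto].
        * apply finsum_le; intros x _. specialize (H2 x). specialize (HWv x s y x). nra.
      (* The cut term pairs [W (S m)] with [u_m]; the ratio of the weights costs [(m + 1)^2 / Amin],
         absorbed by the [(1/2)^m] of the slice. *)
      + apply Rle_trans with ((INR m + 1) ^ 2 * (/ 2) ^ m * (Bap / Amin));
          [|apply Hm3; unfold m; lia].
        apply Rle_trans with ((INR m + 1) ^ 2 / Amin *
           finsum (fun y => wgt r A m s * row v s y m ^ 2) (box e m)).
        * rewrite <- finsum_scal. apply finsum_le; intros y _.
          rewrite wgt_S by apply (cw_pos _ _ _ _ Hcw). rewrite Rmult_assoc.
          apply Rmult_le_compat_r; [auto|].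
          apply Rmult_le_compat; [left; auto|left; apply Rinv_0_lt_compat, (cw_pos _ _ _ _ Hcw)|auto|].
          apply Rinv_le_contravar; [easy|]. apply HA; lra.
        * replace ((INR m + 1) ^ 2 * (/ 2) ^ m * (Bap / Amin)) with
            ((INR m + 1) ^ 2 / Amin * ((/ 2) ^ m * Bap)) by (field; lra).
          apply Rmult_le_compat_l; [|apply Hslice; [lra|lia]].
          apply Rmult_le_pos; [apply pow2_ge_0|]. left; now apply Rinv_0_lt_compat. }
  assert (Hup : half_sum e n (fun x y => wgt r A x t * row v t y x ^ 2) <= 2 * H m t).
  { apply Rle_trans with (2 * H n t).
    - rewrite HHs. unfold half_sum. rewrite <- finsum_scal. apply finsum_le; intros y Hy.
      specialize (Hin n y t). assert (/ 2 <= q ^ l1norm y) by now apply Hqn, l1norm_box. nra.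
    - apply Rmult_le_compat_l; [lra|]. rewrite !HHs.
      apply Rle_trans with (finsum (fun y => q ^ l1norm y *
        finsum (fun x => wgt r A x t * row v t y x ^ 2) (seq 0 (S m))) (box e n)).
      + apply finsum_le; intros y _. apply Rmult_le_compat_l; [left; auto|].
        apply finsum_seq_le; [unfold m; lia|auto].
      + apply box_le; [unfold m; lia|]. intros y. apply Rmult_le_pos; [left; auto|auto]. }
  assert (H m 0 <= B0) by (eapply Rle_trans; [apply Hle|auto]).
  assert (H m 1 <= B0) by (eapply Rle_trans; [apply Hle|auto]).
  assert (0 < conv_const e N M B Amax) by apply exp_pos.
  nra.
Qed.

(** * Concentration of the weights *)

(** The ratio of consecutive squared factorials: [rprod sqS x] is [x!^2]. *)
Definition sqS (x : nat) : R := (INR x + 1) ^ 2.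

Lemma sqS_ge1 x : 1 <= sqS x.
Proof. unfold sqS. generalize (pos_INR x). nra. Qed.

Lemma rprod_ge1 r n : (forall x, 1 <= r x) -> 1 <= rprod r n.
Proof. intros H; induction n; simpl; [lra|]. specialize (H n). nra. Qed.

Lemma rprod_ext r r' n : (forall x, (x < n)%nat -> r x = r' x) -> rprod r n = rprod r' n.
Proof. intros H; induction n; simpl; [easy|]. rewrite H, IHn by (auto; lia). reflexivity. Qed.

Lemma rprod_le r r' n :
  (forall x, 0 <= r x) -> (forall x, r x <= r' x) -> 0 <= rprod r n <= rprod r' n.
Proof.
  intros H0 H; induction n; simpl; [lra|]. specialize (H0 n). specialize (H n). nra.
Qed.

Lemma rprod_const c n : rprod (fun _ => c) n = c ^ n.
Proof. induction n; simpl; congruence. Qed.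

Lemma inv_pow_le a b n : 0 < a -> a <= b -> / b ^ n <= / a ^ n.
Proof.
  intros Ha Hab. apply Rinv_le_contravar; [now apply pow_lt|]. apply pow_incr; lra.
Qed.

Definition half_bounded (e : nat) (v : list Z -> R -> R) (t : R) (w : nat -> R) (b : R) : Prop :=
  forall n, half_sum e n (fun x y => w x * row v t y x ^ 2) <= b.

Lemma half_bounded_le e v t w w' b :
  half_bounded e v t w' b -> (forall x, w x <= w' x) -> half_bounded e v t w b.
Proof.
  intros H Hw n. eapply Rle_trans; [|apply (H n)]. apply half_sum_le; intros x y _ _.
  apply Rmult_le_compat_r; [apply pow2_ge_0|auto].
Qed.

Lemma half_bounded_scal e v t w b c :
  0 <= c -> half_bounded e v t w b -> half_bounded e v t (fun x => c * w x) (c * b).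
Proof.
  intros Hc H n.
  replace (half_sum _ _ _) with (c * half_sum e n (fun x y => w x * row v t y x ^ 2)).
  - now apply Rmult_le_compat_l.
  - rewrite <- half_sum_scal. unfold half_sum. apply finsum_ext; intros.
    apply finsum_ext; intros. ring.
Qed.

Lemma half_bounded_nonneg e v t w b :
  (forall x, 0 <= w x) -> half_bounded e v t w b -> 0 <= b.
Proof.
  intros Hw H. eapply Rle_trans; [|apply (H 0%nat)].
  apply finsum_nonneg; intros; apply finsum_nonneg; intros.
  apply Rmult_le_pos; [auto|apply pow2_ge_0].
Qed.

Lemma zrange_split_le (G G1 : Z -> R) (G2 : nat -> R) n :
  (forall z, 0 <= G1 z) -> (forall z, (z < 0)%Z -> G z <= G1 z) ->
  (forall x, G (Z.of_nat x) <= G2 x) ->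
  finsum G (zrange n) <= finsum G1 (zrange n) + finsum G2 (seq 0 (S n)).
Proof.
  intros H1 Hn Hp. induction n as [|n IH].
  - rewrite !finsum_zrange_0. simpl. specialize (H1 0%Z). specialize (Hp 0%nat). simpl in Hp. lra.
  - rewrite !finsum_zrange_S, (finsum_seq_S G2 (S n)).
    specialize (Hn (- Z.of_nat (S n))%Z ltac:(lia)). specialize (Hp (S n)).
    specialize (H1 (Z.of_nat (S n))). lra.
Qed.

(** The generator is bounded, so exponential moments propagate. At negative first coordinates the
    full-lattice weight is 1, which adds [B] to the data; the cap of [dir_weight] is inactive on the
    box considered. *)
Lemma exp_weight_bound e N M B v Lam b :
  0 <= N -> 0 <= M -> 0 <= B -> lattice_sol (S e) N M B v -> 1 <= Lam ->
  half_bounded e v 0 (fun x => Lam ^ x) b ->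
  exists b', forall t, 0 <= t <= 1 -> half_bounded e v t (fun x => Lam ^ x) b'.
Proof.
  intros HN HM HB Hsol HL Hb.
  exists (2 * exp (2 * M + 2 * INR (S e) * N * (1 + 2 * Lam)) * (B + b)).
  intros t Ht n.
  eapply Rle_trans; [|apply (lattice_weighted_bound (S e) N M B v Lam 0 (B + b)
     HN HM HB Hsol HL ltac:(lra)) with (X := n) (n := n); [|easy]].
  - apply Rle_trans with (half_sum e n (fun x y => dir_weight Lam n (Z.of_nat x :: y)
        * v (Z.of_nat x :: y) t ^ 2)).
    + apply half_sum_le; intros x y Hx _. simpl. rewrite Nat2Z.id, Nat.min_l by easy. apply Rle_refl.
    + apply (half_sum_box e n (fun j => dir_weight Lam n j * v j t ^ 2)). intros j.
      apply Rmult_le_pos; [left; now apply dir_weight_pos|apply pow2_ge_0].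
  - intros X m. rewrite finsum_box_S.
    eapply Rle_trans; [apply (zrange_split_le _
      (fun z => finsum (fun y => v (z :: y) 0 ^ 2) (box e m))
      (fun x => finsum (fun y => Lam ^ x * v (Z.of_nat x :: y) 0 ^ 2) (box e m)))|].
    + intros; apply finsum_nonneg; intros; apply pow2_ge_0.
    + intros z Hz. apply finsum_le; intros y _. unfold dir_weight.
      replace (Z.to_nat z) with 0%nat by lia. simpl. lra.
    + intros x. apply finsum_le; intros y _. apply Rmult_le_compat_r; [apply pow2_ge_0|].
      simpl. rewrite Nat2Z.id. apply Rle_pow; [easy|lia].
    + apply Rplus_le_compat.
      * generalize (ls_bound _ _ _ _ _ Hsol 0 m). now rewrite finsum_box_S.
      * rewrite finsum_swap. apply (Hb m).
Qed.

(** For constant [A] both [p] and [p1] vanish, [g = 0] will do, and the form is diagonal with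
    entries proportional to the increments of [r]. *)
Lemma static_convex_weight N (s2 : R) (r : nat -> R) :
  0 < s2 -> (forall x, 1 <= r x) -> (forall x, r x <= r (S x)) ->
  convex_weight N s2 r (fun _ => s2).
Proof.
  intros Hs Hr Hinc. constructor; auto.
  - intros; lra.
  - intros; apply continuous_const.
  - exists (fun _ => 0), (fun _ => 0). split; [|split; [|split]].
    + intros; apply continuous_const.
    + intros t. replace (2 * 0 * s2) with 0 by ring. apply (is_derive_const s2).
    + intros t. apply (is_derive_const 0).
    + intros t _. exists (fun _ => 0). repeat split; intros x; [lra|lra|].
      assert (0 <= (r x / s2 - prev (fun x => r x / s2) x)).
      { assert (0 < / s2) by now apply Rinv_0_lt_compat. destruct x as [|x]; simpl.
        - specialize (Hr 0%nat). assert (0 <= r 0%nat / s2); [|lra]. apply Rmult_le_pos; lra.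
        - specialize (Hinc x). unfold Rdiv. nra. }
      assert (prev (fun _ => 0) x = 0) by now destruct x. rewrite H0.
      generalize (pow2_ge_0 N). nra.
Qed.

Definition hyp_A (s dl : R) (t : R) : R := s ^ 2 * (dl + (t - / 2) ^ 2).

(** Let E = dl + (t - 1/2)^2. As [p^2] and [p'] are at most 1/E and the ratios are [r x / (s^2 E)],
    every term of the condition carries the factor 1/E, and what remains is free of [dl] and [t]. A
    quarter of the increments of [sqS] is enough, which leaves room for the cap. *)
Lemma hyperbolic_convex_weight N (r : nat -> R) dl :
  0 < N -> 0 < dl -> dl <= 1 -> (forall x, 1 <= r x) -> (forall x, r x <= sqS x) ->
  (forall x, (2 * INR x + 1) / 4 <= r x - prev r x) ->
  convex_weight N (2 * (N / 10) ^ 2) r (hyp_A (N / 10) dl).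
Proof.
  (* The 10 makes [N^2 (2x+1)/8] exceed [s^2 x + N s (2x+1)]; the margin is
     [N^2 ((2x+1)/40 - x/100)]. *)
  intros HN Hdl Hdl1 Hr Hr2 Hinc. set (s := N / 10). assert (Hs : 0 < s) by (unfold s; lra).
  assert (Hs2 : 0 < s ^ 2) by now apply pow_lt.
  assert (HE : forall t, 0 < dl + (t - / 2) ^ 2) by (intros t; generalize (pow2_ge_0 (t - / 2)); lra).
  assert (HA : forall t, 0 < hyp_A s dl t) by (intros; now apply Rmult_lt_0_compat).
  assert (HAd : forall t, is_derive (hyp_A s dl) t
            (2 * ((t - / 2) / (dl + (t - / 2) ^ 2)) * hyp_A s dl t)).
  { intros t. unfold hyp_A. auto_derive; [easy|]. field. specialize (HE t). simpl in *. lra. }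
  assert (Hpd : forall t, is_derive (fun t => (t - / 2) / (dl + (t - / 2) ^ 2)) t
            ((dl - (t - / 2) ^ 2) / (dl + (t - / 2) ^ 2) ^ 2)).
  { intros t. specialize (HE t). auto_derive; [simpl in *; lra|]. field. simpl in *. lra. }
  constructor; auto.
  - intros t Ht. unfold hyp_A. assert ((t - / 2) ^ 2 <= 1) by nra. nra.
  - intros t. apply (ex_derive_continuous (hyp_A s dl)). eexists; apply HAd.
  - exists (fun t => (t - / 2) / (dl + (t - / 2) ^ 2)),
      (fun t => (dl - (t - / 2) ^ 2) / (dl + (t - / 2) ^ 2) ^ 2). split; [|split; [|split]]; auto.
    + intros t. apply (ex_derive_continuous (fun t => (t - / 2) / (dl + (t - / 2) ^ 2))).
      eexists; apply Hpd.
    + intros t Ht. specialize (HA t). specialize (HE t).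
      (* The square root of [p^2 r / A] after the estimates [p^2 <= 1/E] and [r x <= (x+1)^2]. *)
      exists (fun x => s * (INR x + 1) / hyp_A s dl t).
      set (ta := t - / 2) in *. set (E := dl + ta ^ 2) in *.
      assert (EA : hyp_A s dl t = s ^ 2 * E) by reflexivity.
      rewrite EA in *. clear EA.
      assert (Hta : 0 <= ta ^ 2) by apply pow2_ge_0.
      repeat split; intros x.
      * assert (0 <= INR x) by apply pos_INR.
        apply Rmult_le_pos; [nra|]. left; now apply Rinv_0_lt_compat.
      * specialize (Hr2 x). specialize (Hr x). unfold sqS in Hr2.
        apply Rmult_le_reg_r with (s ^ 2 * E ^ 3);
          [apply Rmult_lt_0_compat; [easy|now apply pow_lt]|].
        replace ((ta / E) ^ 2 * (r x / (s ^ 2 * E)) * (s ^ 2 * E ^ 3)) with (ta ^ 2 * r x)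
          by (field; split; lra).
        replace ((s * (INR x + 1) / (s ^ 2 * E)) ^ 2 * (s ^ 2 * E ^ 3)) with (E * (INR x + 1) ^ 2)
          by (field; split; lra).
        apply Rmult_le_compat; [easy|lra| |easy]. unfold E; lra.
      * specialize (Hinc x). assert (Hx : 0 <= INR x) by apply pos_INR.
        assert (E1 : prev (fun x => s * (INR x + 1) / (s ^ 2 * E)) x = s * INR x / (s ^ 2 * E)).
        { destruct x as [|x]; unfold prev; [simpl; unfold Rdiv; ring|]. now rewrite S_INR. }
        assert (E2 : prev (fun x => r x / (s ^ 2 * E)) x = prev r x / (s ^ 2 * E)).
        { destruct x as [|x]; unfold prev; [unfold Rdiv; ring|reflexivity]. }
        rewrite E1, E2.
        assert (Hp1 : (dl - ta ^ 2) / E ^ 2 <= / E).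
        { apply Rmult_le_reg_r with (E ^ 2); [now apply pow_lt|].
          replace ((dl - ta ^ 2) / E ^ 2 * E ^ 2) with (dl - ta ^ 2) by (field; lra).
          replace (/ E * E ^ 2) with E by (field; lra). unfold E. lra. }
        apply Rle_trans with (- INR x * / E + N ^ 2 / 2 * ((2 * INR x + 1) / 4 / (s ^ 2 * E))
           - N * (s * (2 * INR x + 1) / (s ^ 2 * E))).
        -- replace (- INR x * / E + N ^ 2 / 2 * ((2 * INR x + 1) / 4 / (s ^ 2 * E))
             - N * (s * (2 * INR x + 1) / (s ^ 2 * E)))
             with ((- INR x * s ^ 2 + N ^ 2 * (2 * INR x + 1) / 8 - N * s * (2 * INR x + 1))
                   / (s ^ 2 * E)) by (field; split; lra).
           apply Rmult_le_pos; [|left; now apply Rinv_0_lt_compat].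
           unfold s. replace (- INR x * (N / 10) ^ 2 + N ^ 2 * (2 * INR x + 1) / 8
              - N * (N / 10) * (2 * INR x + 1)) with (N ^ 2 * ((2 * INR x + 1) / 40 - INR x / 100))
             by field.
           apply Rmult_le_pos; [apply pow2_ge_0|lra].
        -- assert (H1 : INR x * ((dl - ta ^ 2) / E ^ 2) <= INR x * / E)
             by now apply Rmult_le_compat_l.
           assert (H2 : N ^ 2 / 2 * ((2 * INR x + 1) / 4 / (s ^ 2 * E))
              <= N ^ 2 / 2 * (r x / (s ^ 2 * E) - prev r x / (s ^ 2 * E))).
           { apply Rmult_le_compat_l; [generalize (pow2_ge_0 N); lra|].
             replace (r x / (s ^ 2 * E) - prev r x / (s ^ 2 * E))
               with ((r x - prev r x) / (s ^ 2 * E)) by (unfold Rdiv; ring).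
             apply Rmult_le_compat_r; [left; now apply Rinv_0_lt_compat|easy]. }
           replace (s * (2 * INR x + 1) / (s ^ 2 * E)) with
             (s * (INR x + 1) / (s ^ 2 * E) + s * INR x / (s ^ 2 * E)) by (unfold Rdiv; ring).
           lra.
Qed.

Lemma half_bounded_convexity e N M B v r A Amax Amin Bap B0 :
  0 <= N -> 0 <= M -> 0 <= B -> lattice_sol (S e) N M B v ->
  convex_weight N Amax r A -> 0 < Amin -> (forall t, 0 <= t <= 1 -> Amin <= A t) ->
  (forall x, r x <= sqS x) ->
  (forall t, 0 <= t <= 1 -> half_bounded e v t (fun x => 2 ^ x * wgt r A x t) Bap) ->
  half_bounded e v 0 (fun x => wgt r A x 0) B0 ->
  half_bounded e v 1 (fun x => wgt r A x 1) B0 ->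
  forall t, 0 <= t <= 1 ->
  half_bounded e v t (fun x => wgt r A x t) (4 * conv_const e N M B Amax * (B0 + 1)).
Proof.
  intros HN HM HB Hsol Hcw HAmin HA Hr Hap H0 H1 t Ht n.
  apply (convexity_step e N M B v r A Amax Amin Bap B0); auto.
  intros t' n' Ht'. eapply Rle_trans; [|apply (Hap t' Ht' n')].
  right. unfold half_sum. apply finsum_ext; intros; apply finsum_ext; intros; ring.
Qed.

(* A truncation [r] of [sqS] that agrees with it up to [n] suffices to control [half_sum e n]. *)
Lemma half_bounded_sqS e v t A b :
  (forall n, exists r, (forall x, (x < n)%nat -> r x = sqS x) /\
     half_bounded e v t (fun x => wgt r A x t) b) ->
  half_bounded e v t (fun x => wgt sqS A x t) b.
Proof.
  intros H n. destruct (H (S n)) as (r & Hr & Hb). eapply Rle_trans; [|apply (Hb n)].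
  apply half_sum_le; intros x y Hx _. unfold wgt.
  rewrite (rprod_ext sqS r) by (intros; symmetry; apply Hr; lia). apply Rle_refl.
Qed.

Lemma rprod_sqS_pos x : 0 < rprod sqS x.
Proof. apply rprod_pos. intros y. generalize (sqS_ge1 y). lra. Qed.

Lemma pow_le_sqS_pow Lam c :
  0 <= Lam -> 0 < c -> exists C, 0 <= C /\ forall x, Lam ^ x <= C * (rprod sqS x * c ^ x).
Proof.
  intros HL Hc.
  destruct (INR_unbounded (Lam / c)) as [n0 Hn0].
  apply (eventually_ratio_bound (fun x => Lam ^ x) (fun x => rprod sqS x * c ^ x) n0).
  - intros x. apply Rmult_lt_0_compat; [apply rprod_sqS_pos|now apply pow_lt].
  - intros; now apply pow_le.
  - intros n Hn. simpl. apply le_INR in Hn.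
    assert (Lam <= sqS n * c).
    { apply Rle_trans with (INR n0 * c).
      - apply Rmult_le_reg_r with (/ c); [now apply Rinv_0_lt_compat|].
        rewrite Rmult_assoc, Rinv_r by lra. unfold Rdiv in Hn0. lra.
      - apply Rmult_le_compat_r; [lra|]. unfold sqS. generalize (pos_INR n). nra. }
    assert (0 <= Lam ^ n) by now apply pow_le.
    assert (0 < rprod sqS n) by apply rprod_sqS_pos. assert (0 < c ^ n) by now apply pow_lt.
    assert (0 <= Lam ^ n * (rprod sqS n * c ^ n)).
    { apply Rmult_le_pos; [easy|]. left; now apply Rmult_lt_0_compat. }
    replace (Lam * Lam ^ n * (rprod sqS n * c ^ n)) with (Lam * (Lam ^ n * (rprod sqS n * c ^ n))) by ring.
    replace (Lam ^ n * (sqS n * rprod sqS n * (c * c ^ n)))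
      with (sqS n * c * (Lam ^ n * (rprod sqS n * c ^ n))) by ring.
    now apply Rmult_le_compat_r.
Qed.

(** Ratios capped at [X^2] make the weight exponential, so Gronwall supplies the a priori bound for
    the convexity; the resulting bound does not see [X], and the cap can be lifted. *)
Lemma static_bound e N M B v s2 Bd :
  0 <= N -> 0 <= M -> 0 <= B -> lattice_sol (S e) N M B v -> 0 < s2 ->
  half_bounded e v 0 (fun x => wgt sqS (fun _ => s2) x 0) Bd ->
  half_bounded e v 1 (fun x => wgt sqS (fun _ => s2) x 1) Bd ->
  exists b, forall t, 0 <= t <= 1 -> half_bounded e v t (fun x => wgt sqS (fun _ => s2) x t) b.
Proof.
  intros HN HM HB Hsol Hs H0 H1.
  exists (4 * conv_const e N M B s2 * (Bd + 1)). intros t Ht.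
  apply half_bounded_sqS. intros n.
  set (X := INR (S n)). assert (HX : 1 <= X) by (unfold X; rewrite S_INR; generalize (pos_INR n); lra).
  set (r := fun x => Rmin (sqS x) (X ^ 2)).
  assert (Hr1 : forall x, 1 <= r x).
  { intros x. apply Rmin_glb; [apply sqS_ge1|nra]. }
  assert (Hrinc : forall x, r x <= r (S x)).
  { intros x. apply Rmin_glb; [|apply Rmin_r]. eapply Rle_trans; [apply Rmin_l|].
    unfold sqS. rewrite S_INR. generalize (pos_INR x). nra. }
  assert (HrX : forall x, rprod r x <= (X ^ 2) ^ x).
  { intros x. rewrite <- rprod_const. apply rprod_le; [intros y; specialize (Hr1 y); lra|].
    intros; apply Rmin_r. }
  exists r. split.
  { intros x Hx. unfold r. apply Rmin_left. unfold sqS, X. rewrite S_INR.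
    apply lt_INR in Hx. generalize (pos_INR x). nra. }
  (* The 2 is the spare factor [2^x] demanded of the a priori bound. *)
  set (Lam := Rmax 1 (2 * X ^ 2 / s2)).
  assert (HLam : 1 <= Lam) by apply Rmax_l.
  assert (Hle : forall x s, 2 ^ x * wgt r (fun _ => s2) x s <= Lam ^ x).
  { intros x s. unfold wgt. apply Rle_trans with ((2 * X ^ 2 / s2) ^ x).
    - unfold Rdiv. rewrite !Rpow_mult_distr, pow_inv, <- Rmult_assoc.
      apply Rmult_le_compat_r; [left; apply Rinv_0_lt_compat, pow_lt; lra|].
      apply Rmult_le_compat_l; [apply pow_le; lra|]. apply HrX.
    - apply pow_incr. split; [|apply Rmax_r].
      apply Rmult_le_pos; [nra|left; now apply Rinv_0_lt_compat]. }
  assert (Hdat : forall s, half_bounded e v s (fun x => wgt sqS (fun _ => s2) x s) Bd ->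
      half_bounded e v s (fun x => wgt r (fun _ => s2) x s) Bd).
  { intros s Hb. apply (half_bounded_le _ _ _ _ _ _ Hb). intros x. unfold wgt.
    apply Rmult_le_compat_r; [left; apply Rinv_0_lt_compat, pow_lt; lra|].
    apply rprod_le; [intros y; specialize (Hr1 y); lra|]. intros; apply Rmin_l. }
  destruct (pow_le_sqS_pow Lam (/ s2)) as (C & HC & HLC); [lra|now apply Rinv_0_lt_compat|].
  destruct (exp_weight_bound e N M B v Lam (C * Bd)) as [b' Hb']; auto.
  { apply (half_bounded_le e v 0 _ (fun x => C * wgt sqS (fun _ => s2) x 0)).
    - now apply half_bounded_scal.
    - intros x. eapply Rle_trans; [apply HLC|]. unfold wgt, Rdiv. rewrite pow_inv. lra. }
  apply (half_bounded_convexity e N M B v r (fun _ => s2) s2 s2 b'); auto.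
  - now apply static_convex_weight.
  - intros; lra.
  - intros; apply Rmin_l.
  - intros s Hs'. apply (half_bounded_le _ _ _ _ _ _ (Hb' s Hs')). intros; apply Hle.
Qed.

Lemma wgt_antitone r A A' x t :
  (forall x, 0 < r x) -> 0 < A t -> A t <= A' t -> wgt r A' x t <= wgt r A x t.
Proof.
  intros Hr HA Hle. unfold wgt. apply Rmult_le_compat_l; [left; now apply rprod_pos|].
  now apply inv_pow_le.
Qed.

Section Concentration.
Variables (e : nat) (N M B Bd : R) (v : list Z -> R -> R).
Hypotheses (HN : 0 < N) (HM : 0 <= M) (HB : 0 <= B).
Hypothesis Hsol : lattice_sol (S e) N M B v.
Let s := N / 10.
Hypothesis Hd0 : half_bounded e v 0 (fun x => rprod sqS x * (4 / s ^ 2) ^ x) Bd.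
Hypothesis Hd1 : half_bounded e v 1 (fun x => rprod sqS x * (4 / s ^ 2) ^ x) Bd.

Let A (m : nat) : R -> R := hyp_A s ((2 / 3) ^ m).

Lemma conc_s2_pos : 0 < s ^ 2.
Proof. apply pow_lt. unfold s; lra. Qed.

Lemma conc_delta m : 0 < (2 / 3) ^ m <= 1.
Proof.
  split; [apply pow_lt; lra|]. rewrite <- (pow1 m). apply pow_incr; lra.
Qed.

Lemma conc_A_pos m t : 0 < A m t.
Proof.
  apply Rmult_lt_0_compat; [apply conc_s2_pos|].
  generalize (conc_delta m) (pow2_ge_0 (t - / 2)). lra.
Qed.

(** At both endpoints [(t - 1/2)^2 = 1/4], hence [A >= s^2 / 4] for every delta: the data bound is
    uniform in [m]. *)
Lemma conc_data m t : (t = 0 \/ t = 1) ->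
  half_bounded e v t (fun x => wgt sqS (A m) x t) Bd.
Proof.
  intros Ht.
  apply (half_bounded_le e v t _ (fun x => rprod sqS x * (4 / s ^ 2) ^ x)).
  - now destruct Ht as [->| ->].
  - intros x. unfold wgt. apply Rmult_le_compat_l; [left; apply rprod_sqS_pos|].
    replace (4 / s ^ 2) with (/ (s ^ 2 / 4)) by (field; generalize conc_s2_pos; nra).
    rewrite pow_inv. apply inv_pow_le; [generalize conc_s2_pos; lra|].
    unfold A, hyp_A. generalize (conc_delta m) conc_s2_pos. intros.
    assert (/ 4 <= (2 / 3) ^ m + (t - / 2) ^ 2) by (destruct Ht as [->| ->]; lra). nra.
Qed.

(** The incoming bound [b] is needed for finiteness only and does not appear in the new bound, which
    is therefore uniform in [m]. *)
Lemma conc_step m b :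
  (forall t, 0 <= t <= 1 -> half_bounded e v t (fun x => wgt sqS (A m) x t) b) ->
  forall t, 0 <= t <= 1 ->
  half_bounded e v t (fun x => wgt sqS (A (S m)) x t)
    (4 * conv_const e N M B (2 * s ^ 2) * (Bd + 1)).
Proof.
  intros Hb t Ht. apply half_bounded_sqS. intros n.
  set (X := INR (S n)). assert (HX : 1 <= X) by (unfold X; rewrite S_INR; generalize (pos_INR n); lra).
  (* The cap grows like [(x/2)^2]: its increments are exactly the [(2x+1)/4] that the form requires,
     and below [n] the minimum is still [sqS]. *)
  set (r := fun x => Rmin (sqS x) (X ^ 2 + sqS x / 4)).
  assert (Hr1 : forall x, 1 <= r x).
  { intros x. generalize (sqS_ge1 x). intros. apply Rmin_glb; nra. }
  assert (Hr0 : forall x, 0 < r x) by (intros x; specialize (Hr1 x); lra).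
  assert (HrS : forall x, r x <= sqS x) by (intros; apply Rmin_l).
  exists r. split.
  { intros x Hx. unfold r. apply Rmin_left. unfold sqS, X. rewrite S_INR.
    apply lt_INR in Hx. generalize (pos_INR x). nra. }
  destruct (INR_unbounded (4 * X)) as [n0 Hn0].
  (* The 3 is the spare 2 times the 3/2 lost by lowering delta. Once [sqS x >= 16 X^2], the capped
     ratio is at most 5/16 of [sqS x], less than a third. *)
  destruct (eventually_ratio_bound (fun x => 3 ^ x * rprod r x) (rprod sqS) n0) as (C & HC & HCx).
  { apply rprod_sqS_pos. }
  { intros x. apply Rmult_le_pos; [apply pow_le; lra|]. left; now apply rprod_pos. }
  { intros x Hx. apply le_INR in Hx. simpl.
    assert (3 * r x <= sqS x).
    { assert (r x <= X ^ 2 + sqS x / 4) by apply Rmin_r.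
      assert (16 * X ^ 2 <= sqS x) by (unfold sqS; nra). nra. }
    assert (0 <= 3 ^ x * rprod r x * rprod sqS x).
    { apply Rmult_le_pos; [apply Rmult_le_pos; [apply pow_le; lra|left; now apply rprod_pos]|].
      left; apply rprod_sqS_pos. }
    nra. }
  assert (Hcw : convex_weight N (2 * s ^ 2) r (A (S m))).
  { apply hyperbolic_convex_weight; auto; [apply (conc_delta (S m))|apply (conc_delta (S m))|].
    intros x. destruct x as [|x]; simpl prev.
    - specialize (Hr1 0%nat). simpl INR. lra.
    - assert (r x + (2 * INR (S x) + 1) / 4 <= r (S x)); [|lra].
      apply Rmin_glb.
      + apply Rle_trans with (sqS x + (2 * INR (S x) + 1) / 4); [apply Rplus_le_compat_r, Rmin_l|].
        unfold sqS. rewrite S_INR. generalize (pos_INR x). nra.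
      + apply Rle_trans with (X ^ 2 + sqS x / 4 + (2 * INR (S x) + 1) / 4);
          [apply Rplus_le_compat_r, Rmin_r|].
        unfold sqS. rewrite S_INR. right. field. }
  assert (Hdat : forall s', s' = 0 \/ s' = 1 ->
      half_bounded e v s' (fun x => wgt r (A (S m)) x s') Bd).
  { intros s' Hs'. apply (half_bounded_le _ _ _ _ _ _ (conc_data (S m) s' Hs')). intros x. unfold wgt.
    apply Rmult_le_compat_r; [left; apply Rinv_0_lt_compat, pow_lt, conc_A_pos|].
    apply rprod_le; [intros y; specialize (Hr1 y); lra|easy]. }
  apply (half_bounded_convexity e N M B v r (A (S m)) (2 * s ^ 2) (s ^ 2 * (2 / 3) ^ S m) (C * b));
    auto; try lra.
  - apply Rmult_lt_0_compat; [apply conc_s2_pos|apply conc_delta].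
  - intros s' _. unfold A, hyp_A. apply Rmult_le_compat_l; [left; apply conc_s2_pos|].
    generalize (pow2_ge_0 (s' - / 2)). lra.
  - intros s' Hs'.
    apply (half_bounded_le e v s' _ (fun x => C * wgt sqS (A m) x s'));
      [now apply half_bounded_scal, Hb|].
    intros x. specialize (HCx x). cbv beta in HCx. unfold wgt.
    assert (HAA : 2 / 3 * A m s' <= A (S m) s').
    { unfold A, hyp_A. simpl ((2 / 3) ^ S m). generalize conc_s2_pos (pow2_ge_0 (s' - / 2)). nra. }
    assert (HAm := conc_A_pos m s').
    assert (Hinv : / A (S m) s' ^ x <= (3 / 2) ^ x * / A m s' ^ x).
    { eapply Rle_trans; [apply (inv_pow_le (2 / 3 * A m s')); [lra|exact HAA]|].
      rewrite Rpow_mult_distr, Rinv_mult, <- pow_inv.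
      replace (/ (2 / 3)) with (3 / 2) by field. lra. }
    assert (HP : 0 < rprod r x) by now apply rprod_pos.
    apply Rle_trans with (2 ^ x * (rprod r x * ((3 / 2) ^ x * / A m s' ^ x))).
    + apply Rmult_le_compat_l; [apply pow_le; lra|]. apply Rmult_le_compat_l; lra.
    + replace (2 ^ x * (rprod r x * ((3 / 2) ^ x * / A m s' ^ x)))
        with (3 ^ x * rprod r x * / A m s' ^ x).
      * unfold Rdiv. rewrite <- Rmult_assoc. apply Rmult_le_compat_r; [|easy].
        left. now apply Rinv_0_lt_compat, pow_lt.
      * replace 3 with (2 * (3 / 2)) at 1 by field. rewrite Rpow_mult_distr. ring.
Qed.

(** At [m = 0] delta is 1 and [A >= s^2], so the static weight dominates and starts the
    induction. *)
Lemma conc_all m : exists b, forall t, 0 <= t <= 1 ->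
  half_bounded e v t (fun x => wgt sqS (A m) x t) b.
Proof.
  induction m as [|m [b Hb]].
  - assert (Hs : forall t, t = 0 \/ t = 1 ->
       half_bounded e v t (fun x => wgt sqS (fun _ => s ^ 2) x t) Bd).
    { intros t Ht. apply (half_bounded_le e v t _ (fun x => rprod sqS x * (4 / s ^ 2) ^ x)).
      - now destruct Ht as [->| ->].
      - intros x. unfold wgt. apply Rmult_le_compat_l; [left; apply rprod_sqS_pos|].
        replace (4 / s ^ 2) with (/ (s ^ 2 / 4)) by (field; generalize conc_s2_pos; nra).
        rewrite pow_inv. apply inv_pow_le; generalize conc_s2_pos; lra. }
    destruct (static_bound e N M B v (s ^ 2) Bd) as [b Hb]; auto; try lra; [apply conc_s2_pos|].
    exists b. intros t Ht. apply (half_bounded_le _ _ _ _ _ _ (Hb t Ht)). intros x.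
    apply wgt_antitone; [intros y; generalize (sqS_ge1 y); lra|apply conc_s2_pos|].
    unfold A, hyp_A. simpl. generalize conc_s2_pos (pow2_ge_0 (t - / 2)). simpl. nra.
  - eexists. apply (conc_step m b Hb).
Qed.

(** At time 1/2, [A = s^2 delta] exactly, and the bound reads [x!^2 u_x^2 <= K (s^2 delta)^x]. For
    [x >= 1] the right side tends to 0 with delta; at [x = 0] it says nothing. *)
Lemma concentration x y : (1 <= x)%nat -> length y = e -> row v (/ 2) y x = 0.
Proof.
  intros Hx Hy. set (K := 4 * conv_const e N M B (2 * s ^ 2) * (Bd + 1)).
  assert (Hs := conc_s2_pos).
  (* One further step trades the bound of [conc_all], which may depend on [m], for the uniform
     [K]. *)
  assert (HK : forall m, half_bounded e v (/ 2) (fun x => wgt sqS (A (S m)) x (/ 2)) K).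
  { intros m. destruct (conc_all m) as [b Hb]. apply (conc_step m b Hb). lra. }
  assert (HK0 : 0 <= K).
  { apply (half_bounded_nonneg e v (/ 2) (fun x => wgt sqS (A 1%nat) x (/ 2))); [|apply HK].
    intros z. left. apply wgt_pos; [intros w; generalize (sqS_ge1 w); lra|apply conc_A_pos]. }
  destruct (box_exists y) as [n0 Hn0]. rewrite Hy in Hn0.
  assert (Hv : forall m, row v (/ 2) y x ^ 2 <= (2 / 3) ^ S m * (K * (s ^ 2) ^ x)).
  { intros m. specialize (HK m (n0 + x)%nat).
    assert (Hpos : forall z w, 0 <= wgt sqS (A (S m)) z (/ 2) * row v (/ 2) w z ^ 2).
    { intros z w. apply Rmult_le_pos; [|apply pow2_ge_0].
      left. apply wgt_pos; [intros u; generalize (sqS_ge1 u); lra|apply conc_A_pos]. }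
    assert (H1 : wgt sqS (A (S m)) x (/ 2) * row v (/ 2) y x ^ 2 <= K).
    { eapply Rle_trans; [|exact HK].
      eapply Rle_trans; [|apply (half_sum_slice e (n0 + x) n0 x
          (fun x y => wgt sqS (A (S m)) x (/ 2) * row v (/ 2) y x ^ 2)); [lia|lia|auto]].
      apply (finsum_member (fun y => wgt sqS (A (S m)) x (/ 2) * row v (/ 2) y x ^ 2)); auto. }
    assert (HA : A (S m) (/ 2) = s ^ 2 * (2 / 3) ^ S m).
    { unfold A, hyp_A. ring. }
    destruct (conc_delta (S m)) as [Hd Hd']. set (dl := (2 / 3) ^ S m) in *.
    assert (HAx : A (S m) (/ 2) ^ x <= (s ^ 2) ^ x * dl).
    { rewrite HA, Rpow_mult_distr. apply Rmult_le_compat_l; [apply pow_le; lra|].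
      replace dl with (dl ^ 1) at 2 by ring. apply pow_decr; [lra|easy]. }
    assert (HAp : 0 < A (S m) (/ 2) ^ x) by apply pow_lt, conc_A_pos.
    assert (H2 : rprod sqS x * row v (/ 2) y x ^ 2 <= K * A (S m) (/ 2) ^ x).
    { unfold wgt in H1. apply Rmult_le_compat_r with (r := A (S m) (/ 2) ^ x) in H1; [|lra].
      replace (rprod sqS x / A (S m) (/ 2) ^ x * row v (/ 2) y x ^ 2 * A (S m) (/ 2) ^ x)
        with (rprod sqS x * row v (/ 2) y x ^ 2) in H1 by (field; lra). exact H1. }
    assert (1 <= rprod sqS x) by (apply rprod_ge1, sqS_ge1).
    generalize (pow2_ge_0 (row v (/ 2) y x)). intros.
    assert (K * A (S m) (/ 2) ^ x <= K * ((s ^ 2) ^ x * dl)) by now apply Rmult_le_compat_l.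
    nra. }
  assert (H0 : row v (/ 2) y x ^ 2 <= 0).
  { change (Rbar_le (row v (/ 2) y x ^ 2) 0).
    apply (is_lim_seq_le (fun _ => row v (/ 2) y x ^ 2)
             (fun m => (2 / 3) ^ S m * (K * (s ^ 2) ^ x))); [exact Hv|apply is_lim_seq_const|].
    replace (Finite 0) with (Rbar_mult 0 (K * (s ^ 2) ^ x)) by (simpl; f_equal; ring).
    apply (is_lim_seq_scal_r (fun m => (2 / 3) ^ S m)).
    apply (is_lim_seq_incr_1 (fun m => (2 / 3) ^ m)). apply is_lim_seq_geom.
    rewrite Rabs_pos_eq; lra. }
  nra.
Qed.
End Concentration.

(** * Macdonald functions *)

Definition mac_f (nu z s : R) : R := exp (- z * cosh s) * cosh (nu * s).
Definition mac_F (nu z b : R) : R := RInt (mac_f nu z) 0 b.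

Lemma cosh_derive x : is_derive cosh x (sinh x).
Proof. apply is_derive_Reals, derivable_pt_lim_cosh. Qed.

Lemma sinh_derive x : is_derive sinh x (cosh x).
Proof. apply is_derive_Reals, derivable_pt_lim_sinh. Qed.

Lemma mac_f_continuous nu z s : continuous (mac_f nu z) s.
Proof.
  apply (ex_derive_continuous (mac_f nu z)). unfold mac_f, cosh. auto_derive. easy.
Qed.

Lemma mac_F_derive nu z b : is_derive (mac_F nu z) b (mac_f nu z b).
Proof.
  apply (is_derive_RInt (mac_f nu z) (mac_F nu z) 0); [|apply mac_f_continuous].
  exists (mkposreal 1 Rlt_0_1). intros x _. apply (RInt_correct (mac_f nu z)).
  apply ex_RInt_continuous. intros; apply mac_f_continuous.
Qed.

Lemma mac_F_0 nu z : mac_F nu z 0 = 0.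
Proof. exact (RInt_point 0 (mac_f nu z)). Qed.

Lemma incr_of_derive_nonneg (G dG : R -> R) a b :
  a <= b -> (forall t, is_derive G t (dG t)) -> (forall t, a < t < b -> 0 <= dG t) ->
  G a <= G b.
Proof.
  intros Hab Hd Hp. apply derive_nonneg_incr; [easy| |].
  - intros t _. apply (ex_derive_continuous G). eexists; apply Hd.
  - intros t Ht. exists (dG t). auto.
Qed.

Lemma cosh_pos x : 0 < cosh x.
Proof. unfold cosh. generalize (exp_pos x) (exp_pos (- x)). lra. Qed.

Lemma cosh_sub x y : cosh (x + y) - 2 * sinh y * sinh x = cosh (x - y).
Proof.
  unfold cosh, sinh, Rminus. rewrite !Ropp_plus_distr, !exp_plus.
  replace (- - y) with y by ring. field.
Qed.

Lemma mac_f_pos nu z s : 0 < mac_f nu z s.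
Proof. apply Rmult_lt_0_compat; [apply exp_pos|apply cosh_pos]. Qed.

Lemma exp_le x y : x <= y -> exp x <= exp y.
Proof. intros [H| ->]; [left; now apply exp_increasing|lra]. Qed.

Lemma cosh_le x y : Rabs x <= Rabs y -> cosh x <= cosh y.
Proof.
  assert (E : forall x, cosh x = cosh (Rabs x)).
  { intros w. unfold Rabs. destruct Rcase_abs; [|easy]. unfold cosh. rewrite Ropp_involutive. lra. }
  rewrite (E x), (E y). assert (Hx := Rabs_pos x). generalize (Rabs x) (Rabs y) Hx. clear.
  intros x y Hx Hxy. apply (incr_of_derive_nonneg cosh sinh); [easy|apply cosh_derive|].
  intros t Ht. unfold sinh. assert (exp (- t) <= exp t) by (apply exp_le; lra). lra.
Qed.

Lemma exp_pow x n : exp x ^ n = exp (INR n * x).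
Proof.
  induction n as [|n IH].
  - simpl. now rewrite Rmult_0_l, exp_0.
  - rewrite S_INR. simpl. rewrite IH, <- exp_plus. f_equal. ring.
Qed.

(** With w = z e^s / 2, [exp (- z cosh s) <= exp (- w)]; and [w / k <= exp (w / k)], raised to a
    power [k > nu + 1], makes a multiple of [exp w] exceed [exp ((nu + 1) s)]. *)
Lemma mac_f_decay nu z : 0 <= nu -> 0 < z ->
  exists C, 0 < C /\ forall s, 0 <= s -> mac_f nu z s <= C * exp (- s).
Proof.
  intros Hnu Hz. destruct (INR_unbounded (nu + 1)) as [k Hk].
  assert (Hk0 : 0 < 2 * INR k / z).
  { apply Rmult_lt_0_compat; [lra|now apply Rinv_0_lt_compat]. }
  exists ((2 * INR k / z) ^ k). split; [now apply pow_lt|]. intros s Hs.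
  assert (He : 0 < exp s) by apply exp_pos.
  set (w := z * exp s / 2).
  assert (H1 : exp (- z * cosh s) <= exp (- w)).
  { apply exp_le. unfold w, cosh. generalize (exp_pos (- s)). nra. }
  assert (H2 : cosh (nu * s) <= exp (nu * s)).
  { unfold cosh. assert (exp (- (nu * s)) <= exp (nu * s)) by (apply exp_le; nra). lra. }
  assert (H3 : exp s ^ k <= (2 * INR k / z) ^ k * exp w).
  { replace (exp w) with (exp (w / INR k) ^ k).
    - rewrite <- Rpow_mult_distr. apply pow_incr. split; [lra|].
      assert (w / INR k <= exp (w / INR k)) by (generalize (exp_ineq1_le (w / INR k)); lra).
      apply Rle_trans with (2 * INR k / z * (w / INR k)).
      + right. unfold w. field. lra.
      + apply Rmult_le_compat_l; lra.
    - rewrite exp_pow. f_equal. field. lra. }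
  assert (H4 : exp (nu * s) * exp s <= exp s ^ k).
  { rewrite exp_pow, <- exp_plus. apply exp_le. nra. }
  assert (E1 : exp w * exp (- w) = 1) by (rewrite <- exp_plus, Rplus_opp_r; apply exp_0).
  assert (E2 : exp s * exp (- s) = 1) by (rewrite <- exp_plus, Rplus_opp_r; apply exp_0).
  set (C := (2 * INR k / z) ^ k) in *.
  assert (Hw : 0 < exp (- w)) by apply exp_pos. assert (Hs' : 0 < exp (- s)) by apply exp_pos.
  apply Rle_trans with (exp (- w) * exp (nu * s)).
  - apply Rmult_le_compat; [left; apply exp_pos|left; apply cosh_pos|easy|easy].
  - replace (exp (- w) * exp (nu * s)) with (exp (- w) * (exp (nu * s) * exp s) * exp (- s)).
    + apply Rmult_le_compat_r; [lra|].
      apply Rle_trans with (exp (- w) * (C * exp w)); [apply Rmult_le_compat_l; lra|].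
      right. rewrite (Rmult_comm C), <- Rmult_assoc, (Rmult_comm (exp (- w))), E1. ring.
    + rewrite !Rmult_assoc, E2. ring.
Qed.

(** The integrand is positive and its truncated integrals are bounded, so the improper integral is
    their supremum. Estimates of [MacK] thereby reduce to signs of derivatives of finite
    integrals. *)
Lemma MacK_lub nu z : 0 <= nu -> 0 < z ->
  (forall b, 0 <= b -> mac_F nu z b <= MacK nu z) /\
  (forall M, (forall b, 0 <= b -> mac_F nu z b <= M) -> MacK nu z <= M).
Proof.
  intros Hnu Hz. destruct (mac_f_decay nu z Hnu Hz) as (C & HC & Hdec).
  assert (Hmono : forall a b, a <= b -> mac_F nu z a <= mac_F nu z b).
  { intros a b Hab. apply (incr_of_derive_nonneg (mac_F nu z) (mac_f nu z)); [easy|apply mac_F_derive|].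
    intros; left; apply mac_f_pos. }
  assert (Hbd : forall b, 0 <= b -> mac_F nu z b <= C).
  { intros b Hb.
    assert (H : - (mac_F nu z 0 + C * exp (- 0)) <= - (mac_F nu z b + C * exp (- b))).
    { apply (incr_of_derive_nonneg (fun t => - (mac_F nu z t + C * exp (- t)))
              (fun t => - (mac_f nu z t + C * (- exp (- t))))); [easy| |].
      - intros t. assert (E := mac_F_derive nu z t).
        apply (is_derive_opp (fun t => mac_F nu z t + C * exp (- t))).
        apply (is_derive_plus (mac_F nu z)); [easy|]. apply is_derive_scal.
        auto_derive; [easy|]. ring.
      - intros t Ht. specialize (Hdec t ltac:(lra)). lra. }
    rewrite mac_F_0, Ropp_0, exp_0 in H. generalize (exp_pos (- b)). nra. }
  destruct (completeness (fun y => exists b, 0 <= b /\ y = mac_F nu z b)) as [l [Hl1 Hl2]].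
  { exists C. intros y (b & Hb & ->). auto. }
  { exists (mac_F nu z 0), 0. split; [lra|easy]. }
  assert (El : MacK nu z = l).
  { apply (is_RInt_gen_unique (mac_f nu z)). intros P [eps HP].
    assert (Hb : exists b, 0 <= b /\ l - eps < mac_F nu z b).
    { destruct (classic (exists b, 0 <= b /\ l - eps < mac_F nu z b)) as [|Hn]; [easy|].
      exfalso. assert (l <= l - eps); [|generalize (cond_pos eps); lra].
      apply Hl2. intros y (b & Hb & ->). apply Rnot_lt_le. intros Hlt. apply Hn. now exists b. }
    destruct Hb as (b0 & Hb0 & Hlt).
    apply (Filter_prod _ _ _ (fun a => a = 0) (fun b => b0 < b)).
    - reflexivity.
    - now exists b0.
    - intros a b -> Hb. exists (mac_F nu z b). split.
      + apply (RInt_correct (mac_f nu z)). apply ex_RInt_continuous.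
        intros; apply mac_f_continuous.
      + apply HP. change (Rabs (mac_F nu z b - l) < eps).
        assert (mac_F nu z b0 <= mac_F nu z b) by (apply Hmono; lra).
        assert (mac_F nu z b <= l) by (apply Hl1; exists b; split; [lra|easy]).
        rewrite Rabs_left1; lra. }
  rewrite El. split.
  - intros b Hb. apply Hl1. now exists b.
  - intros M HM. apply Hl2. intros y (b & Hb & ->). auto.
Qed.

Lemma MacK_even nu z : MacK (- nu) z = MacK nu z.
Proof.
  unfold MacK. f_equal. apply functional_extensionality. intros s. f_equal.
  unfold cosh. rewrite !Ropp_mult_distr_l, Ropp_involutive. f_equal. ring.
Qed.

Lemma MacK_le nu nu' z : 0 <= nu <= nu' -> 0 < z -> MacK nu z <= MacK nu' z.
Proof.
  intros Hnu Hz. apply MacK_lub; [lra|easy|]. intros b Hb.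
  apply Rle_trans with (mac_F nu' z b); [|apply MacK_lub; lra].
  assert (H : mac_F nu' z 0 - mac_F nu z 0 <= mac_F nu' z b - mac_F nu z b).
  { apply (incr_of_derive_nonneg (fun t => mac_F nu' z t - mac_F nu z t)
       (fun t => mac_f nu' z t - mac_f nu z t)); [easy| |].
    - intros t. apply (is_derive_minus (mac_F nu' z)); apply mac_F_derive.
    - intros t Ht. assert (mac_f nu z t <= mac_f nu' z t); [|lra].
      apply Rmult_le_compat_l; [left; apply exp_pos|]. apply cosh_le.
      rewrite !Rabs_pos_eq; nra. }
  rewrite !mac_F_0 in H. lra.
Qed.

Lemma MacK_0_pos z : 0 < z -> 0 < MacK 0 z.
Proof.
  intros Hz. apply Rlt_le_trans with (mac_F 0 z 1); [|apply MacK_lub; lra].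
  set (c := exp (- z * cosh 1)). assert (Hc : 0 < c) by apply exp_pos.
  assert (H : mac_F 0 z 0 - c * 0 <= mac_F 0 z 1 - c * 1).
  { apply (incr_of_derive_nonneg (fun t => mac_F 0 z t - c * t) (fun t => mac_f 0 z t - c * 1)); [lra| |].
    - intros t. apply (is_derive_minus (mac_F 0 z)); [apply mac_F_derive|].
      apply is_derive_scal, (is_derive_id t).
    - intros t Ht. unfold mac_f. rewrite Rmult_0_l, cosh_0, Rmult_1_r.
      assert (c <= exp (- z * cosh t)); [|lra]. apply exp_le.
      assert (cosh t <= cosh 1) by (apply cosh_le; rewrite !Rabs_pos_eq; lra). nra. }
  rewrite mac_F_0 in H. lra.
Qed.

(* [exp (- z cosh s) * cosh ((nu - 1) s)] is the derivative of the difference of the two sides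
   truncated at [s], up to the boundary term [2/z * exp (- z cosh s) * sinh (nu s)]. *)
Lemma MacK_recurrence nu z : 0 <= nu -> 0 < z -> 2 * nu / z * MacK nu z <= MacK (nu + 1) z.
Proof.
  intros Hnu Hz.
  assert (Hzi : 0 < / z) by now apply Rinv_0_lt_compat.
  assert (Hmain : forall b, 0 <= b -> 2 * nu / z * mac_F nu z b
            <= MacK (nu + 1) z + 2 / z * mac_f nu z b).
  { intros b Hb.
    apply Rle_trans with (mac_F (nu + 1) z b + 2 / z * (exp (- z * cosh b) * sinh (nu * b))).
    2:{ apply Rplus_le_compat; [apply MacK_lub; lra|].
        apply Rmult_le_compat_l; [unfold Rdiv; lra|]. apply Rmult_le_compat_l; [left; apply exp_pos|].
        unfold sinh, cosh. generalize (exp_pos (- (nu * b))). lra. }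
    set (G := fun t => mac_F (nu + 1) z t - 2 * nu / z * mac_F nu z t
                 + 2 / z * (exp (- z * cosh t) * sinh (nu * t))).
    assert (H : G 0 <= G b).
    { apply (incr_of_derive_nonneg G (fun t => exp (- z * cosh t) * cosh ((nu - 1) * t))); [easy| |].
      - intros t. evar_last.
        + apply (is_derive_plus (fun t => mac_F (nu + 1) z t - 2 * nu / z * mac_F nu z t)).
          * apply (is_derive_minus (mac_F (nu + 1) z)); [apply mac_F_derive|].
            apply is_derive_scal, mac_F_derive.
          * apply (is_derive_scal (fun t => exp (- z * cosh t) * sinh (nu * t))).
            apply (is_derive_mult (fun t => exp (- z * cosh t)) (fun t => sinh (nu * t))).
            -- apply (is_derive_comp exp (fun t => - z * cosh t)); [apply is_derive_exp|].
               apply is_derive_scal, cosh_derive.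
            -- apply (is_derive_comp sinh (fun t => nu * t)); [apply sinh_derive|].
               apply is_derive_scal, (is_derive_id t).
            -- intros; apply Rmult_comm.
        + unfold plus, minus, opp, scal, mult, one; simpl. unfold mult, one; simpl.
          unfold mac_f. set (E := exp (- z * cosh t)).
          transitivity (E * (cosh ((nu + 1) * t) - 2 * sinh t * sinh (nu * t))).
          * unfold plus; simpl. field. lra.
          * f_equal. replace ((nu + 1) * t) with (nu * t + t) by ring.
            replace ((nu - 1) * t) with (nu * t - t) by ring. apply cosh_sub.
      - intros t _. left. apply Rmult_lt_0_compat; [apply exp_pos|apply cosh_pos]. }
    unfold G in H. rewrite !mac_F_0, !Rmult_0_r, sinh_0, !Rmult_0_r in H. lra. }
  destruct (mac_f_decay nu z Hnu Hz) as (C & HC & Hdec).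
  destruct (Req_dec nu 0) as [->|Hnu0].
  { unfold Rdiv. rewrite Rmult_0_r, !Rmult_0_l, Rplus_0_l.
    left. apply Rlt_le_trans with (MacK 0 z); [now apply MacK_0_pos|]. apply MacK_le; lra. }
  assert (Hc : 0 < 2 * nu / z) by (unfold Rdiv; apply Rmult_lt_0_compat; lra).
  apply Rle_trans with (2 * nu / z * (MacK (nu + 1) z / (2 * nu / z))); [|right; field; lra].
  apply Rmult_le_compat_l; [lra|]. apply MacK_lub; [easy|easy|]. intros b0 Hb0.
  apply Rmult_le_reg_l with (2 * nu / z); [easy|].
  replace (2 * nu / z * (MacK (nu + 1) z / (2 * nu / z))) with (MacK (nu + 1) z) by (field; lra).
  apply le_epsilon. intros eps Heps.
  (* At this [b] the boundary term is at most [eps], because [b * exp (- b) <= 1]. *)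
  set (b := Rmax b0 (2 / z * C / eps)).
  assert (Hb : b0 <= b) by apply Rmax_l.
  assert (Hb' : 2 / z * C / eps <= b) by apply Rmax_r.
  apply Rle_trans with (2 * nu / z * mac_F nu z b).
  - apply Rmult_le_compat_l; [lra|].
    apply (incr_of_derive_nonneg (mac_F nu z) (mac_f nu z)); [easy|apply mac_F_derive|].
    intros; left; apply mac_f_pos.
  - eapply Rle_trans; [apply Hmain; lra|]. apply Rplus_le_compat_l.
    specialize (Hdec b ltac:(lra)).
    assert (Hexp : b * exp (- b) <= 1).
    { assert (E2 : exp b * exp (- b) = 1) by (rewrite <- exp_plus, Rplus_opp_r; apply exp_0).
      rewrite <- E2. apply Rmult_le_compat_r; [left; apply exp_pos|].
      generalize (exp_ineq1_le b). lra. }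
    assert (Hzc : 0 < 2 / z * C) by (unfold Rdiv; repeat apply Rmult_lt_0_compat; lra).
    apply Rle_trans with (2 / z * (C * exp (- b))); [apply Rmult_le_compat_l; [unfold Rdiv; lra|easy]|].
    assert (2 / z * C <= eps * b).
    { apply Rmult_le_compat_r with (r := eps) in Hb'; [|lra].
      replace (2 / z * C / eps * eps) with (2 / z * C) in Hb' by (field; lra). lra. }
    generalize (exp_pos (- b)). nra.
Qed.

(** The recurrence iterated [k] times, starting from [K_1 >= K_0]. *)
Lemma MacK_ratio k z : 0 < z ->
  INR (fact k) * (2 / z) ^ k <= MacK (INR (S k)) z / MacK 0 z.
Proof.
  intros Hz. assert (H0 := MacK_0_pos z Hz).
  assert (Hzi : 0 < 2 / z) by (apply Rmult_lt_0_compat; [lra|now apply Rinv_0_lt_compat]).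
  apply Rmult_le_reg_r with (MacK 0 z); [easy|].
  replace (MacK (INR (S k)) z / MacK 0 z * MacK 0 z) with (MacK (INR (S k)) z) by (field; lra).
  induction k as [|k IH].
  - simpl. rewrite !Rmult_1_l. apply MacK_le; lra.
  - rewrite (S_INR (S k)).
    eapply Rle_trans; [|apply MacK_recurrence; [apply pos_INR|easy]].
    apply Rmult_le_compat_l with (r := 2 * INR (S k) / z) in IH.
    2:{ apply Rmult_le_pos; [generalize (pos_INR (S k)); lra|left; now apply Rinv_0_lt_compat]. }
    eapply Rle_trans; [|exact IH]. right.
    change (fact (S k)) with (S k * fact k)%nat. rewrite mult_INR. simpl pow. field. lra.
Qed.

(** * From the solution to the real lattice equation *)

Lemma box_sum_le_of_lat_sum d (F : list Z -> R) (c a : R) :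
  0 < c -> Rbar_le (Rbar_mult (Finite c) (lat_sum d F)) (Finite a) ->
  forall n, c * finsum F (box d n) <= a.
Proof.
  intros Hc H n. unfold lat_sum in H. rewrite <- Sup_seq_scal_l in H by lra.
  change (Rbar_le (c * finsum F (box d n)) a). eapply Rbar_le_trans; [|exact H].
  apply (Sup_seq_minor_le _ _ n). simpl. lra.
Qed.

Lemma box_sum_bounded_of_lat_sum d (F : list Z -> R) (c : R) :
  0 < c -> Rbar_lt (Rbar_mult (Finite c) (lat_sum d F)) p_infty ->
  exists a, forall n, c * finsum F (box d n) <= a.
Proof.
  intros Hc H. destruct (Rbar_mult (Finite c) (lat_sum d F)) as [a| |] eqn:E.
  - exists a. apply box_sum_le_of_lat_sum; [easy|]. rewrite E. apply Rle_refl.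
  - easy.
  - exists 0. apply box_sum_le_of_lat_sum; [easy|]. now rewrite E.
Qed.

(** Compactness of [[0, 1]], through the supremum of the times up to which a common bound exists;
    monotonicity in the bound merges two bounds into one. *)
Lemma locally_bounded_bounded (P : R -> R -> Prop) :
  (forall s b b', P s b -> b <= b' -> P s b') ->
  (forall t, 0 <= t <= 1 -> exists de b, 0 < de /\
     forall s, 0 <= s <= 1 -> Rabs (s - t) < de -> P s b) ->
  exists b, forall s, 0 <= s <= 1 -> P s b.
Proof.
  intros Hm Hl.
  set (E := fun x => 0 <= x <= 1 /\ exists b, forall s, 0 <= s <= x -> P s b).
  assert (HE0 : E 0).
  { split; [lra|]. destruct (Hl 0) as (de & b & Hde & Hb); [lra|]. exists b. intros s Hs.
    apply Hb; [lra|]. replace (s - 0) with 0 by lra. now rewrite Rabs_R0. }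
  destruct (completeness E) as [l [Hl1 Hl2]].
  { exists 1. intros x [Hx _]. lra. }
  { now exists 0. }
  assert (Hl01 : 0 <= l <= 1).
  { split; [now apply Hl1|]. apply Hl2. intros x [Hx _]. lra. }
  destruct (Hl l Hl01) as (de & b & Hde & Hb).
  assert (Hx : exists x, E x /\ l - de < x).
  { destruct (classic (exists x, E x /\ l - de < x)) as [|Hn]; [easy|]. exfalso.
    assert (l <= l - de); [|lra]. apply Hl2. intros x Hx. apply Rnot_lt_le. intros Hlt.
    apply Hn. now exists x. }
  destruct Hx as (x & [Hx [b' Hb']] & Hlt).
  assert (HE : E (Rmin 1 (l + de / 2))).
  { split; [split; [apply Rmin_glb; lra|apply Rmin_l]|]. exists (Rmax b b'). intros s Hs.
    destruct (Rle_lt_dec s x) as [Hsx|Hsx].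
    - apply Hm with b'; [apply Hb'; lra|apply Rmax_r].
    - apply Hm with b; [|apply Rmax_l].
      assert (s <= 1) by (eapply Rle_trans; [apply Hs|apply Rmin_l]).
      assert (s <= l + de / 2) by (eapply Rle_trans; [apply Hs|apply Rmin_r]).
      apply Hb; [lra|]. apply Rabs_def1; lra. }
  assert (H1 : Rmin 1 (l + de / 2) <= l) by now apply Hl1.
  assert (H2 : Rmin 1 (l + de / 2) = 1).
  { unfold Rmin in *. destruct Rle_dec; lra. }
  rewrite H2 in HE. destruct HE as [_ [b'' Hb'']]. exists b''. auto.
Qed.

(** Freezing time outside [[0, 1]] yields functions continuous on the whole line without touching
    the equation inside. *)
Definition clamp (t : R) : R := Rmax 0 (Rmin 1 t).

Lemma clamp_in t : 0 <= clamp t <= 1.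
Proof. unfold clamp. split; [apply Rmax_l|]. apply Rmax_lub; [lra|apply Rmin_l]. Qed.

Lemma clamp_id t : 0 <= t <= 1 -> clamp t = t.
Proof. intros. unfold clamp. rewrite Rmin_right, Rmax_right; lra. Qed.

Lemma clamp_lipschitz s t : Rabs (clamp s - clamp t) <= Rabs (s - t).
Proof.
  unfold clamp, Rmax, Rmin, Rabs.
  repeat (destruct Rle_dec || destruct Rcase_abs); lra.
Qed.

(** The potential is real, so real and imaginary part solve the same real equation; [pr] stands for
    either. *)
Record coordinate (pr : C -> R) : Prop := {
  co_plus : forall z w, pr (Cplus z w) = pr z + pr w;
  co_minus : forall z w, pr (Cminus z w) = pr z - pr w;
  co_scal : forall a z, pr (Cmult (RtoC a) z) = a * pr z;
  co_zero : pr (RtoC 0) = 0;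
  co_le : forall z, Rabs (pr z) <= Cmod z }.

Lemma coordinate_fst : coordinate fst.
Proof.
  constructor; intros; simpl; try ring.
  apply Rle_trans with (2 := Rmax_Cmod z). apply Rmax_l.
Qed.

Lemma coordinate_snd : coordinate snd.
Proof.
  constructor; intros; simpl; try ring.
  apply Rle_trans with (2 := Rmax_Cmod z). apply Rmax_r.
Qed.

Lemma coordinate_sq_le pr z : coordinate pr -> pr z ^ 2 <= Cmod z ^ 2.
Proof.
  intros H. rewrite <- (pow2_abs (pr z)). apply pow_incr. split; [apply Rabs_pos|].
  now apply co_le.
Qed.

Lemma Cmod_sq_sum3 x y z :
  Cmod (Cplus x (Cplus y z)) ^ 2 <= 3 * (Cmod x ^ 2 + Cmod y ^ 2 + Cmod z ^ 2).
Proof.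
  assert (H : Cmod (Cplus x (Cplus y z)) <= Cmod x + Cmod y + Cmod z).
  { eapply Rle_trans; [apply Cmod_triangle|]. generalize (Cmod_triangle y z). lra. }
  assert (H0 := Cmod_ge_0 (Cplus x (Cplus y z))).
  generalize (Cmod_ge_0 x) (Cmod_ge_0 y) (Cmod_ge_0 z). intros.
  apply Rle_trans with ((Cmod x + Cmod y + Cmod z) ^ 2); [apply pow_incr; lra|].
  generalize (pow2_ge_0 (Cmod x - Cmod y)) (pow2_ge_0 (Cmod x - Cmod z))
    (pow2_ge_0 (Cmod y - Cmod z)). lra.
Qed.

Lemma C1_l2_quotient d h u u' t eps :
  0 < h -> is_C1_l2 d h u u' -> 0 <= t <= 1 -> 0 < eps ->
  exists de, 0 < de /\ forall s, 0 <= s <= 1 -> 0 < Rabs (s - t) < de ->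
    forall n, finsum (fun j => Cmod (Cminus (Cmult (RtoC (/ (s - t))) (Cminus (u s j) (u t j)))
                                            (u' t j)) ^ 2) (box d n) <= eps.
Proof.
  intros Hh (_ & H & _) Ht Heps. assert (Hhd : 0 < h ^ d) by now apply pow_lt.
  destruct (H t Ht (h ^ d * eps)) as (de & Hde & Hs); [now apply Rmult_lt_0_compat|].
  exists de. split; [easy|]. intros s H1 H2 n. specialize (Hs s H1 H2).
  apply Rbar_lt_le in Hs. apply Rmult_le_reg_l with (h ^ d); [easy|].
  exact (box_sum_le_of_lat_sum d _ (h ^ d) _ Hhd Hs n).
Qed.

(** Near [t], [u s = u t + (s - t) * (q + u' t)] with the quotient error [q] small in l2; local
    bounds extend by compactness. *)
Lemma C1_l2_bounded d h u u' :
  0 < h -> is_C1_l2 d h u u' ->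
  exists b, forall s, 0 <= s <= 1 -> forall n, finsum (fun j => Cmod (u s j) ^ 2) (box d n) <= b.
Proof.
  intros Hh HC. assert (Hhd : 0 < h ^ d) by now apply pow_lt.
  apply (locally_bounded_bounded (fun s b => forall n,
     finsum (fun j => Cmod (u s j) ^ 2) (box d n) <= b)).
  { intros s b b' H Hb n. specialize (H n). lra. }
  intros t Ht.
  destruct (C1_l2_quotient d h u u' t 1 Hh HC Ht Rlt_0_1) as (de & Hde & Hq).
  destruct HC as (Hf & _). destruct (Hf t Ht) as [Hf1 Hf2].
  apply (box_sum_bounded_of_lat_sum d _ _ Hhd) in Hf1 as [b1 Hb1].
  apply (box_sum_bounded_of_lat_sum d _ _ Hhd) in Hf2 as [b2 Hb2].
  assert (Hdiv : forall x b, h ^ d * x <= b -> x <= b / h ^ d).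
  { intros x b H. apply Rmult_le_reg_l with (h ^ d); [easy|].
    replace (h ^ d * (b / h ^ d)) with b by (field; lra). easy. }
  exists de, (3 * (b1 / h ^ d + 1 + b2 / h ^ d)). split; [easy|]. intros s Hs Hst n.
  specialize (Hb1 n). specialize (Hb2 n). apply Hdiv in Hb1, Hb2.
  assert (P1 : 0 <= finsum (fun j => Cmod (u t j) ^ 2) (box d n))
    by (apply finsum_nonneg; intros; apply pow2_ge_0).
  assert (P2 : 0 <= finsum (fun j => Cmod (u' t j) ^ 2) (box d n))
    by (apply finsum_nonneg; intros; apply pow2_ge_0).
  destruct (Req_dec s t) as [->|Hne]; [lra|].
  assert (Hst' : 0 < Rabs (s - t) < de) by (split; [apply Rabs_pos_lt; lra|easy]).
  specialize (Hq s Hs Hst' n).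
  apply Rle_trans with (finsum (fun j => 3 * (Cmod (u t j) ^ 2 + (Cmod (Cminus (Cmult (RtoC (/ (s - t)))
      (Cminus (u s j) (u t j))) (u' t j)) ^ 2 + Cmod (u' t j) ^ 2))) (box d n)).
  - apply finsum_le; intros j _.
    set (q := Cminus (Cmult (RtoC (/ (s - t))) (Cminus (u s j) (u t j))) (u' t j)).
    assert (E : u s j = Cplus (u t j) (Cplus (Cmult (RtoC (s - t)) q)
                                              (Cmult (RtoC (s - t)) (u' t j)))).
    { unfold q. destruct (u s j) as [a1 a2], (u t j) as [c1 c2], (u' t j) as [e1 e2].
      unfold Cplus, Cminus, Cmult, Copp, RtoC; simpl. f_equal; field; lra. }
    rewrite E. eapply Rle_trans; [apply Cmod_sq_sum3|].
    rewrite !Cmod_mult, !Cmod_R, !Rpow_mult_distr, !pow2_abs.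
    assert ((s - t) ^ 2 <= 1).
    { rewrite <- (pow1 2), <- (pow2_abs (s - t)). apply pow_incr. split; [apply Rabs_pos|].
      apply Rabs_le; lra. }
    generalize (pow2_ge_0 (Cmod q)) (pow2_ge_0 (Cmod (u' t j))) (pow2_ge_0 (s - t)). nra.
  - rewrite finsum_scal, !finsum_plus. lra.
Qed.

Lemma finsum_Cplus pr (F : nat -> C) l : coordinate pr ->
  pr (fold_right Cplus (RtoC 0) (map F l)) = finsum (fun k => pr (F k)) l.
Proof.
  intros Hp. induction l as [|a l IH]; simpl; [now apply co_zero|].
  rewrite co_plus by easy. now rewrite IH.
Qed.

(** The diagonal [- 2 d / h^2] of the Laplacian joins the potential in [c], whence the second
    constant. Differentiability in l2 gives it pointwise, one entry being bounded by a box sum. *)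
Lemma solution_lattice_sol d h V u M pr :
  0 < h -> coordinate pr -> is_solution d h V u ->
  (forall j t, lat_pt d j -> 0 <= t <= 1 -> Rabs (V j t) <= M) ->
  exists B, 0 <= B /\
    lattice_sol d (/ h ^ 2) (M + 2 * INR d * / h ^ 2) B (fun j t => pr (u (clamp t) j)).
Proof.
  intros Hh Hp (u' & HC & Heq) HV.
  destruct (C1_l2_bounded d h u u' Hh HC) as [b Hb].
  assert (Hpos : 0 <= b).
  { eapply Rle_trans; [|apply (Hb 0 ltac:(lra) 0%nat)].
    apply finsum_nonneg; intros; apply pow2_ge_0. }
  assert (HN : 0 < / h ^ 2) by (apply Rinv_0_lt_compat, pow_lt; lra).
  assert (Hquot : forall j t eps, length j = d -> 0 <= t <= 1 -> 0 < eps ->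
     exists de, 0 < de /\ forall s, 0 <= s <= 1 -> 0 < Rabs (s - t) < de ->
       Rabs ((pr (u s j) - pr (u t j)) / (s - t) - pr (u' t j)) <= eps).
  { intros j t eps Hj Ht Heps.
    destruct (C1_l2_quotient d h u u' t (eps ^ 2) Hh HC Ht) as (de & Hde & H);
      [now apply pow_lt|].
    exists de. split; [easy|]. intros s Hs Hst.
    destruct (box_exists j) as [n Hn]. rewrite Hj in Hn. specialize (H s Hs Hst n).
    set (F := fun j => Cmod (Cminus (Cmult (RtoC (/ (s - t))) (Cminus (u s j) (u t j)))
                                            (u' t j)) ^ 2) in H.
    assert (HF : F j <= eps ^ 2).
    { eapply Rle_trans; [apply (finsum_member F (box d n))|exact H]; [|easy].
      intros; apply pow2_ge_0. }
    unfold F in HF.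
    set (q := Cminus (Cmult (RtoC (/ (s - t))) (Cminus (u s j) (u t j))) (u' t j)) in HF.
    replace ((pr (u s j) - pr (u t j)) / (s - t) - pr (u' t j)) with (pr q).
    - eapply Rle_trans; [now apply co_le|].
      generalize (Cmod_ge_0 q). nra.
    - unfold q. rewrite co_minus, co_scal, co_minus by easy. unfold Rdiv. ring. }
  exists b. split; [easy|]. constructor.
  - intros j t Hj. apply continuity_pt_filterlim. intros eps Heps.
    destruct (Hquot j (clamp t) 1 Hj (clamp_in t) Rlt_0_1) as (de & Hde & H).
    set (L := Rabs (pr (u' (clamp t) j)) + 1).
    assert (HL : 0 < L) by (unfold L; generalize (Rabs_pos (pr (u' (clamp t) j))); lra).
    exists (Rmin de (eps / L)). split.
    + apply Rmin_glb_lt; [easy|]. apply Rmult_lt_0_compat; [easy|now apply Rinv_0_lt_compat].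
    + intros s [_ Hs]. change (Rabs (s - t) < Rmin de (eps / L)) in Hs.
      change (Rabs (pr (u (clamp s) j) - pr (u (clamp t) j)) < eps).
      assert (H1 := clamp_lipschitz s t).
      assert (H2 : Rabs (s - t) < de) by (eapply Rlt_le_trans; [exact Hs|apply Rmin_l]).
      assert (H3 : Rabs (s - t) < eps / L) by (eapply Rlt_le_trans; [exact Hs|apply Rmin_r]).
      destruct (Req_dec (clamp s) (clamp t)) as [E|E].
      { rewrite E, Rminus_diag, Rabs_R0. easy. }
      specialize (H (clamp s) (clamp_in s)).
      assert (H4 : 0 < Rabs (clamp s - clamp t) < de) by (split; [apply Rabs_pos_lt; lra|lra]).
      specialize (H H4).
      set (x := pr (u (clamp s) j) - pr (u (clamp t) j)) in *.
      set (y := clamp s - clamp t) in *.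
      assert (Hxy : Rabs (x / y) <= L).
      { replace (x / y) with ((x / y - pr (u' (clamp t) j)) + pr (u' (clamp t) j)) by ring.
        eapply Rle_trans; [apply Rabs_triang|]. unfold L. lra. }
      replace x with (x / y * y) by (field; unfold y; lra). rewrite Rabs_mult.
      apply Rle_lt_trans with (L * Rabs (s - t)).
      * apply Rmult_le_compat; [apply Rabs_pos|apply Rabs_pos|easy|easy].
      * apply Rmult_lt_compat_l with (r := L) in H3; [|easy].
        replace (L * (eps / L)) with eps in H3 by (field; lra). easy.
  - intros j t Hj Ht. exists (V j t - 2 * INR d * / h ^ 2). split.
    + unfold Rminus. eapply Rle_trans; [apply Rabs_triang|]. apply Rplus_le_compat.
      * apply HV; [easy|lra].
      * rewrite Rabs_Ropp, Rabs_pos_eq; [lra|].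
        apply Rmult_le_pos; [generalize (pos_INR d); lra|lra].
    + replace (_ + _) with (pr (u' t j)).
      * apply is_derive_Reals. intros eps Heps.
        destruct (Hquot j t (eps / 2) Hj ltac:(lra) ltac:(lra)) as (de & Hde & H).
        (* This keeps [t + k] inside [[0, 1]], where [clamp] is the identity. *)
        assert (Hm : 0 < Rmin de (Rmin t (1 - t))) by (repeat apply Rmin_glb_lt; lra).
        exists (mkposreal _ Hm). intros k Hk Hkd. simpl in Hkd.
        assert (A1 := Rmin_l de (Rmin t (1 - t))). assert (A2 := Rmin_r de (Rmin t (1 - t))).
        assert (A3 := Rmin_l t (1 - t)). assert (A4 := Rmin_r t (1 - t)).
        assert (A5 : - Rabs k <= k <= Rabs k).
        { split; [generalize (Rle_abs (- k)); rewrite Rabs_Ropp; lra|apply Rle_abs]. }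
        rewrite !clamp_id by lra.
        specialize (H (t + k) ltac:(lra)). replace (t + k - t) with k in H by ring.
        assert (Hk' : 0 < Rabs k) by now apply Rabs_pos_lt.
        specialize (H ltac:(lra)). lra.
      * rewrite (Heq t ltac:(lra) j Hj), clamp_id by lra. unfold disc_lap.
        rewrite co_plus, !co_scal, finsum_Cplus by easy.
        rewrite (finsum_ext _ (fun k => (pr (u t (lat_add j k 1)) + pr (u t (lat_add j k (-1))))
                     + - 2 * pr (u t j))).
        2:{ intros k _. rewrite co_plus, co_minus, co_scal by easy. ring. }
        rewrite finsum_plus.
        assert (Hc : forall l : list nat, finsum (fun _ => - 2 * pr (u t j)) l
                     = INR (length l) * (- 2 * pr (u t j))).
        { induction l as [|a l IH]; [simpl; ring|]. rewrite finsum_cons, IH.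
          change (length (a :: l)) with (S (length l)). rewrite S_INR. ring. }
        rewrite Hc, length_seq. ring.
  - intros t n. eapply Rle_trans; [|apply (Hb (clamp t) (clamp_in t) n)].
    apply finsum_le; intros j _. now apply coordinate_sq_le.
Qed.

(** * Translation along the first axis and growth of the data weights *)

Fixpoint shift_dir (m : nat) (v : list Z -> R -> R) : list Z -> R -> R :=
  match m with
  | O => v
  | S m => shift_dir m (fun j => v (lat_add j 0 (-1)))
  end.

Lemma shift_dir_cons m v z y t : shift_dir m v (z :: y) t = v ((z - Z.of_nat m)%Z :: y) t.
Proof.
  revert v. induction m as [|m IH]; intros v; simpl shift_dir.
  - now rewrite Z.sub_0_r.
  - rewrite IH. simpl lat_add. f_equal. f_equal. lia.
Qed.

Lemma lat_add_comm j k l s s' : lat_add (lat_add j k s) l s' = lat_add (lat_add j l s') k s.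
Proof.
  revert k l. induction j as [|z y IH]; intros [|k] [|l]; simpl; try reflexivity.
  - f_equal. lia.
  - now rewrite IH.
Qed.

Lemma shift_dir_sol e N M B m v :
  lattice_sol (S e) N M B v -> lattice_sol (S e) N M B (shift_dir m v).
Proof.
  revert v; induction m as [|m IH]; intros v Hv; [easy|]. simpl. apply IH. constructor.
  - intros j t Hj. apply (ls_cont _ _ _ _ _ Hv). now rewrite length_lat_add.
  - intros j t Hj Ht.
    destruct (ls_eq _ _ _ _ _ Hv (lat_add j 0 (-1)) t) as (c & Hc & H);
      [now rewrite length_lat_add|easy|].
    exists c. split; [easy|].
    rewrite (finsum_ext (fun k => v (lat_add (lat_add j k 1) 0 (-1)) t + _)
       (fun k => v (lat_add (lat_add j 0 (-1)) k 1) t + v (lat_add (lat_add j 0 (-1)) k (-1)) t)).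
    + exact H.
    + intros k _. now rewrite !(lat_add_comm j k 0).
  - intros t n. eapply Rle_trans; [|apply (ls_bound _ _ _ _ _ Hv t (S n))].
    apply (box_shift (fun j => v j t ^ 2)); [intros; apply pow2_ge_0|lia|now right].
Qed.

Definition head_coord (j : list Z) : Z := hd 0%Z j.

Lemma half_sum_shift e n m (G : Z -> list Z -> R) :
  (forall z y, 0 <= G z y) ->
  half_sum e n (fun x y => G (Z.of_nat x - Z.of_nat m)%Z y)
  <= finsum (fun j => G (head_coord j) (tl j)) (box (S e) (n + m)).
Proof.
  revert G. induction m as [|m IH]; intros G HG.
  - rewrite Nat.add_0_r.
    eapply Rle_trans; [|apply (half_sum_box e n (fun j => G (head_coord j) (tl j))); auto].
    apply half_sum_le; intros x y _ _. simpl. rewrite Z.sub_0_r. apply Rle_refl.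
  - specialize (IH (fun z y => G (z - 1)%Z y) ltac:(intros; apply HG)).
    eapply Rle_trans; [|eapply Rle_trans; [exact IH|]].
    + apply half_sum_le; intros x y _ _.
      replace (Z.of_nat x - Z.of_nat (S m))%Z with (Z.of_nat x - Z.of_nat m - 1)%Z by lia.
      apply Rle_refl.
    + replace (n + S m)%nat with (S (n + m)) by lia.
      eapply Rle_trans; [|apply (box_shift (fun j => G (head_coord j) (tl j)) (S e) (n + m) 0 (-1));
        [auto|lia|now right]].
      apply finsum_le; intros j Hj. apply box_length in Hj.
      destruct j as [|z y]; [discriminate|]. simpl. apply Rle_refl.
Qed.

(** Concentration reaches positive first coordinates only, so it is applied to translates; hence
    [om] must dominate the factorial weight shifted by every [m]. Vanishing at time 1/2 then spreads
    to all times by uniqueness. *)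
Lemma lattice_vanish e N M B v (om : Z -> R) A :
  0 < N -> 0 <= M -> 0 <= B -> lattice_sol (S e) N M B v ->
  (forall z, 0 <= om z) ->
  (forall m, exists C, 0 <= C /\ forall x,
     rprod sqS x * (4 / (N / 10) ^ 2) ^ x <= C * om (Z.of_nat x - Z.of_nat m)%Z) ->
  (forall t n, t = 0 \/ t = 1 ->
     finsum (fun j => om (head_coord j) * v j t ^ 2) (box (S e) n) <= A) ->
  forall j t, length j = S e -> 0 <= t <= 1 -> v j t = 0.
Proof.
  intros HN HM HB Hsol Hom HC HA.
  apply (lattice_unique (S e) N M B v (/ 2)); auto; try lra.
  intros j Hj. destruct j as [|z y]; [discriminate|]. simpl in Hj.
  (* Just large enough for the translated first coordinate to be at least 1. *)
  set (m := (S (Z.to_nat (- z)))).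
  set (x := Z.to_nat (z + Z.of_nat m)).
  destruct (HC m) as (C & HC0 & HCx).
  assert (Hdat : forall t, t = 0 \/ t = 1 -> half_bounded e (shift_dir m v) t
     (fun x => rprod sqS x * (4 / (N / 10) ^ 2) ^ x) (C * A)).
  { intros t Ht n.
    apply Rle_trans with (C * half_sum e n (fun x y =>
        om (Z.of_nat x - Z.of_nat m)%Z * v ((Z.of_nat x - Z.of_nat m)%Z :: y) t ^ 2)).
    - rewrite <- half_sum_scal. apply half_sum_le; intros x' y' _ _. unfold row.
      rewrite shift_dir_cons, <- Rmult_assoc. apply Rmult_le_compat_r; [apply pow2_ge_0|auto].
    - apply Rmult_le_compat_l; [easy|].
      eapply Rle_trans; [apply (half_sum_shift e n m (fun z y => om z * v (z :: y) t ^ 2))|].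
      + intros. apply Rmult_le_pos; [auto|apply pow2_ge_0].
      + eapply Rle_trans; [|apply (HA t (n + m)%nat Ht)]. apply finsum_le; intros j' Hj'.
        apply box_length in Hj'. destruct j'; [discriminate|]. apply Rle_refl. }
  assert (H : row (shift_dir m v) (/ 2) y x = 0).
  { apply (concentration e N M B (C * A)); auto; try lia.
    now apply shift_dir_sol. }
  unfold row in H. rewrite shift_dir_cons in H.
  replace (Z.of_nat x - Z.of_nat m)%Z with z in H by lia. exact H.
Qed.

(** The ratios of the lower bound [c] eventually exceed those of the shifted factorial weight; the
    finitely many sites [x <= m] are paid with [om >= 1]. The index of [c] lags by one, as in
    [MacK_ratio]. *)
Lemma weight_growth (om : Z -> R) (c : nat -> R) (th : R) :
  0 <= th -> (forall z, 1 <= om z) -> (forall k, 0 < c k) ->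
  (forall k, c k <= om (Z.of_nat (S k))) ->
  (forall m, exists k0, forall k, (k0 <= k)%nat -> sqS (k + m) * th * c k <= c (S k)) ->
  forall m, exists C, 0 <= C /\ forall x,
    rprod sqS x * th ^ x <= C * om (Z.of_nat x - Z.of_nat m)%Z.
Proof.
  intros Hth Hom Hc Hcom Hr m.
  assert (Hb : forall x, 0 <= rprod sqS x * th ^ x).
  { intros x. apply Rmult_le_pos; [left; apply rprod_sqS_pos|now apply pow_le]. }
  destruct (Hr (S m)) as [k0 Hk0].
  destruct (eventually_ratio_bound (fun k => rprod sqS (k + S m) * th ^ (k + S m)) c k0)
    as (C1 & HC1 & H1); auto.
  { intros k Hk. specialize (Hk0 k Hk). simpl plus. simpl rprod. simpl pow.
    specialize (Hb (k + S m)%nat).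
    replace (sqS (k + S m) * rprod sqS (k + S m) * (th * th ^ (k + S m)) * c k)
      with (rprod sqS (k + S m) * th ^ (k + S m) * (sqS (k + S m) * th * c k)) by ring.
    now apply Rmult_le_compat_l. }
  set (C2 := finsum (fun x => rprod sqS x * th ^ x) (seq 0 (S m))).
  assert (HC2 : 0 <= C2) by (apply finsum_nonneg; auto).
  exists (C1 + C2). split; [lra|]. intros x.
  destruct (Nat.le_gt_cases x m) as [Hx|Hx].
  - specialize (Hom (Z.of_nat x - Z.of_nat m)%Z).
    assert (rprod sqS x * th ^ x <= C2).
    { apply (finsum_member (fun x => rprod sqS x * th ^ x)); [auto|]. apply in_seq; lia. }
    nra.
  - specialize (H1 (x - S m)%nat). cbv beta in H1. specialize (Hcom (x - S m)%nat).
    replace (x - S m + S m)%nat with x in H1 by lia.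
    replace (Z.of_nat (S (x - S m))) with (Z.of_nat x - Z.of_nat m)%Z in Hcom by lia.
    specialize (Hc (x - S m)%nat). nra.
Qed.

(** All factors are at least 1, so keeping only the first lowers the weight; hence one weighted
    direction is enough. *)
Lemma prod_ge_head (f : Z -> R) z y :
  (forall z, 1 <= f z) -> f z <= fold_right Rmult 1 (map f (z :: y)).
Proof.
  intros Hf. assert (H : forall l, 1 <= fold_right Rmult 1 (map f l)).
  { induction l as [|a l IH]; simpl; [lra|]. specialize (Hf a). nra. }
  simpl. specialize (H y). specialize (Hf z). nra.
Qed.

Lemma vanishes_of_weight d h V u M (om : Z -> R) A :
  (1 <= d)%nat -> 0 < h -> is_solution d h V u ->
  (forall j t, lat_pt d j -> 0 <= t <= 1 -> Rabs (V j t) <= M) ->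
  (forall z, 1 <= om z) ->
  (forall m, exists C, 0 <= C /\ forall x,
     rprod sqS x * (4 / (/ h ^ 2 / 10) ^ 2) ^ x <= C * om (Z.of_nat x - Z.of_nat m)%Z) ->
  (forall n, h ^ d * finsum (fun j => fold_right Rmult 1 (map om j)
       * (Cmod (u 0 j) ^ 2 + Cmod (u 1 j) ^ 2)) (box d n) <= A) ->
  vanishes d u.
Proof.
  intros Hd Hh Hsol HV Hom Hgr HA.
  destruct d as [|e]; [lia|]. assert (HN : 0 < / h ^ 2) by (apply Rinv_0_lt_compat, pow_lt; lra).
  assert (HM : 0 <= M).
  { eapply Rle_trans; [apply Rabs_pos|apply (HV (repeat 0%Z (S e)) 0)]; [|lra].
    apply repeat_length. }
  assert (Hhd : 0 < h ^ S e) by now apply pow_lt.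
  assert (Hom0 : forall z, 0 <= om z) by (intros z; specialize (Hom z); lra).
  assert (Hz : forall pr, coordinate pr -> forall t j, 0 <= t <= 1 -> length j = S e ->
                pr (u t j) = 0).
  { intros pr Hp t j Ht Hj.
    destruct (solution_lattice_sol (S e) h V u M pr Hh Hp Hsol HV) as (B & HB & Hl).
    rewrite <- (clamp_id t Ht).
    apply (lattice_vanish e (/ h ^ 2) (M + 2 * INR (S e) * / h ^ 2) B
      (fun j t => pr (u (clamp t) j)) om (A / h ^ S e)); auto.
    - generalize (pos_INR (S e)). intros.
      assert (0 <= INR (S e) * / h ^ 2) by (apply Rmult_le_pos; lra). lra.
    - intros t' n Ht'. specialize (HA n).
      apply Rmult_le_reg_l with (h ^ S e); [easy|].
      replace (h ^ S e * (A / h ^ S e)) with A by (field; lra).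
      eapply Rle_trans; [|exact HA]. apply Rmult_le_compat_l; [lra|].
      apply finsum_le; intros j' Hj'. apply box_length in Hj'.
      destruct j' as [|z y]; [discriminate|]. unfold head_coord. simpl hd.
      apply Rmult_le_compat; [auto|apply pow2_ge_0|now apply prod_ge_head|].
      assert (C0 : pr (u 0 (z :: y)) ^ 2 <= Cmod (u 0 (z :: y)) ^ 2) by now apply coordinate_sq_le.
      assert (C1 : pr (u 1 (z :: y)) ^ 2 <= Cmod (u 1 (z :: y)) ^ 2) by now apply coordinate_sq_le.
      generalize (pow2_ge_0 (Cmod (u 0 (z :: y)))) (pow2_ge_0 (Cmod (u 1 (z :: y)))).
      destruct Ht' as [->| ->]; rewrite clamp_id by lra; lra. }
  intros t Ht j Hj.
  assert (H1 := Hz fst coordinate_fst t j Ht Hj). assert (H2 := Hz snd coordinate_snd t j Ht Hj).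
  destruct (u t j) as [a b]. simpl in H1, H2. now subst.
Qed.

Lemma MacK_abs nu z : MacK nu z = MacK (Rabs nu) z.
Proof. unfold Rabs. destruct Rcase_abs; [now rewrite MacK_even|easy]. Qed.

Lemma MacK_quot_ge1 nu z : 0 < z -> 1 <= MacK nu z / MacK 0 z.
Proof.
  intros Hz. assert (H0 := MacK_0_pos z Hz). rewrite MacK_abs.
  apply Rmult_le_reg_r with (MacK 0 z); [easy|].
  replace (MacK (Rabs nu) z / MacK 0 z * MacK 0 z) with (MacK (Rabs nu) z) by (field; lra).
  rewrite Rmult_1_l. apply MacK_le; [|easy]. split; [lra|apply Rabs_pos].
Qed.

Lemma fact_pow_pos k b : 0 < b -> 0 < INR (fact k) * b ^ k.
Proof. intros. apply Rmult_lt_0_compat; [apply INR_fact_lt_0|now apply pow_lt]. Qed.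

(** The square of [k! (2/z)^k] has ratio [(k+1)^2 (2/z)^2]. The 4 pays for the translation:
    [k + m + 1 <= 2 (k + 1)] once [k >= m]. *)
Lemma squared_weight_growth z th :
  0 < z -> 0 <= th -> 4 * th <= (2 / z) ^ 2 ->
  forall m, exists C, 0 <= C /\ forall x,
    rprod sqS x * th ^ x
    <= C * (MacK (IZR (Z.of_nat x - Z.of_nat m)) z ^ 2 / MacK 0 z ^ 2).
Proof.
  intros Hz Hth Hle.
  assert (Hb : 0 < 2 / z) by (apply Rmult_lt_0_compat; [lra|now apply Rinv_0_lt_compat]).
  assert (H0 := MacK_0_pos z Hz).
  assert (E : forall nu, MacK nu z ^ 2 / MacK 0 z ^ 2 = (MacK nu z / MacK 0 z) ^ 2)
    by (intros; field; lra).
  apply (weight_growth (fun k => MacK (IZR k) z ^ 2 / MacK 0 z ^ 2)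
           (fun k => (INR (fact k) * (2 / z) ^ k) ^ 2) th); auto.
  - intros k. rewrite E. generalize (MacK_quot_ge1 (IZR k) z Hz). nra.
  - intros k. apply pow_lt. now apply fact_pow_pos.
  - intros k. rewrite E, <- INR_IZR_INZ. apply pow_incr.
    split; [left; now apply fact_pow_pos|now apply MacK_ratio].
  - intros m. exists m. intros k Hk.
    change (fact (S k)) with (S k * fact k)%nat. rewrite mult_INR, S_INR. simpl ((2 / z) ^ S k).
    set (f := INR (fact k)). set (p := (2 / z) ^ k). set (b := 2 / z) in *.
    replace (((INR k + 1) * f * (b * p)) ^ 2) with ((INR k + 1) ^ 2 * b ^ 2 * (f * p) ^ 2) by ring.
    apply Rmult_le_compat_r; [apply pow2_ge_0|].
    apply Rle_trans with (4 * (INR k + 1) ^ 2 * th).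
    + apply Rmult_le_compat_r; [easy|]. unfold sqS. rewrite plus_INR.
      apply le_INR in Hk. generalize (pos_INR m) (pos_INR k). nra.
    + generalize (pow2_ge_0 (INR k + 1)). nra.
Qed.

(** [mu > 4] makes the order at least [4 (k + 1)], and [(4k+3)!] gains four factors per step against
    the two of the squared factorial; the surplus beats any constant, so [th] is arbitrary. *)
Lemma stretched_weight_growth mu z th :
  4 < mu -> 0 < z -> 0 <= th ->
  forall m, exists C, 0 <= C /\ forall x,
    rprod sqS x * th ^ x
    <= C * (MacK (IZR (Z.of_nat x - Z.of_nat m) * mu) z / MacK 0 z).
Proof.
  intros Hmu Hz Hth.
  assert (Hb : 0 < 2 / z) by (apply Rmult_lt_0_compat; [lra|now apply Rinv_0_lt_compat]).
  assert (H0 := MacK_0_pos z Hz).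
  apply (weight_growth (fun k => MacK (IZR k * mu) z / MacK 0 z)
           (fun k => INR (fact (4 * k + 3)) * (2 / z) ^ (4 * k + 3)) th); auto.
  - intros k. now apply MacK_quot_ge1.
  - intros k. now apply fact_pow_pos.
  - intros k. eapply Rle_trans; [now apply MacK_ratio|].
    apply Rmult_le_compat_r; [left; now apply Rinv_0_lt_compat|]. apply MacK_le; [|easy].
    split; [apply pos_INR|]. rewrite <- INR_IZR_INZ.
    replace (S (4 * k + 3)) with (4 * S k)%nat by lia. rewrite mult_INR. simpl (INR 4).
    assert (0 <= INR (S k)) by apply pos_INR. nra.
  - intros m. set (b := 2 / z) in *.
    destruct (INR_unbounded (4 * th / b ^ 4)) as [k1 Hk1].
    assert (Hb4 : 0 < b ^ 4) by now apply pow_lt.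
    exists (m + k1)%nat. intros k Hk.
    apply le_INR in Hk. rewrite plus_INR in Hk. generalize (pos_INR m) (pos_INR k1); intros.
    assert (Hthk : 4 * th <= INR k * b ^ 4).
    { apply Rmult_le_reg_r with (/ b ^ 4); [now apply Rinv_0_lt_compat|].
      replace (INR k * b ^ 4 * / b ^ 4) with (INR k) by (field; lra). unfold Rdiv in Hk1. lra. }
    replace (4 * S k + 3)%nat with (S (S (S (S (4 * k + 3))))) by lia.
    set (n := (4 * k + 3)%nat).
    assert (Hn : INR n = 4 * INR k + 3).
    { unfold n. rewrite plus_INR, mult_INR. simpl. ring. }
    rewrite !fact_simpl, !mult_INR, !S_INR, Hn.
    set (f := INR (fact n)).
    replace (b ^ S (S (S (S n)))) with (b ^ 4 * b ^ n) by (simpl; ring).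
    set (x := INR k) in *.
    replace ((4 * x + 3 + 1 + 1 + 1 + 1) * ((4 * x + 3 + 1 + 1 + 1) * ((4 * x + 3 + 1 + 1) *
       ((4 * x + 3 + 1) * f))) * (b ^ 4 * b ^ n)) with
      ((4 * x + 7) * (4 * x + 6) * (4 * x + 5) * (4 * x + 4) * b ^ 4 * (f * b ^ n)) by ring.
    apply Rmult_le_compat_r; [left; now apply fact_pow_pos|].
    assert (Hx : 0 <= x) by apply pos_INR.
    apply Rle_trans with ((x + 1) ^ 2 * (4 * th)).
    + unfold sqS. rewrite plus_INR. fold x.
      replace ((x + 1) ^ 2 * (4 * th)) with ((2 * (x + 1)) ^ 2 * th) by ring.
      apply Rmult_le_compat_r; [easy|]. apply pow_incr. lra.
    + apply Rle_trans with ((x + 1) ^ 2 * (x * b ^ 4)).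
      * apply Rmult_le_compat_l; [apply pow2_ge_0|easy].
      * rewrite <- Rmult_assoc. apply Rmult_le_compat_r; [lra|].
        assert (0 <= x ^ 2) by apply pow2_ge_0. assert (0 <= x * x ^ 2) by nra.
        assert (0 <= x ^ 2 * x ^ 2) by nra. nra.
Qed.

Theorem theorem1p1 :
  (* Part 1: bounds M on ||V||_inf, N on ||u||_2, A on the weighted data,
     all independent of h *)
  (forall (d : nat) (M N A : R), (1 <= d)%nat ->
     exists C0 h0 : R, 0 < C0 /\ 0 < h0 /\
       forall (gam h : R) (V : list Z -> R -> R) (u : R -> list Z -> C),
         0 < gam -> gam < C0 -> 0 < h -> h < h0 ->
         (forall j t, lat_pt d j -> 0 <= t <= 1 -> Rabs (V j t) <= M) ->
         is_solution d h V u ->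
         L2norm_sq d h u <= N ^ 2 ->
         Rbar_le (weighted_data d h (weight1 gam h) u) (Finite A) ->
         vanishes d u) /\
  (* Part 2 *)
  (forall (d : nat), (1 <= d)%nat ->
     exists mu0 : R,
       forall (mu h M : R) (V : list Z -> R -> R) (u : R -> list Z -> C),
         mu0 < mu -> 0 < h ->
         (forall j t, lat_pt d j -> 0 <= t <= 1 -> Rabs (V j t) <= M) ->
         is_solution d h V u ->
         Rbar_lt (weighted_data d h (weight2 mu h) u) p_infty ->
         vanishes d u).
Proof.
  split.
  (* With [s = / (10 h^2)] the data weight has [th = 4 / s^2 = (20 h^2)^2], and [4 th <= (2 / z)^2]
     for [z = gam / h^2] amounts to [gam <= / 20]. *)
  - intros d M N A Hd. exists (/ 20), 1. split; [lra|]. split; [lra|].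
    intros gam h V u Hg Hg0 Hh _ HV Hsol _ HA.
    assert (Hh2 : 0 < h ^ 2) by now apply pow_lt.
    assert (Hz : 0 < gam / h ^ 2) by (apply Rmult_lt_0_compat; [easy|now apply Rinv_0_lt_compat]).
    apply (vanishes_of_weight d h V u M
      (fun k => MacK (IZR k) (gam / h ^ 2) ^ 2 / MacK 0 (gam / h ^ 2) ^ 2) A); auto.
    + intros k. assert (H0 := MacK_0_pos _ Hz). assert (H1 := MacK_quot_ge1 (IZR k) _ Hz).
      replace (MacK (IZR k) (gam / h ^ 2) ^ 2 / MacK 0 (gam / h ^ 2) ^ 2)
        with ((MacK (IZR k) (gam / h ^ 2) / MacK 0 (gam / h ^ 2)) ^ 2) by (field; lra).
      nra.
    + replace (4 / (/ h ^ 2 / 10) ^ 2) with ((20 * h ^ 2) ^ 2) by (field; lra).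
      apply squared_weight_growth; [easy|apply pow2_ge_0|].
      replace (4 * (20 * h ^ 2) ^ 2) with ((40 * h ^ 2) ^ 2) by ring.
      apply pow_incr. split; [lra|].
      replace (2 / (gam / h ^ 2)) with (2 / gam * h ^ 2) by (field; lra).
      apply Rmult_le_compat_r; [lra|].
      apply Rmult_le_reg_r with gam; [easy|]. replace (2 / gam * gam) with 2 by (field; lra). lra.
    + apply (box_sum_le_of_lat_sum d _ (h ^ d) A); [now apply pow_lt|exact HA].
  - intros d Hd. exists 4. intros mu h M V u Hmu Hh HV Hsol HA.
    assert (Hh2 : 0 < h ^ 2) by now apply pow_lt.
    assert (Hz : 0 < 2 / (exp 1 * h ^ 2)).
    { apply Rmult_lt_0_compat; [lra|]. apply Rinv_0_lt_compat, Rmult_lt_0_compat; [apply exp_pos|easy]. }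
    destruct (box_sum_bounded_of_lat_sum d _ (h ^ d) (pow_lt _ _ Hh) HA) as [a Ha].
    apply (vanishes_of_weight d h V u M
      (fun k => MacK (IZR k * mu) (2 / (exp 1 * h ^ 2)) / MacK 0 (2 / (exp 1 * h ^ 2))) a); auto.
    + intros k. now apply MacK_quot_ge1.
    + apply stretched_weight_growth; [easy|easy|].
      apply Rmult_le_pos; [lra|]. left. apply Rinv_0_lt_compat, pow_lt.
      apply Rmult_lt_0_compat; [now apply Rinv_0_lt_compat|lra].
Qed.
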